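(* Let $\mathbb{G}$ be a coamenable locally compact quantum group and let $\omega\in \mathrm{M}(\mathbb{G})$ be a contractive idempotent functional. Then $L_\omega(\mathrm{C}_0(\mathbb{G}))$ is a ternary ring of operators (a sub-TRO of $\mathrm{C}_0(\mathbb{G})$), and $L_\omega:\mathrm{C}_0(\mathbb{G})\to L_\omega(\mathrm{C}_0(\mathbb{G}))$ is a TRO conditional expectation.
   Context: Locally compact quantum groups are in the $C^*$-algebraic sense of Kustermans and Vaes: $\mathbb{G}$ is given by a $C^*$-algebra $\mathrm{C}_0(\mathbb{G})$ with a coassociative nondegenerate $^*$-homomorphism $\Delta:\mathrm{C}_0(\mathbb{G})\to M(\mathrm{C}_0(\mathbb{G})\otimes \mathrm{C}_0(\mathbb{G}))$ (comultiplication) satisfying the cancellation laws $\overline{\mathrm{span}}\,\Delta(\mathrm{C}_0(\mathbb{G}))(\mathrm{C}_0(\mathbb{G})\otimes 1)=\mathrm{C}_0(\mathbb{G})\otimes \mathrm{C}_0(\mathbb{G})=\overline{\mathrm{span}}\,\Delta(\mathrm{C}_0(\mathbb{G}))(1\otimes \mathrm{C}_0(\mathbb{G}))$, and admitting faithful KMS left and right invariant Haar weights. $\mathbb{G}$ is coamenable if $\mathrm{C}_0(\mathbb{G})$ admits a bounded counit. $\mathrm{M}(\mathbb{G})=\mathrm{C}_0(\mathbb{G})^*$ with product $\omega\star\mu=(\omega\otimes\mu)\circ\Delta$. An idempotent functional is a nonzero $\omega\in \mathrm{M}(\mathbb{G})$ with $\omega\star\omega=\omega$; it is contractive if $\|\omega\|\le1$.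 The left convolution operator is $L_\omega:\mathrm{C}_0(\mathbb{G})\to \mathrm{C}_0(\mathbb{G})$, $L_\omega(a)=(\omega\otimes\mathrm{id})(\Delta(a))$. A ternary ring of operators (TRO) acting between Hilbert spaces $\mathsf{H}$ and $\mathsf{K}$ is a closed subspace $T\subseteq B(\mathsf{H};\mathsf{K})$ such that $ab^*c\in T$ whenever $a,b,c\in T$. (A $C^*$-algebra acting on a Hilbert space is a TRO.) A sub-TRO $X\subseteq T$ is a closed subspace of $T$ closed under the ternary product. A contractive linear map $P$ from $T$ onto a sub-TRO $X$ is a TRO conditional expectation if $P(ax^*y)=P(a)x^*y$, $P(xa^*y)=xP(a)^*y$ and $P(xy^*a)=xy^*P(a)$ for all $a\in T$ and $x,y\in X$. *)

(* Defs.v *)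
From HB Require Import structures.
From mathcomp Require Import all_boot all_order all_algebra.
From mathcomp Require Import complex.
From mathcomp Require Import all_classical all_reals all_analysis.
Set Implicit Arguments.
Unset Strict Implicit.
Unset Printing Implicit Defensive.
Import Order.TTheory GRing.Theory Num.Theory.
Import numFieldNormedType.Exports.
Local Open Scope classical_set_scope.
Local Open Scope ring_scope.
Local Open Scope complex_scope.

Section BoundedOperators.
Variables (R : realType) (H K : normedModType R[i]).

Definition bounded_linear : {pred H -> K} :=
  fun f => `[< linear f /\ exists M : R[i], forall x, `|f x| <= M * `|x| >].

Lemma bounded_linear_submod : submod_closed bounded_linear.
Proof.
split.
  apply/asboolP; split; first by move=> c x y; rewrite scaler0 addr0.
  by exists 0 => x; rewrite normr0 mul0r.
move=> c f g /asboolP[lf [M fM]] /asboolP[lg [N gN]]; apply/asboolP; split.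
  move=> d x y; rewrite !fctE lf lg !scalerDr !scalerA mulrC -!addrA.
  by congr (_ + _); rewrite addrCA.
exists (`|c| * M + N) => x; rewrite !fctE (le_trans (ler_normD _ _))// mulrDl.
by rewrite lerD// normrZ -mulrA ler_wpM2l.
Qed.

HB.instance Definition _ :=
  GRing.isSubmodClosed.Build R[i] (H -> K) bounded_linear bounded_linear_submod.

Record bop := Bop { bop_fun :> H -> K; bopP : bop_fun \in bounded_linear }.

HB.instance Definition _ := [isSub for bop_fun].
HB.instance Definition _ := [Choice of bop by <:].
HB.instance Definition _ := [SubChoice_isSubLmodule of bop by <:].

Lemma bop_linear (f : bop) : linear f.
Proof. by have /asboolP[] := bopP f. Qed.

HB.instance Definition _ (f : bop) :=
  GRing.isLinear.Build R[i] H K _ f (@bop_linear f).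


Definition bop_norm (f : bop) : R[i] :=
  (sup [set complex.Re `|f x| | x in [set x | `|x| <= 1]])%:C.

Let normE (V : normedModType R[i]) (x : V) : `|x| = (complex.Re `|x|)%:C.
Proof. by have /ger0_Im := normr_ge0 x; case: `|x| => a b /= ->. Qed.

Let lecR' (a b : R) : (a%:C <= b%:C :> R[i]) = (a <= b).
Proof. exact: lecR. Qed.

Let bop_normP' (f : bop) (M : R[i]) : 0 <= M ->
  bop_norm f <= M <-> (forall x, `|f x| <= M * `|x|).
Proof.
move=> M0; have [m mM] : exists m : R, M = m%:C.
  by have := ger0_Im M0; case: (M) => m i /= ->; exists m.
rewrite {}mM lecR' in M0 *.
set S := [set complex.Re `|f x| | x in [set x | `|x| <= 1]].
have S0 : S 0 by exists 0; rewrite /= ?normr0 ?linear0 ?normr0.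
have /asboolP[_ [B fB]] := bopP f.
have ubS : has_ubound S.
  exists (complex.Re `|B|) => _ [x /= x1 <-]; rewrite -lecR' -!normE.
  rewrite (le_trans (fB x))// (le_trans (real_ler_norm _))//.
    by rewrite realE (le_trans _ (fB x)).
  by rewrite normrM normr_id ler_piMr.
rewrite /bop_norm -/S lecR'; split=> [SM x|fM].
  have [->|x0] := eqVneq x 0; first by rewrite linear0 !normr0 mulr0.
  have nx : 0 < `|x| by rewrite normr_gt0.
  rewrite -ler_pdivrMr//; set y := `|x|^-1 *: x.
  have -> : `|f x| / `|x| = `|f y|.
    by rewrite linearZ/= normrZ normfV normr_id mulrC.
  rewrite normE lecR' (le_trans _ SM)//; apply: ub_le_sup => //.
  by exists y => //=; rewrite normrZ normfV normr_id mulVf// gt_eqF.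
apply: ge_sup; first by exists 0.
move=> _ [x /= x1 <-]; rewrite -lecR' -normE (le_trans (fM x))//.
by rewrite ler_piMr ?lecR'.
Qed.

Let bop_norm_ge0 f : 0 <= bop_norm f.
Proof.
rewrite /bop_norm lecR'; have /asboolP[_ [B fB]] := bopP f.
apply: ub_le_sup; last by exists 0; rewrite /= ?normr0 ?linear0 ?normr0.
exists (complex.Re `|B|) => _ [x /= x1 <-]; rewrite -lecR' -!normE.
rewrite (le_trans (fB x))// (le_trans (real_ler_norm _))//.
  by rewrite realE (le_trans _ (fB x)).
by rewrite normrM normr_id ler_piMr.
Qed.

Let le_bop_norm' (f : bop) x : `|f x| <= bop_norm f * `|x|.
Proof. by move: x; apply/bop_normP'. Qed.

Let bop_normD f g : bop_norm (f + g) <= bop_norm f + bop_norm g.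
Proof.
apply/bop_normP' => [|x]; first by rewrite addr_ge0.
by rewrite mulrDl (le_trans (ler_normD _ _))// lerD// le_bop_norm'.
Qed.

Let bop_normZ_le c f : bop_norm (c *: f) <= `|c| * bop_norm f.
Proof.
apply/bop_normP' => [|x]; first by rewrite mulr_ge0.
by rewrite normrZ -mulrA ler_wpM2l// le_bop_norm'.
Qed.

Let bop_norm0_eq0 f : bop_norm f = 0 -> f = 0.
Proof.
move=> f0; apply/val_inj/funext => x; apply/normr0_eq0/le_anti.
by rewrite normr_ge0 andbT (le_trans (le_bop_norm' _ _))// f0 mul0r.
Qed.

Let bop_normZ c f : bop_norm (c *: f) = `|c| * bop_norm f.
Proof.
have [->|c0] := eqVneq c 0.
  apply/le_anti/andP; split; first by rewrite (le_trans (bop_normZ_le _ _)).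
  by rewrite normr0 mul0r.
apply/le_anti; rewrite bop_normZ_le/=.
rewrite -ler_pdivlMl ?normr_gt0// -normfV.
by rewrite -{1}(scalerK c0 f) bop_normZ_le.
Qed.

HB.instance Definition _ := Lmodule_isNormed.Build R[i] bop
  bop_normD bop_normZ bop_norm0_eq0.

Lemma le_bop_norm (f : bop) x : `|f x| <= `|f| * `|x|.
Proof. exact: le_bop_norm'. Qed.

Lemma bop_normP (f : bop) (M : R[i]) : 0 <= M ->
  `|f| <= M <-> (forall x, `|f x| <= M * `|x|).
Proof. exact: bop_normP'. Qed.

End BoundedOperators.

Section Composition.
Variables (R : realType) (H K L : normedModType R[i]).

Lemma bid_subproof : (idfun : H -> H) \in @bounded_linear R H H.
Proof. by apply/asboolP; split=> //; exists 1 => x; rewrite mul1r. Qed.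

Definition bid : bop H H := Bop bid_subproof.

Lemma bcomp_subproof (g : bop K L) (f : bop H K) :
  g \o f \in @bounded_linear R H L.
Proof.
apply/asboolP; split=> [c x y /=|]; first by rewrite !linearP.
exists (`|g| * `|f|) => x /=.
rewrite (le_trans (le_bop_norm g _))// -mulrA.
by rewrite ler_wpM2l// le_bop_norm.
Qed.

Definition bcomp (g : bop K L) (f : bop H K) : bop H L :=
  Bop (bcomp_subproof g f).

End Composition.

Notation "g ** f" := (bcomp g f) (at level 40, left associativity).

Section LinearOn.
Variables (R : realType) (V W : normedModType R[i]).

Definition subspace (X : set V) :=
  X 0 /\ forall (c : R[i]) u v, X u -> X v -> X (c *: u + v).

Definition lin_span (X : set V) : set V :=
  [set v | exists n (c : 'I_n -> R[i]) (u : 'I_n -> V),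
     (forall i, X (u i)) /\ v = \sum_(i < n) c i *: u i].

Definition closed_span (X : set V) : set V := closure (lin_span X).

(** Maps out of a subspace [X] of [V] are represented by functions on [V] whose
    values outside [X] are irrelevant. *)
Definition linear_on (X : set V) (f : V -> W) :=
  forall (c : R[i]) u v, X u -> X v -> f (c *: u + v) = c *: f u + f v.

Definition bounded_linear_on (X : set V) (f : V -> W) :=
  linear_on X f /\ exists M : R[i], forall u, X u -> `|f u| <= M * `|u|.

End LinearOn.

Record hilbert (R : realType) := Hilbert {
  hilbert_space :> completeNormedModType R[i];
  hdot : {dot hilbert_space for Num.conj};
  hdotE : forall x : hilbert_space, `|x| ^+ 2 = hdot x x }.

(** The adjoint; it exists by the Riesz representation theorem. *)
Definition adj (R : realType) (H K : hilbert R) (a : bop H K) : bop K H :=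
  get [set b : bop K H | forall x y, hdot K (a x) y = hdot H x (b y)].

(** [htensor H K L] is the data identifying [L] with the Hilbert space tensor
    product of [H] and [K]; [htens x y] is the elementary tensor. *)
Record htensor (R : realType) (H K L : hilbert R) := HTensor {
  htens :> H -> K -> L;
  htens_linearl : forall y, linear (htens^~ y);
  htens_linearr : forall x, linear (htens x);
  htens_dot : forall x x' y y',
    hdot L (htens x y) (htens x' y') = hdot H x x' * hdot K y y';
  htens_dense : closed_span [set htens x y | x in setT & y in setT] = setT }.

Section CstarAlgebra.
Variables (R : realType) (H : hilbert R).
Implicit Types A : set (bop H H).

Definition cstar_algebra A :=
  [/\ subspace A, closed A, forall a b, A a -> A b -> A (a ** b) &
      forall a, A a -> A (adj a)].

Definition nondegenerate A :=
  closed_span [set (a : bop H H) x | a in A & x in setT] = setT.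

Definition multiplier A : set (bop H H) :=
  [set m | forall a, A a -> A (m ** a) /\ A (a ** m)].

Definition positive A : set (bop H H) := [set adj a ** a | a in A].

Definition star_hom (K : hilbert R) A (p : bop H H -> bop K K) :=
  [/\ linear_on A p,
      forall a b, A a -> A b -> p (a ** b) = p a ** p b &
      forall a, A a -> p (adj a) = adj (p a)].

(** The filter on the closed unit ball of [A] of the strict neighbourhoods of
    the unit of M(A): convergence along it is convergence along every
    contractive approximate unit of [A]. *)
Definition approx_unit A : set_system (bop H H) :=
  [set U | exists (s : seq (bop H H)) (r : R[i]),
     [/\ 0 < r, forall b, b \in s -> A b &
         forall u, A u -> `|u| <= 1 ->
           (forall b, b \in s -> `|u ** b - b| < r /\ `|b ** u - b| < r) ->
           U u]].

Definition functional A (w : bop H H -> R[i]) :=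
  @bounded_linear_on R (bop H H) R[i]^o A w.

Definition positive_functional A (w : bop H H -> R[i]) :=
  functional A w /\ forall a, positive A a -> 0 <= w a.

(** Strict extensions to M(A): of functionals on [A], of strict maps from [A]
    into a C*-algebra [B] (the limit is taken in the strict topology of M(B)),
    and of nondegenerate representations of [A]. *)
Definition functional_ext A (w : bop H H -> R[i]) (m : bop H H) : R[i] :=
  lim ((w (m ** u) : R[i]^o) @[u --> approx_unit A]).

Definition strict_ext (K : hilbert R) A (B : set (bop K K))
    (E : bop H H -> bop K K) (m : bop H H) : bop K K :=
  get [set n : bop K K | forall b, B b ->
    (E (m ** u) ** b @[u --> approx_unit A] --> n ** b) /\
    (b ** E (m ** u) @[u --> approx_unit A] --> b ** n)].

Definition hom_ext (K : hilbert R) A (p : bop H H -> bop K K) (m : bop H H) :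
    bop K K :=
  get [set n : bop K K | forall a, A a -> n ** p a = p (m ** a)].

End CstarAlgebra.

Section TensorProduct.
Variables (R : realType) (H K L : hilbert R) (t : htensor H K L).

Definition op_tens (a : bop H H) (b : bop K K) : bop L L :=
  get [set c : bop L L | forall x y, c (t x y) = t (a x) (b y)].

Definition min_tens (A : set (bop H H)) (B : set (bop K K)) : set (bop L L) :=
  closed_span [set op_tens a b | a in A & b in B].

(** The bounded linear map on the minimal tensor product of [A] and [B] that
    sends the elementary tensor of [a] and [b] to [f a b]. *)
Definition tens_map (V : normedModType R[i]) (A : set (bop H H))
    (B : set (bop K K)) (f : bop H H -> bop K K -> V) : bop L L -> V :=
  get [set E : bop L L -> V | bounded_linear_on (min_tens A B) E /\
    forall a b, A a -> B b -> E (op_tens a b) = f a b].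

End TensorProduct.

Section Weights.
Variables (R : realType) (H : hilbert R) (A : set (bop H H)).
Implicit Type phi : bop H H -> \bar R.

(** Only the values of [phi] on the positive cone of [A] matter. *)
Definition weight phi :=
  [/\ forall a, positive A a -> (0 <= phi a)%E,
      forall a b, positive A a -> positive A b ->
        phi (a + b) = (phi a + phi b)%E &
      forall (r : R) a, 0 <= r -> positive A a ->
        phi (r%:C *: a) = (r%:E * phi a)%E].

Definition proper_weight phi :=
  [/\ weight phi,
      exists2 a, positive A a & phi a != 0%E,
      positive A `<=` closure [set a | positive A a /\ (phi a < +oo)%E] &
      forall l : R, closed [set a | positive A a /\ (phi a <= l%:E)%E]].

Definition faithful_weight phi := forall a, positive A a -> phi a = 0%E -> a = 0.

Definition one_parameter_group (s : R -> bop H H -> bop H H) :=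
  [/\ forall r, star_hom A (s r) /\ (forall a, A a -> A (s r a)),
      forall a, A a -> s 0 a = a,
      forall q r a, A a -> s (q + r) a = s q (s r a) &
      forall a, A a -> continuous (s^~ a)].

(** [a] is in the domain of s_{i/2}, with value [b] there. *)
Definition half_generator (s : R -> bop H H -> bop H H) (a b : bop H H) :=
  exists f : R[i]^o -> bop H H,
    let strip : set R[i]^o :=
      [set z | 0 <= complex.Im z /\ complex.Im z <= 2^-1] in
    [/\ forall z, strip z -> A (f z),
        {within strip, continuous f},
        forall z : R[i]^o, 0 < complex.Im z -> complex.Im z < 2^-1 ->
          derivable f z 1,
        forall r : R, f r%:C = s r a &
        f (0 +i* 2^-1) = b].

Definition kms_weight phi :=
  proper_weight phi /\
  exists s, [/\ one_parameter_group s,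
    forall r a, positive A a -> phi (s r a) = phi a &
    forall a b, A a -> half_generator s a b ->
      phi (adj a ** a) = phi (b ** adj b)].

End Weights.

(** The C*-algebra C_0(G) is given by a faithful representation on [qg_H], which
    is nondegenerate (field [C0_nondegenerate] of [lcqg]); [qg_H2] and [qg_H3] are the tensor square and cube of
    [qg_H], the latter with both bracketings. *)
Record qg_data (R : realType) := QGData {
  qg_H : hilbert R;
  qg_H2 : hilbert R;
  qg_H3 : hilbert R;
  qg_t : htensor qg_H qg_H qg_H2;
  qg_tl : htensor qg_H2 qg_H qg_H3;
  qg_tr : htensor qg_H qg_H2 qg_H3;
  qg_tA : forall x y z, qg_tl (qg_t x y) z = qg_tr x (qg_t y z);
  C0 : set (bop qg_H qg_H);
  Delta : bop qg_H qg_H -> bop qg_H2 qg_H2 }.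

Arguments C0 {R} q _.
Arguments Delta {R} q a.

Section Convolution.
Variables (R : realType) (G : qg_data R).
Local Notation op := (bop (qg_H G) (qg_H G)).
Local Notation op2 := (bop (qg_H2 G) (qg_H2 G)).
Local Notation op3 := (bop (qg_H3 G) (qg_H3 G)).
Implicit Types (w m : op -> R[i]) (a b : op).

Definition C0C0 : set op2 := min_tens (qg_t G) (C0 G) (C0 G).

(** w (x) m, w (x) id and id (x) w on M(C_0(G) (x) C_0(G)) *)
Definition slice2 w m : op2 -> R[i] :=
  functional_ext C0C0
    (tens_map (qg_t G) (C0 G) (C0 G) (fun a b => w a * m b : R[i]^o)).

Definition slice_l w : op2 -> op :=
  strict_ext C0C0 (C0 G)
    (tens_map (qg_t G) (C0 G) (C0 G) (fun a b => w a *: b)).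

Definition slice_r w : op2 -> op :=
  strict_ext C0C0 (C0 G)
    (tens_map (qg_t G) (C0 G) (C0 G) (fun a b => w b *: a)).

(** Delta (x) id and id (x) Delta on M(C_0(G) (x) C_0(G)) *)
Definition Delta_id : op2 -> op3 :=
  hom_ext C0C0 (tens_map (qg_t G) (C0 G) (C0 G)
    (fun a b => op_tens (qg_tl G) (Delta G a) b)).

Definition id_Delta : op2 -> op3 :=
  hom_ext C0C0 (tens_map (qg_t G) (C0 G) (C0 G)
    (fun a b => op_tens (qg_tr G) a (Delta G b))).

Definition comultiplication :=
  [/\ star_hom (C0 G) (Delta G),
      forall a, C0 G a -> multiplier C0C0 (Delta G a),
      closed_span [set Delta G a ** b | a in C0 G & b in C0C0] = C0C0 &
      forall a, C0 G a -> Delta_id (Delta G a) = id_Delta (Delta G a)].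

Definition cancellation :=
  closed_span [set Delta G a ** op_tens (qg_t G) b (bid _) |
    a in C0 G & b in C0 G] = C0C0 /\
  closed_span [set Delta G a ** op_tens (qg_t G) (bid _) b |
    a in C0 G & b in C0 G] = C0C0.

(** The factor [w(1)] is the value at 1 of the strict extension of [w]. *)
Definition left_invariant (phi : op -> \bar R) :=
  forall w a, positive_functional (C0 G) w -> positive (C0 G) a ->
    (phi a < +oo)%E ->
    phi (slice_l w (Delta G a)) =
      ((complex.Re (functional_ext (C0 G) w (bid _)))%:E * phi a)%E.

Definition right_invariant (phi : op -> \bar R) :=
  forall w a, positive_functional (C0 G) w -> positive (C0 G) a ->
    (phi a < +oo)%E ->
    phi (slice_r w (Delta G a)) =
      ((complex.Re (functional_ext (C0 G) w (bid _)))%:E * phi a)%E.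

Definition coamenable :=
  exists2 e, functional (C0 G) e & forall a, C0 G a ->
    slice_l e (Delta G a) = a /\ slice_r e (Delta G a) = a.

Definition convolution w m : op -> R[i] := fun a => slice2 w m (Delta G a).

Definition idempotent_functional w :=
  [/\ functional (C0 G) w, exists2 a, C0 G a & w a != 0 &
      forall a, C0 G a -> convolution w w a = w a].

Definition contractive_functional w := forall a, C0 G a -> `|w a| <= `|a|.

Definition conv_op w : op -> op := fun a => slice_l w (Delta G a).

End Convolution.

Record lcqg (R : realType) := Lcqg {
  lcqg_data :> qg_data R;
  C0_cstar : cstar_algebra (C0 lcqg_data);
  C0_nondegenerate : nondegenerate (C0 lcqg_data);
  lcqg_comultiplication : comultiplication lcqg_data;
  lcqg_cancellation : cancellation lcqg_data;
  lcqg_left_haar : exists phi, [/\ kms_weight (C0 lcqg_data) phi,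
    faithful_weight (C0 lcqg_data) phi & left_invariant phi];
  lcqg_right_haar : exists phi, [/\ kms_weight (C0 lcqg_data) phi,
    faithful_weight (C0 lcqg_data) phi & right_invariant phi] }.

Section TRO.
Variables (R : realType) (H K : hilbert R).
Implicit Types T X : set (bop H K).

Definition tro T :=
  [/\ subspace T, closed T &
      forall a b c, T a -> T b -> T c -> T (a ** adj b ** c)].

Definition sub_tro T X := X `<=` T /\ tro X.

Definition tro_conditional_expectation T X (P : bop H K -> bop H K) :=
  [/\ linear_on T P, forall a, T a -> `|P a| <= `|a|, P @` T = X &
      forall a x y, T a -> X x -> X y ->
        [/\ P (a ** adj x ** y) = P a ** adj x ** y,
            P (x ** adj a ** y) = x ** adj (P a) ** y &
            P (x ** adj y ** a) = x ** adj y ** P a]].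

End TRO.

(* Main.v *)
Require Import Defs.
From HB Require Import structures.
From mathcomp Require Import all_boot all_order all_algebra.
From mathcomp Require Import complex.
From mathcomp Require Import all_classical all_reals all_analysis.
From mathcomp Require Import ring lra.
Set Implicit Arguments.
Unset Strict Implicit.
Unset Printing Implicit Defensive.
Import Order.TTheory GRing.Theory Num.Theory.
Import numFieldNormedType.Exports.
Local Open Scope classical_set_scope.
Local Open Scope ring_scope.
Local Open Scope complex_scope.

(* Contractivity makes [w] norm-attaining in the limit: along elements [c] of the
   unit ball with [w c -> 1], the functionals [w (c b)] and [w (b c)] converge to
   states [psi] and [om], the right and left absolute values of [w].  Write [V'] for
   the adjoint of [V].  Comparing the norm of
   [(1 - s/2 V V') c (1 - s/2 T' T) + s V T] with [1 + O(s^2)] gives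
   [2 Re w(V T) <= om(V V') + psi(T' T)], whence [(L a)' L a <= L_psi (a' a)].
   If [L x = x], the left Haar weight, which [L_psi] does not increase, forces
   [L_psi (x' x) = x' x].  The first order condition in this equality case gives
   [L (a x) = L_om a x] and [L_om (a x') = L a x'], and the three identities of a
   conditional expectation follow by composing these for [w] and its adjoint.

   Operators on a tensor product are handled through their slices
   [(1 (x) y)' X (1 (x) x)], so that [L] becomes the operator with matrix
   coefficients [<L a x, y> = w (slice of Delta a)]; coassociativity then gives
   [L L = L]. *)

(** The polar decomposition of [w] lives in the bidual of [C0 G]; the definition [polar] avoids the
    bidual by keeping elements [c] of the algebra that do its work up to [e]. They exist because
    idempotence forces norm one: since [w = w L], a norm [q < 1] would improve to [q ^ n] for every
    [n]. The element whose norm is compared with [1 + O(s^2)] is a row times a column, and the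
    coefficient [1/2] cancels the first order terms of both norms. Letting [V] and [T] pass through
    another Hilbert space makes the inequality apply directly to [V = (1 (x) y)'] and
    [T = Delta a (1 (x) x)], in place of an argument on complete positivity. Such a [V V'] is a
    scalar, which may lie outside the algebra; hence the form [k + a], with the scalar estimated
    separately. The Haar weight may be infinite at [x' x]. Faithfulness is therefore used at [L a]
    with [a' a] of finite weight, and such elements are dense among the fixed points. Strict
    extensions and maps on tensor products are given by a choice or a limit, so each must be shown
    to exist and be unique before it can be computed; this is where the slices come in. *)

Local Notation cj := (@Num.conj _).

(** * Norms and moduli as real numbers *)

Section RealNorm.
Variable R : realType.
Implicit Types (V : normedModType R[i]) (c d : R[i]).

(** Norms over [R[i]] take values in [R[i]]; the real part puts every estimate in the ordered field
    [R]. *)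
Definition rnm V (x : V) : R := complex.Re `|x|.
Definition cab c : R := complex.Re `|c|.

Lemma rnmE V (x : V) : `|x| = (rnm x)%:C.
Proof. by rewrite /rnm; have /ger0_Im := normr_ge0 x; case: `|x| => a b /= ->. Qed.

Lemma cabE c : `|c| = (cab c)%:C.
Proof. by rewrite /cab; have /ger0_Im := normr_ge0 c; case: `|c| => a b /= ->. Qed.

Lemma lecC (a b : R) : (a%:C <= b%:C :> R[i]) = (a <= b).
Proof. exact: lecR. Qed.

Lemma ltcC (a b : R) : (a%:C < b%:C :> R[i]) = (a < b).
Proof. exact: ltcR. Qed.

Lemma rnm_le V (x : V) (e : R) : (`|x| <= e%:C) = (rnm x <= e).
Proof. by rewrite rnmE lecC. Qed.

Lemma rnm_lt V (x : V) (e : R) : (`|x| < e%:C) = (rnm x < e).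
Proof. by rewrite rnmE ltcC. Qed.

Lemma rnm_lt_i V (x : V) (e : R) : rnm x < e -> `|x| < e%:C.
Proof. by rewrite rnm_lt. Qed.

Lemma rnm_lt_e V (x : V) (e : R) : `|x| < e%:C -> rnm x < e.
Proof. by rewrite rnm_lt. Qed.

Lemma rC_inj (a b : R) : a%:C = b%:C :> R[i] -> a = b.
Proof. by case. Qed.

Lemma rCD (a b : R) : (a + b)%:C = a%:C + b%:C :> R[i].
Proof. exact: rmorphD. Qed.

Lemma rCB (a b : R) : (a - b)%:C = a%:C - b%:C :> R[i].
Proof. exact: rmorphB. Qed.

Lemma rCM (a b : R) : (a * b)%:C = a%:C * b%:C :> R[i].
Proof. exact: rmorphM. Qed.

Lemma rC1 : 1%:C = 1 :> R[i]. Proof. by []. Qed.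

Lemma rnm_ge0 V (x : V) : 0 <= rnm x.
Proof. by rewrite -lecC -rnmE; exact: normr_ge0. Qed.

Lemma rnm0 V : rnm (0 : V) = 0.
Proof. by rewrite /rnm normr0. Qed.

Lemma rnm_eq0 V (x : V) : rnm x = 0 -> x = 0.
Proof. by move=> x0; apply/normr0_eq0; rewrite rnmE x0. Qed.

Lemma rnmD V (x y : V) : rnm (x + y) <= rnm x + rnm y.
Proof. by rewrite -lecC rCD -!rnmE ler_normD. Qed.

Lemma rnmN V (x : V) : rnm (- x) = rnm x.
Proof. by rewrite /rnm normrN. Qed.

Lemma rnmBC V (x y : V) : rnm (x - y) = rnm (y - x).
Proof. by rewrite /rnm distrC. Qed.

Lemma rnmB V (x y : V) : rnm (x - y) <= rnm x + rnm y.
Proof. by rewrite -(rnmN y) rnmD. Qed.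

Lemma rnm_tri V (y x z : V) : rnm (x - z) <= rnm (x - y) + rnm (y - z).
Proof. by have := rnmD (x - y) (y - z); rewrite addrA subrK. Qed.

Lemma rnmZ V c (x : V) : rnm (c *: x) = cab c * rnm x.
Proof. by apply: rC_inj; rewrite rCM -cabE -!rnmE normrZ. Qed.

Lemma rnm_small V (x : V) : (forall e : R, 0 < e -> rnm x <= e) -> x = 0.
Proof.
move=> xe; apply: rnm_eq0; apply/le_anti; rewrite rnm_ge0 andbT.
by apply/ler_addgt0Pr => e e0; rewrite add0r xe.
Qed.

Lemma cab_ge0 c : 0 <= cab c.
Proof. by rewrite -lecC -cabE; exact: normr_ge0. Qed.

Lemma cab0 : cab 0 = 0. Proof. by rewrite /cab normr0. Qed.
Lemma cab1 : cab 1 = 1. Proof. by rewrite /cab normr1. Qed.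

Lemma cabM c d : cab (c * d) = cab c * cab d.
Proof. by apply: rC_inj; rewrite rCM -!cabE normrM. Qed.

Lemma cabD c d : cab (c + d) <= cab c + cab d.
Proof. by rewrite -lecC rCD -!cabE ler_normD. Qed.

Lemma cabN c : cab (- c) = cab c.
Proof. by rewrite /cab normrN. Qed.

Lemma cabBC c d : cab (c - d) = cab (d - c).
Proof. by rewrite /cab distrC. Qed.

Lemma cab_tri d c e : cab (c - e) <= cab (c - d) + cab (d - e).
Proof. by have := cabD (c - d) (d - e); rewrite addrA subrK. Qed.

Lemma cab_conj c : cab (cj c) = cab c.
Proof. by rewrite /cab norm_conjC. Qed.

Lemma cab_real (r : R) : cab r%:C = `|r|.
Proof. by apply: rC_inj; rewrite -cabE normc_def/= expr0n/= addr0 sqrtr_sqr. Qed.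

Lemma cabV c : cab c^-1 = (cab c)^-1.
Proof. by apply: rC_inj; rewrite -cabE normfV cabE -fmorphV. Qed.

Lemma cab_eq0 c : cab c = 0 -> c = 0.
Proof. by move=> c0; apply/normr0_eq0; rewrite cabE c0. Qed.

Lemma cab_small c : (forall e : R, 0 < e -> cab c <= e) -> c = 0.
Proof.
move=> xe; apply: cab_eq0; apply/le_anti; rewrite cab_ge0 andbT.
by apply/ler_addgt0Pr => e e0; rewrite add0r xe.
Qed.

Lemma norm_Re_le c : `|complex.Re c| <= cab c.
Proof.
rewrite /cab normc_def/= -sqrtr_sqr ler_wsqrtr//.
by rewrite lerDl sqr_ge0.
Qed.

Lemma Re_le c : complex.Re c <= cab c.
Proof. exact: le_trans (ler_norm _) (norm_Re_le _). Qed.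

Lemma norm_Im_le c : `|complex.Im c| <= cab c.
Proof.
rewrite /cab normc_def/= -sqrtr_sqr ler_wsqrtr//.
by rewrite lerDr sqr_ge0.
Qed.

Lemma cab_ReIm c : cab c <= `|complex.Re c| + `|complex.Im c|.
Proof.
case: c => a b; have -> : a +i* b = a%:C + 'i%C * b%:C.
  by simpc.
rewrite (le_trans (cabD _ _))//= cabM !cab_real.
have -> : cab 'i%C = 1 by rewrite /cab normc_def/= expr0n expr1n add0r sqrtr1.
by rewrite /= !(mul1r, mul0r, mulr0, subr0, addr0, add0r).
Qed.

Lemma ReD c d : complex.Re (c + d) = complex.Re c + complex.Re d.
Proof. exact: raddfD. Qed.
Lemma ReB c d : complex.Re (c - d) = complex.Re c - complex.Re d.
Proof. exact: raddfB. Qed.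
Lemma ReN c : complex.Re (- c) = - complex.Re c.
Proof. exact: raddfN. Qed.
Lemma Re_sum (I : Type) (r : seq I) (F : I -> R[i]) :
  complex.Re (\sum_(i <- r) F i) = \sum_(i <- r) complex.Re (F i).
Proof. exact: raddf_sum. Qed.
Lemma Re_cj c : complex.Re (cj c) = complex.Re c.
Proof. by case: c. Qed.
Lemma Re_scale (r : R) c : complex.Re (r%:C * c) = r * complex.Re c.
Proof. by case: c => a b; simpc. Qed.

(** Rotating by such an [s] turns bounds on real parts into bounds on moduli. *)
Lemma Re_phase c : exists2 s, cab s = 1 & s * c = (cab c)%:C.
Proof.
have [->|c0] := eqVneq c 0; first by exists 1; rewrite ?cab1// mulr0 cab0.
have n0 : cab c != 0 by apply: contra_neq c0 => /cab_eq0.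
exists ((cj c) / (cab c)%:C).
  by rewrite cabM cab_conj cabV cab_real ger0_norm ?cab_ge0// divff.
rewrite mulrAC (mulrC (cj c)).
have -> : c * cj c = ((cab c) ^+ 2)%:C by rewrite -normCK cabE -rmorphXn.
by rewrite -fmorphV -rCM expr2 mulfK.
Qed.

End RealNorm.

(** * Inner products *)

Section Hilbert.
Variables (R : realType) (H : hilbert R).
Implicit Types x y z : H.

Lemma dotDl x y z : hdot H (x + y) z = hdot H x z + hdot H y z.
Proof. exact: linearDl. Qed.
Lemma dotDr x y z : hdot H z (x + y) = hdot H z x + hdot H z y.
Proof. exact: linearDr. Qed.
Lemma dotNl x z : hdot H (- x) z = - hdot H x z.
Proof. exact: linearNl. Qed.
Lemma dotNr x z : hdot H z (- x) = - hdot H z x.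
Proof. exact: linearNr. Qed.
Lemma dotBl x y z : hdot H (x - y) z = hdot H x z - hdot H y z.
Proof. exact: linearBl. Qed.
Lemma dotBr x y z : hdot H z (x - y) = hdot H z x - hdot H z y.
Proof. exact: linearBr. Qed.
Lemma dot0l x : hdot H 0 x = 0.
Proof. exact: linear0l. Qed.
Lemma dot0r x : hdot H x 0 = 0.
Proof. exact: linear0r. Qed.
Lemma dotZl c x y : hdot H (c *: x) y = c * hdot H x y.
Proof. exact: linearZl_LR. Qed.
Lemma dotZr c x y : hdot H x (c *: y) = (cj c) * hdot H x y.
Proof. exact: linearZr_LR. Qed.
Lemma dot_suml (I : Type) (r : seq I) (F : I -> H) y :
  hdot H (\sum_(i <- r) F i) y = \sum_(i <- r) hdot H (F i) y.
Proof. exact: linear_sumlz. Qed.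
Lemma dotC x y : hdot H x y = cj (hdot H y x).
Proof. by rewrite hermC expr0 mul1r. Qed.

Lemma dotxx x : hdot H x x = (rnm x ^+ 2)%:C.
Proof. by rewrite -hdotE rnmE rmorphXn. Qed.

Lemma Re_dotC x y : complex.Re (hdot H x y) = complex.Re (hdot H y x).
Proof. by rewrite dotC Re_cj. Qed.

Lemma rnm_sqD x y :
  rnm (x + y) ^+ 2 = rnm x ^+ 2 + rnm y ^+ 2 + 2 * complex.Re (hdot H x y).
Proof.
have := congr1 (@complex.Re R) (dotxx (x + y)) => /= <-.
rewrite dotDl !dotDr !dotxx !ReD/= (Re_dotC y x); lra.
Qed.

Lemma rnm_sqB x y :
  rnm (x - y) ^+ 2 = rnm x ^+ 2 + rnm y ^+ 2 - 2 * complex.Re (hdot H x y).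
Proof. by rewrite rnm_sqD rnmN dotNr ReN mulrN. Qed.

Lemma parallelogram x y :
  rnm (x + y) ^+ 2 + rnm (x - y) ^+ 2 = 2 * rnm x ^+ 2 + 2 * rnm y ^+ 2.
Proof. rewrite rnm_sqD rnm_sqB; lra. Qed.

Lemma cauchy_schwarz x y : cab (hdot H x y) <= rnm x * rnm y.
Proof.
have [s s1 sxy] := Re_phase (hdot H x y).
have -> : cab (hdot H x y) = complex.Re (hdot H (s *: x) y) by rewrite dotZl sxy.
have -> : rnm x = rnm (s *: x) by rewrite rnmZ s1 mul1r.
move: (s *: x) => {s s1 sxy} {}x.
have [y0|y0] := eqVneq (rnm y) 0.
  by rewrite (rnm_eq0 y0) dot0r/= rnm0 mulr0.
have yp : 0 < rnm y by rewrite lt_neqAle eq_sym y0 rnm_ge0.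
have [x0|x0] := eqVneq (rnm x) 0.
  by rewrite (rnm_eq0 x0) dot0l/= rnm0 mul0r.
have xp : 0 < rnm x by rewrite lt_neqAle eq_sym x0 rnm_ge0.
(* Expanded, the square is [2 p (p - Re <x, y>)] with [p = rnm x * rnm y]. *)
have := sqr_ge0 (rnm ((rnm y)%:C *: x - (rnm x)%:C *: y)).
rewrite rnm_sqB dotZl dotZr !rnmZ !cab_real !ger0_norm ?rnm_ge0//.
have -> : cj ((rnm x)%:C : R[i]) = (rnm x)%:C by exact: conjc_real.
rewrite mulrA -rCM Re_scale !exprMn (mulrC (rnm y ^+ 2)).
rewrite -exprMn => h.
have p : 0 < rnm x * rnm y by rewrite mulr_gt0.
rewrite -(ler_pM2l p); move: h; rewrite (mulrC (rnm y)) expr2; lra.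
Qed.

Lemma dot_ext x : (forall y, hdot H x y = 0) -> x = 0.
Proof.
move=> /(_ x); rewrite dotxx => /(rC_inj (b := 0)) /eqP.
by rewrite sqrf_eq0 => /eqP /rnm_eq0.
Qed.

Lemma dot_ext_eq x y : (forall z, hdot H x z = hdot H y z) -> x = y.
Proof.
move=> xy; apply/eqP; rewrite -subr_eq0; apply/eqP/dot_ext => z.
by rewrite dotBl xy subrr.
Qed.

End Hilbert.

(** * Closures, limits and completeness *)

Section RealTopology.
Variables (R : realType) (V : normedModType R[i]).
Implicit Types (x y : V) (A : set V).

Lemma ball_rnm x (e : R) y : ball x e%:C y = (rnm (x - y) < e) :> Prop.
Proof. by rewrite -ball_normE /ball_/= rnmE ltcC. Qed.

Lemma posC (e : R[i]) : 0 < e -> exists2 r : R, 0 < r & e = r%:C.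
Proof.
case: e => a b; rewrite ltcE/= => /andP[/eqP -> a0]; by exists a.
Qed.

Lemma closure_rnm A x :
  closure A x <-> forall e : R, 0 < e -> exists2 y, A y & rnm (x - y) < e.
Proof.
split=> [cA e e0|h].
  have e0' : 0 < e%:C :> R[i] by rewrite ltcC.
  have [y [Ay xy]] := cA _ (nbhsx_ballx x _ e0').
  by exists y => //; rewrite -ball_rnm.
move=> B /nbhs_ballP[_ /posC[r r0 ->] rB].
by have [y Ay xy] := h r r0; exists y; split=> //; apply: rB; rewrite /= ball_rnm.
Qed.

Lemma closed_rnm A : closed A <->
  forall x, (forall e : R, 0 < e -> exists2 y, A y & rnm (x - y) < e) -> A x.
Proof.
split=> [cA x /closure_rnm|h x /closure_rnm]; first exact: cA.
exact: h.
Qed.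

Lemma cvg_rnm (T : Type) (F : set_system T) (FF : Filter F) (f : T -> V) x :
  f @ F --> x <-> forall e : R, 0 < e -> F [set u | rnm (x - f u) < e].
Proof.
split=> [fx e e0|h].
  have e0' : 0 < e%:C :> R[i] by rewrite ltcC.
  have h : F [set u | ball x e%:C (f u)] := fx _ (nbhsx_ballx x _ e0').
  by apply: filterS h => u /=; rewrite ball_rnm.
move=> B /nbhs_ballP[_ /posC[r r0 ->] rB].
have hr := h r r0; change (F (f @^-1` B)).
by apply: filterS hr => u /= xu; apply: rB; rewrite /= ball_rnm.
Qed.

End RealTopology.

Definition cauchy_rnm (R : realType) (V : normedModType R[i]) (u : nat -> V) :=
  forall e : R, 0 < e -> exists N, forall m n, (N <= m)%N -> (N <= n)%N ->
    rnm (u m - u n) < e.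

Definition lim_rnm (R : realType) (V : normedModType R[i]) (u : nat -> V) x :=
  forall e : R, 0 < e -> exists N, forall n, (N <= n)%N -> rnm (u n - x) < e.

Lemma complete_rnm (R : realType) (V : completeNormedModType R[i]) (u : nat -> V) :
  cauchy_rnm u -> exists x, lim_rnm u x.
Proof.
move=> cu.
have : cauchy (u @ \oo).
  apply/cauchy_ballP => _ /posC[e e0 ->].
  have [N uN] := cu e e0.
  exists (u @` [set n | (N <= n)%N], u @` [set n | (N <= n)%N]) => /=.
    by split; exists N => // n /= Nn; exists n.
  by case=> _ _ [/= [m Nm <-] [n Nn <-]]; rewrite ball_rnm; exact: uN.
move=> /cauchy_cvg => cvgu.
exists (lim (u @ \oo)) => e e0.
have /cvg_rnm /(_ e e0) [N _ h] := cvgu.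
by exists N => n Nn; rewrite rnmBC; exact: h.
Qed.

(** * Algebra and completeness of bounded operators *)

Section BopBasics.
Variables (R : realType).
Implicit Types H K L : normedModType R[i].

Lemma bop_eq H K (a b : bop H K) : a =1 b -> a = b.
Proof. by move=> ab; apply/val_inj/funext. Qed.

Lemma bopD H K (a b : bop H K) x : bop_fun (a + b) x = bop_fun a x + bop_fun b x. Proof. by []. Qed.
Lemma bopN H K (a : bop H K) x : bop_fun (- a) x = - bop_fun a x. Proof. by []. Qed.
Lemma bopB H K (a b : bop H K) x : bop_fun (a - b) x = bop_fun a x - bop_fun b x. Proof. by []. Qed.
Lemma bopZ H K c (a : bop H K) x : bop_fun (c *: a) x = c *: bop_fun a x. Proof. by []. Qed.
Lemma bop0 H K x : bop_fun (0 : bop H K) x = 0. Proof. by []. Qed.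
Lemma bop_sum H K (I : Type) (r : seq I) (F : I -> bop H K) x :
  bop_fun (\sum_(i <- r) F i) x = \sum_(i <- r) bop_fun (F i) x.
Proof. by elim/big_rec2: _ => // i _ y _ <-. Qed.

Lemma rnm_bop H K (a : bop H K) x : rnm (a x) <= rnm a * rnm x.
Proof. by rewrite -lecC rCM -!rnmE le_bop_norm. Qed.

Lemma rnm_bopP H K (a : bop H K) (M : R) : 0 <= M ->
  (forall x, rnm (a x) <= M * rnm x) -> rnm a <= M.
Proof.
move=> M0 aM; rewrite -lecC -rnmE; apply/bop_normP => [|x]; first by rewrite lecC.
by rewrite !rnmE -rCM lecC.
Qed.

Lemma bopE_exists H K (f : H -> K) (M : R) : linear f ->
  (forall x, rnm (f x) <= M * rnm x) -> exists b : bop H K, b =1 f.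
Proof.
move=> lf fM; have fb : f \in @bounded_linear R H K.
  apply/asboolP; split=> //; exists M%:C => x.
  by rewrite !rnmE -rCM lecC.
by exists (Bop fb).
Qed.

Lemma bop_rD H K (a : bop H K) x y : a (x + y) = a x + a y.
Proof. exact: linearD. Qed.
Lemma bop_rN H K (a : bop H K) x : a (- x) = - a x.
Proof. exact: linearN. Qed.
Lemma bop_rB H K (a : bop H K) x y : a (x - y) = a x - a y.
Proof. exact: linearB. Qed.
Lemma bop_rZ H K (a : bop H K) c x : a (c *: x) = c *: a x.
Proof. exact: linearZ. Qed.
Lemma bop_r0 H K (a : bop H K) : a 0 = 0.
Proof. exact: linear0. Qed.
Lemma bop_r_sum H K (a : bop H K) (I : Type) (r : seq I) (F : I -> H) :
  a (\sum_(i <- r) F i) = \sum_(i <- r) a (F i).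
Proof. exact: linear_sum. Qed.
Lemma bidE H x : bid H x = x. Proof. by []. Qed.
Lemma bcompE H K L (a : bop K L) (b : bop H K) x : bop_fun (a ** b) x = bop_fun a (bop_fun b x).
Proof. by []. Qed.
Lemma bcompA H K L M (a : bop L M) (b : bop K L) (c : bop H K) :
  a ** (b ** c) = a ** b ** c.
Proof. exact: bop_eq. Qed.
Lemma bcomp1l H K (a : bop H K) : bid K ** a = a. Proof. exact: bop_eq. Qed.
Lemma bcomp1r H K (a : bop H K) : a ** bid H = a. Proof. exact: bop_eq. Qed.
Lemma bcompDl H K L (a b : bop K L) (c : bop H K) :
  (a + b) ** c = a ** c + b ** c.
Proof. exact: bop_eq. Qed.
Lemma bcompDr H K L (a b : bop H K) (c : bop K L) :
  c ** (a + b) = c ** a + c ** b.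
Proof. by apply: bop_eq => x; rewrite bopD !bcompE bopD linearD. Qed.
Lemma bcompNl H K L (a : bop K L) (c : bop H K) : (- a) ** c = - (a ** c).
Proof. exact: bop_eq. Qed.
Lemma bcompNr H K L (a : bop H K) (c : bop K L) : c ** (- a) = - (c ** a).
Proof. by apply: bop_eq => x; rewrite bopN !bcompE bopN linearN. Qed.
Lemma bcompBl H K L (a b : bop K L) (c : bop H K) :
  (a - b) ** c = a ** c - b ** c.
Proof. by rewrite bcompDl bcompNl. Qed.
Lemma bcompBr H K L (a b : bop H K) (c : bop K L) :
  c ** (a - b) = c ** a - c ** b.
Proof. by rewrite bcompDr bcompNr. Qed.
Lemma bcompZl H K L k (a : bop K L) (c : bop H K) : (k *: a) ** c = k *: (a ** c).
Proof. exact: bop_eq. Qed.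
Lemma bcompZr H K L k (a : bop H K) (c : bop K L) : c ** (k *: a) = k *: (c ** a).
Proof. by apply: bop_eq => x; rewrite bopZ !bcompE bopZ linearZ. Qed.
Lemma bcomp0l H K L (a : bop H K) : (0 : bop K L) ** a = 0.
Proof. exact: bop_eq. Qed.
Lemma bcomp0r H K L (a : bop K L) : a ** (0 : bop H K) = 0.
Proof. by apply: bop_eq => x; rewrite bcompE bop0 linear0. Qed.
Lemma bcomp_suml H K L (I : Type) (r : seq I) (F : I -> bop K L) (a : bop H K) :
  (\sum_(i <- r) F i) ** a = \sum_(i <- r) F i ** a.
Proof. by apply: bop_eq => x; rewrite bop_sum bcompE bop_sum. Qed.
Lemma bcomp_sumr H K L (I : Type) (r : seq I) (F : I -> bop H K) (a : bop K L) :
  a ** (\sum_(i <- r) F i) = \sum_(i <- r) a ** F i.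
Proof. by apply: bop_eq => x; rewrite bop_sum bcompE bop_sum linear_sum. Qed.

Lemma rnm_bcomp H K L (a : bop K L) (b : bop H K) : rnm (a ** b) <= rnm a * rnm b.
Proof.
apply: rnm_bopP => [|x]; first by rewrite mulr_ge0 ?rnm_ge0.
rewrite bcompE (le_trans (rnm_bop _ _))// -mulrA.
by rewrite ler_wpM2l ?rnm_ge0 ?rnm_bop.
Qed.

Lemma rnm_bid H : rnm (bid H) <= 1.
Proof. by apply: rnm_bopP => // x; rewrite mul1r. Qed.

End BopBasics.

Definition bopE := (@bopD, @bopN, @bopZ, @bop0, @bidE, @bcompE, @bop_rD, @bop_rN,
  @bop_rZ, @bop_r0).
Definition dotE := (@dotDl, @dotDr, @dotNl, @dotNr, @dotZl, @dotZr, @dot0l, @dot0r).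

Lemma lim_rnm_uniq (R : realType) (V : normedModType R[i]) (u : nat -> V) x y :
  lim_rnm u x -> lim_rnm u y -> x = y.
Proof.
move=> ux uy; apply/eqP; rewrite -subr_eq0; apply/eqP/rnm_small => e e0.
have e2 : 0 < e / 2 by rewrite divr_gt0.
have [N hN] := ux _ e2; have [M hM] := uy _ e2.
have := hN _ (leq_maxl N M); have := hM _ (leq_maxr N M).
have := rnm_tri (u (maxn N M)) x y; rewrite (rnmBC x (u _)); lra.
Qed.

(** The limit is taken pointwise in [K]; the Cauchy bound passes to it uniformly in the vector,
    which gives both its boundedness and convergence in norm. *)
Lemma bop_complete (R : realType) (H : normedModType R[i])
    (K : completeNormedModType R[i]) (u : nat -> bop H K) :
  cauchy_rnm u -> exists a, lim_rnm u a.
Proof.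
move=> cu.
have ptC x : cauchy_rnm (fun n => u n x).
  move=> e e0; pose d := e / (rnm x + 1).
  have x1 : 0 < rnm x + 1 by have := rnm_ge0 x; lra.
  have d0 : 0 < d by rewrite divr_gt0.
  have [N hN] := cu d d0; exists N => m n Nm Nn.
  rewrite -bopB (le_lt_trans (rnm_bop _ _))//.
  have -> : e = d * (rnm x + 1) by rewrite /d divfK// gt_eqF.
  have := hN m n Nm Nn; have := rnm_ge0 (u m - u n); have := rnm_ge0 x.
  move: (rnm _) (rnm _) => p q p0 q0 qd.
  rewrite (@le_lt_trans _ _ (d * q))//; last by rewrite ltr_pM2l//; lra.
  by rewrite ler_wpM2r// ltW.
have [f fP] := choice (fun x => complete_rnm (ptC x)).
have lf : linear f.
  move=> c x y; apply: (@lim_rnm_uniq _ _ (fun n => u n (c *: x + y))); first exact: fP.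
  move=> e e0; pose M := cab c + 1.
  have M0 : 0 < M by rewrite /M; have := cab_ge0 c; lra.
  have d0 : 0 < e / 2 / M by rewrite !divr_gt0.
  have [N hN] := fP x _ d0; have [N' hN'] := fP y _ (divr_gt0 e0 (ltr0Sn _ 1)).
  exists (maxn N N') => n; rewrite geq_max => /andP[/hN h1 /hN' h2].
  rewrite linearP opprD addrACA -scalerBr (le_lt_trans (rnmD _ _))// rnmZ.
  suff : cab c * rnm (u n x - f x) < e / 2 by move: h2 => /=; lra.
  have -> : e / 2 = M * (e / 2 / M) by rewrite (mulrC M) divfK// gt_eqF.
  rewrite (@le_lt_trans _ _ (M * rnm (u n x - f x)))//; last by rewrite ltr_pM2l.
  by rewrite ler_wpM2r ?rnm_ge0// /M; lra.
have [N0 hN0] := cu 1 ltr01.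
have fb x : rnm (f x) <= (rnm (u N0) + 1) * rnm x.
  apply/ler_addgt0Pr => e e0; have [N hN] := fP x e e0.
  pose n := maxn N N0.
  have h1 := hN n (leq_maxl _ _); have h2 := hN0 n N0 (leq_maxr _ _) (leqnn _).
  have h3 : rnm (u n x - u N0 x) <= rnm x.
    rewrite -bopB (le_trans (rnm_bop _ _))// ler_piMl ?rnm_ge0// ltW//.
  have := rnm_bop (u N0) x; have := rnm_tri (u n x) (f x) (u N0 x).
  have := rnm_tri (u N0 x) (f x) 0; rewrite !subr0 (rnmBC (f x) (u n x)) mulrDl.
  move: h1 => /=; lra.
have [a aE] := bopE_exists lf fb.
exists a => e e0; have e2 : 0 < e / 2 by rewrite divr_gt0.
have [N hN] := cu _ e2; exists N => n Nn.
suff : rnm (u n - a) <= e / 2 by lra.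
apply: rnm_bopP; first exact: ltW.
move=> x; apply/ler_addgt0Pr => d d0; have [M hM] := fP x d d0.
have h1 := hM _ (leq_maxr N M); have h2 := hN n _ Nn (leq_maxl N M).
have h3 : rnm (u n x - u (maxn N M) x) <= e / 2 * rnm x.
  by rewrite -bopB (le_trans (rnm_bop _ _))// ler_wpM2r ?rnm_ge0// ltW.
have := rnm_tri (u (maxn N M) x) (u n x) (a x); rewrite bopB aE.
move: h1 => /=; lra.
Qed.

(** * Riesz representation and adjoints *)

Section Riesz.
Variables (R : realType) (H : hilbert R).
Variables (f : H -> R[i]) (M : R).
Hypothesis flin : forall c x y, f (c *: x + y) = c * f x + f y.
Hypothesis fbd : forall x, cab (f x) <= M * rnm x.

(** If [z] represents [f], then [J x] is [rnm (x - z) ^+ 2 - rnm z ^+ 2]; so [z] is sought as the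
    minimizer of [J]. *)
Let J (x : H) : R := rnm x ^+ 2 - 2 * complex.Re (f x).

Let fD x y : f (x + y) = f x + f y.
Proof. by have := flin 1 x y; rewrite scale1r mul1r. Qed.

Let f0 : f 0 = 0.
Proof. by have := fD 0 0; rewrite addr0 => /esym/eqP; rewrite -subr_eq0 addrK => /eqP. Qed.

Let fZ c x : f (c *: x) = c * f x.
Proof. by have := flin c x 0; rewrite !addr0 f0 addr0. Qed.

(** The parallelogram law; it makes minimizing sequences Cauchy. *)
Let J_mid x y :
  J x + J y = 2 * J (2^-1%:C *: (x + y)) + rnm (x - y) ^+ 2 / 2.
Proof.
rewrite /J fZ rnmZ cab_real ger0_norm ?invr_ge0// fD Re_scale ReD exprMn.
have := parallelogram x y; move: (complex.Re _) (complex.Re _) => a b.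
have -> : (2^-1 : R) ^+ 2 = 4^-1 by rewrite expr2 -invfM -natrM.
lra.
Qed.

Lemma riesz : exists z, forall x, f x = hdot H x z.
Proof.
pose E := [set J x | x in setT].
have J_lb x : - M ^+ 2 <= J x.
  have := fbd x; have := Re_le (f x); rewrite /J.
  have := sqr_ge0 (rnm x - M); rewrite sqrrB; lra.
have hE : has_inf E.
  by split; [exists (J 0), 0|exists (- M ^+ 2) => _ [x _ <-]].
have infJ x : inf E <= J x by apply: ge_inf; [exact: hE.2|exists x].
have /choice[u uP] : forall n, exists x, J x < inf E + n.+1%:R^-1.
  move=> n; have n0 : 0 < n.+1%:R^-1 :> R by rewrite invr_gt0.
  by have [_ [x _ <-] ?] := inf_adherent n0 hE; exists x.
have n0 (e : R) : 0 < e -> exists N, forall n, (N <= n)%N -> n.+1%:R^-1 < e.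
  move=> e0; have [N _ hN] := near_infty_natSinv_lt (PosNum e0).
  by exists N => n Nn; exact: hN.
have cu : cauchy_rnm u.
  (* By [J_mid], the squared distance is at most twice the sum of the two excesses over the
     infimum. *)
  move=> e e0; have [|N hN] := n0 (e ^+ 2 / 4); first by rewrite divr_gt0 ?exprn_gt0.
  exists N => m n Nm Nn.
  rewrite -(ltr_pXn2r (n := 2))// ?nnegrE ?rnm_ge0 ?ltW//.
  have := J_mid (u m) (u n); have := infJ (2^-1%:C *: (u m + u n)).
  have := uP m; have := uP n; have := hN m Nm; have := hN n Nn.
  move: (m.+1%:R^-1) (n.+1%:R^-1) => a b; lra.
have [z uz] := complete_rnm cu.
(* This is [J (z + y) >= J z], obtained by comparing [J (u n + y)] with the infimum and letting
   [u n] tend to [z]. *)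
have key y : 0 <= rnm y ^+ 2 + 2 * (complex.Re (hdot H y z) - complex.Re (f y)).
  apply/ler_addgt0Pr => e e0.
  have [N hN] := n0 (e / 2) (divr_gt0 e0 (ltr0Sn _ 1)).
  pose d := e / 4 / (rnm y + 1).
  have y1 : 0 < rnm y + 1 by have := rnm_ge0 y; lra.
  have [|N' hN'] := uz d; first by rewrite !divr_gt0.
  set n := maxn N N'.
  have h1 := hN n (leq_maxl _ _); have h2 := hN' n (leq_maxr _ _).
  have := infJ (u n + y); have := uP n; rewrite /J rnm_sqD fD ReD.
  have h3 : complex.Re (hdot H y (u n)) - complex.Re (hdot H y z) <= e / 4.
    rewrite -ReB -dotBr (le_trans (Re_le _))// (le_trans (cauchy_schwarz _ _))//.
    have -> : e / 4 = d * (rnm y + 1) by rewrite /d divfK// gt_eqF.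
    have := rnm_ge0 y; have := rnm_ge0 (u n - z).
    move: (rnm y) (rnm _) h2 => p q qd q0 p0.
    have d0 : 0 <= d by exact: le_trans (ltW qd).
    rewrite mulrC (@le_trans _ _ (d * p))//; first by rewrite ler_wpM2r// ltW.
    by rewrite ler_wpM2l// lerDl.
  rewrite (Re_dotC (u n)); move: h1; move: (n.+1%:R^-1) => a; lra.
have Reeq y : complex.Re (f y) = complex.Re (hdot H y z).
  apply/eqP; rewrite -subr_eq0; apply/eqP.
  set D := complex.Re (f y) - complex.Re (hdot H y z).
  (* Real multiples of [y] give a quadratic in [t] that is never negative, so its linear coefficient
     vanishes. *)
  have key2 (t : R) : 0 <= t ^+ 2 * rnm y ^+ 2 - 2 * t * D.
    have := key (t%:C *: y); rewrite fZ dotZl rnmZ cab_real !Re_scale exprMn.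
    rewrite real_normK ?num_real// /D; lra.
  have [y0|y0] := eqVneq (rnm y) 0.
    have := key2 1; have := key2 (-1); rewrite y0; lra.
  have yp : 0 < rnm y ^+ 2 by rewrite exprn_gt0// lt_neqAle eq_sym y0 rnm_ge0.
  pose s := D / rnm y ^+ 2; have sD : D = s * rnm y ^+ 2 by rewrite divfK// gt_eqF.
  have := key2 s; rewrite sD => h; have {}h : s ^+ 2 * rnm y ^+ 2 <= 0.
    by rewrite expr2; move: h; rewrite expr2; lra.
  have : s ^+ 2 <= 0 by move: h; rewrite pmulr_lle0.
  rewrite le_eqVlt ltNge sqr_ge0 orbF sqrf_eq0 => /eqP ->.
  by rewrite mul0r.
exists z => x.
(* The real part at [i x] is minus the imaginary part at [x]. *)
have h1 := Reeq x; have h2 := Reeq ('i%C *: x).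
move: h2; rewrite fZ dotZl; case: (f x) (hdot H x z) h1 => [a b] [c d] /= ->.
rewrite !mul0r !mul1r !sub0r => /oppr_inj ->; by [].
Qed.

End Riesz.

Section Adjoint.
Variables (R : realType).
Implicit Types H K L : hilbert R.

Lemma rnm_dotP H K (a : bop H K) (M : R) : 0 <= M ->
  (forall x y, cab (hdot K (a x) y) <= M * rnm x * rnm y) -> rnm a <= M.
Proof.
move=> M0 aM; apply: rnm_bopP => // x.
have [->|y0] := eqVneq (rnm (a x)) 0; first by rewrite mulr_ge0 ?rnm_ge0.
have yp : 0 < rnm (a x) by rewrite lt_neqAle eq_sym y0 rnm_ge0.
rewrite -(ler_pM2r yp) (le_trans _ (aM _ _))// dotxx cab_real -expr2.
by rewrite ger0_norm// sqr_ge0.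
Qed.

(** Riesz in the second variable. Adjoints and slices are both obtained this way, as operators with
    prescribed matrix coefficients. *)
Lemma bop_of_form H K (B : H -> K -> R[i]) (M : R) :
  (forall c x x' y, B (c *: x + x') y = c * B x y + B x' y) ->
  (forall c x y y', B x (c *: y + y') = cj c * B x y + B x y') ->
  0 <= M -> (forall x y, cab (B x y) <= M * rnm x * rnm y) ->
  exists2 T : bop H K, rnm T <= M & forall x y, hdot K (T x) y = B x y.
Proof.
move=> Bl Br M0 BM.
have h x : exists z, forall y, cj (B x y) = hdot K y z.
  apply: (@riesz R K (fun y => cj (B x y)) (M * rnm x)) => [c y y'|y].
    by rewrite Br rmorphD rmorphM/= conjCK.
  by rewrite cab_conj.
have [g gP] := choice h.
have gB x y : hdot K (g x) y = B x y by rewrite dotC -gP conjCK.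
have lg : linear g.
  by move=> c x x'; apply: dot_ext_eq => y; rewrite dotDl dotZl !gB Bl.
have [|T TE] := @bopE_exists R H K g M lg.
  move=> x; have [->|y0] := eqVneq (rnm (g x)) 0; first by rewrite mulr_ge0 ?rnm_ge0.
  have yp : 0 < rnm (g x) by rewrite lt_neqAle eq_sym y0 rnm_ge0.
  rewrite -(ler_pM2r yp) (le_trans _ (BM _ _))// -gB dotxx cab_real -expr2.
  by rewrite ger0_norm// sqr_ge0.
exists T; last by move=> x y; rewrite TE gB.
by apply: rnm_dotP => // x y; rewrite TE gB.
Qed.

Lemma adj_exists H K (a : bop H K) :
  exists b : bop K H, forall x y, hdot K (a x) y = hdot H x (b y).
Proof.
have [||y x|b _ bE] := @bop_of_form K H (fun y x => hdot K y (a x)) (rnm a) _ _ (rnm_ge0 a).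
- by move=> c y y' x; rewrite dotDl dotZl.
- by move=> c y x x'; rewrite linearP dotDr dotZr.
- rewrite (le_trans (cauchy_schwarz _ _))// mulrAC mulrC.
  by rewrite ler_wpM2r ?rnm_ge0 ?rnm_bop.
by exists b => x y; rewrite dotC -bE -dotC.
Qed.

Lemma adjP H K (a : bop H K) x y : hdot K (a x) y = hdot H x (adj a y).
Proof. by move: x y; exact: (getPex (adj_exists a)). Qed.

Lemma adjP' H K (a : bop H K) x y : hdot K y (a x) = hdot H (adj a y) x.
Proof. by rewrite dotC adjP -dotC. Qed.

Lemma bop_dot_ext H K (a b : bop H K) :
  (forall x y, hdot K (a x) y = hdot K (b x) y) -> a = b.
Proof. by move=> ab; apply: bop_eq => x; apply: dot_ext_eq. Qed.

Lemma adj_uniq H K (a : bop H K) (b : bop K H) :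
  (forall x y, hdot K (a x) y = hdot H x (b y)) -> adj a = b.
Proof.
move=> ab; apply: bop_dot_ext => y x.
by rewrite dotC [RHS]dotC -ab adjP.
Qed.

Lemma adjK H K (a : bop H K) : adj (adj a) = a.
Proof. by apply: adj_uniq => x y; rewrite -adjP'. Qed.
Lemma adjM H K L (a : bop K L) (b : bop H K) : adj (a ** b) = adj b ** adj a.
Proof. by apply: adj_uniq => x y; rewrite !bcompE !adjP. Qed.
Lemma adjD H K (a b : bop H K) : adj (a + b) = adj a + adj b.
Proof. by apply: adj_uniq => x y; rewrite !bopD dotDl dotDr !adjP. Qed.
Lemma adjN H K (a : bop H K) : adj (- a) = - adj a.
Proof. by apply: adj_uniq => x y; rewrite !bopN dotNl dotNr !adjP. Qed.
Lemma adjB H K (a b : bop H K) : adj (a - b) = adj a - adj b.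
Proof. by rewrite adjD adjN. Qed.
Lemma adjZ H K c (a : bop H K) : adj (c *: a) = cj c *: adj a.
Proof. by apply: adj_uniq => x y; rewrite !bopZ dotZl dotZr conjCK adjP. Qed.
Lemma adj0 H K : adj (0 : bop H K) = 0.
Proof. by apply: adj_uniq => x y; rewrite !bop0 dot0l dot0r. Qed.
Lemma adj1 H : adj (bid H) = bid H.
Proof. exact: adj_uniq. Qed.
Lemma adj_sum H K (I : Type) (r : seq I) (F : I -> bop H K) :
  adj (\sum_(i <- r) F i) = \sum_(i <- r) adj (F i).
Proof. by elim/big_rec2: _ => [|i x y _ <-]; rewrite ?adj0 ?adjD. Qed.

Lemma dot_bop_le H K (a : bop H K) x y :
  cab (hdot K (a x) y) <= rnm a * rnm x * rnm y.
Proof.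
by rewrite (le_trans (cauchy_schwarz _ _))// ler_wpM2r ?rnm_ge0 ?rnm_bop.
Qed.

Lemma rnm_adj H K (a : bop H K) : rnm (adj a) = rnm a.
Proof.
have h H' K' (b : bop H' K') : rnm (adj b) <= rnm b.
  apply: rnm_dotP => [|x y]; first exact: rnm_ge0.
  by rewrite -adjP' dotC cab_conj (le_trans (dot_bop_le _ _ _))// mulrAC.
by apply/le_anti; rewrite h/= -{1}(adjK a) h.
Qed.

Lemma rnm_cstar H K (a : bop H K) : rnm (adj a ** a) = rnm a ^+ 2.
Proof.
apply/le_anti/andP; split.
  by rewrite (le_trans (rnm_bcomp _ _))// rnm_adj -expr2.
have [a0|a0] := eqVneq (rnm a) 0; first by rewrite a0 expr0n/= rnm_ge0.
rewrite -[leRHS]sqr_sqrtr ?rnm_ge0// ler_pXn2r ?nnegrE ?rnm_ge0 ?sqrtr_ge0//.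
apply: rnm_bopP => [|x]; first exact: sqrtr_ge0.
rewrite -(ler_pXn2r (n := 2)) ?nnegrE ?mulr_ge0 ?rnm_ge0 ?sqrtr_ge0//.
rewrite exprMn sqr_sqrtr ?rnm_ge0// -[leLHS]/(complex.Re ((rnm (a x) ^+ 2)%:C)).
rewrite -dotxx adjP' -bcompE (le_trans (Re_le _))//.
by rewrite (le_trans (dot_bop_le _ _ _))// -mulrA -expr2.
Qed.

Lemma rnm_cstar' H K (a : bop H K) : rnm (a ** adj a) = rnm a ^+ 2.
Proof. by rewrite -{1}(adjK a) rnm_cstar rnm_adj. Qed.

Lemma adj_comp_dot H K (a : bop H K) x :
  hdot H ((adj a ** a) x) x = (rnm (a x) ^+ 2)%:C.
Proof. by rewrite bcompE -adjP' dotxx. Qed.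

End Adjoint.

Ltac bop_ring := apply: bop_dot_ext => ? ?; rewrite ?bopE ?dotE; ring.

(** * Subspaces and square roots of operators *)

Section Subspace.
Variables (R : realType) (V : normedModType R[i]) (A : set V).
Hypothesis sA : Defs.subspace A.

Lemma sub0 : A 0. Proof. by case: sA. Qed.
Lemma subD x y : A x -> A y -> A (x + y).
Proof. by move=> Ax Ay; rewrite -(scale1r x); case: sA => _; exact. Qed.
Lemma subZ c x : A x -> A (c *: x).
Proof. by move=> Ax; rewrite -(addr0 (c *: x)); case: (sA) => _; apply => //; exact: sub0. Qed.
Lemma subN x : A x -> A (- x).
Proof. by move=> Ax; rewrite -scaleN1r; exact: subZ. Qed.
Lemma subB x y : A x -> A y -> A (x - y).
Proof. by move=> Ax Ay; apply: subD => //; exact: subN. Qed.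
Lemma sub_sum (I : Type) (r : seq I) (P : pred I) (F : I -> V) :
  (forall i, P i -> A (F i)) -> A (\sum_(i <- r | P i) F i).
Proof. by move=> AF; elim/big_ind: _ => //; [exact: sub0|exact: subD]. Qed.
End Subspace.

Lemma closed_lim (R : realType) (V : normedModType R[i]) (A : set V) u x :
  closed A -> (forall n, A (u n)) -> lim_rnm u x -> A x.
Proof.
move=> /closed_rnm cA Au ux; apply: cA => e e0.
by have [N hN] := ux e e0; exists (u N) => //; rewrite rnmBC hN.
Qed.

Section SquareRoot.
Variables (R : realType).

(** A fixed point [u = (s + u^2)/2] satisfies [(1 - u)^2 = 1 - s]; the
    scalar iterates [sqt] (the case s = 1) majorize the operator iterates. *)
Fixpoint sqt (n : nat) : R := if n is n'.+1 then (1 + sqt n' ^+ 2) / 2 else 0.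

(** The gap [p = 1 - sqt n] evolves by [p -> p - p^2 / 2], hence decays like [2 / n]. *)
Lemma sqt_bounds n : [/\ 0 <= sqt n, sqt n <= 1 & 1 - sqt n <= 2 / n.+2%:R].
Proof.
elim: n => [|n [t0 t1 tn]] /=; first by split; lra.
split; first by have := sqr_ge0 (sqt n); lra.
  by rewrite expr2; nra.
have n0 : 0 < n.+2%:R :> R by rewrite ltr0n.
have n1 : 0 < n.+3%:R :> R by rewrite ltr0n.
have e3 : n.+3%:R = n.+2%:R + 1 :> R by rewrite -natr1.
move: tn; set d := sqt n => tn.
have h : 1 - (1 + d ^+ 2) / 2 = (1 - d) - (1 - d) ^+ 2 / 2.
  by rewrite sqrrB expr1n; lra.
rewrite h; set p := 1 - d in tn *; rewrite ler_pdivlMr//.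
have p0 : 0 <= p by rewrite /p /d; lra.
have p1 : p <= 1 by rewrite /p /d; lra.
have {}tn : p * n.+2%:R <= 2 by move: tn; rewrite ler_pdivlMr.
rewrite e3; have n2 : 2 <= n.+2%:R :> R by rewrite ler_nat.
move: n.+2%:R n0 n2 tn {e3 n1} => m m0 m2 tn.
rewrite expr2; nra.
Qed.

Lemma sqt_near1 (e : R) : 0 < e -> exists N, forall n, (N <= n)%N -> 1 - sqt n < e.
Proof.
move=> e0; have [N _ hN] := near_infty_natSinv_lt (PosNum (divr_gt0 e0 (ltr0Sn _ 1))).
exists N => n Nn; have [_ _ h] := sqt_bounds n; apply: (le_lt_trans h).
have := hN n Nn; rewrite /= => h'.
have : n.+2%:R^-1 <= n.+1%:R^-1 :> R by rewrite lef_pV2 ?posrE ?ltr0n// ler_nat.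
move: (n.+2%:R^-1 : R) (n.+1%:R^-1 : R) h' => a b; lra.
Qed.

Variables (H : hilbert R) (s : bop H H).
Hypothesis s1 : rnm s <= 1.

Fixpoint squ (n : nat) : bop H H :=
  if n is n'.+1 then (2^-1)%:C *: (s + squ n' ** squ n') else 0.

Let half (V : normedModType R[i]) (x : V) : rnm ((2^-1)%:C *: x) = rnm x / 2.
Proof. by rewrite rnmZ cab_real ger0_norm ?invr_ge0// mulrC. Qed.

Lemma rnm_squ n : rnm (squ n) <= sqt n.
Proof.
elim: n => [|n IH]/=; first by rewrite rnm0.
rewrite half ler_pM2r ?invr_gt0// (le_trans (rnmD _ _))// lerD//.
rewrite (le_trans (rnm_bcomp _ _))// expr2 ler_pM ?rnm_ge0//.
Qed.

Lemma rnm_squ1 n : rnm (squ n) <= 1.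
Proof. by have [_ t1 _] := sqt_bounds n; exact: le_trans (rnm_squ n) t1. Qed.

(** The identity [u u - v v = u (u - v) + (u - v) v] holds without commutation and bounds each
    operator step by the same expression in the scalar iterates. *)
Lemma squ_step n : rnm (squ n.+1 - squ n) <= sqt n.+1 - sqt n.
Proof.
elim: n => [|n IH].
  by rewrite /= subr0 half bcomp0l addr0 expr2 mul0r addr0 subr0 ler_pM2r ?invr_gt0.
have -> : squ n.+2 - squ n.+1 = (2^-1)%:C *:
    (squ n.+1 ** (squ n.+1 - squ n) + (squ n.+1 - squ n) ** squ n).
  rewrite [squ n.+2]/= [X in _ - X]/= -scalerBr opprD addrACA subrr add0r.
  by congr (_ *: _); rewrite -[X in _ ** X - _]/(squ n.+1) bcompBr bcompBl addrA subrK.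
have -> : sqt n.+2 - sqt n.+1 =
    (sqt n.+1 * (sqt n.+1 - sqt n) + (sqt n.+1 - sqt n) * sqt n) / 2.
  rewrite [sqt n.+2]/= [X in _ - X = _]/= -[(1 + sqt n ^+ 2) / 2 in LHS]/(sqt n.+1).
  by rewrite -[X in 1 + X ^+ 2]/(sqt n.+1) !expr2 /=; lra.
rewrite half ler_pM2r ?invr_gt0// (le_trans (rnmD _ _))// lerD//.
  by rewrite (le_trans (rnm_bcomp _ _))// ler_pM ?rnm_ge0// rnm_squ.
by rewrite (le_trans (rnm_bcomp _ _))// ler_pM ?rnm_ge0// rnm_squ.
Qed.

Lemma squ_diff m n : (m <= n)%N -> rnm (squ n - squ m) <= sqt n - sqt m.
Proof.
move=> /subnKC <-; elim: (n - m)%N => [|k IH]; first by rewrite addn0 !subrr rnm0.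
rewrite addnS (le_trans (rnm_tri (squ (m + k)) _ _))//.
by have := squ_step (m + k); move: IH; lra.
Qed.

Lemma squ_cvg : exists2 u, lim_rnm squ u & (bid H - u) ** (bid H - u) = bid H - s.
Proof.
have cu : cauchy_rnm squ.
  move=> e e0; have [N hN] := sqt_near1 e0; exists N => m n Nm Nn.
  wlog mn : m n Nm Nn / (m <= n)%N.
    by move=> h; have /orP[mn|mn] := leq_total m n; [|rewrite rnmBC]; exact: h.
  rewrite rnmBC (le_lt_trans (squ_diff mn))//.
  by have [_ t1 _] := sqt_bounds n; have := hN m Nm; lra.
have [u uP] := bop_complete cu.
have u1 : rnm u <= 1.
  apply/ler_addgt0Pr => e e0; have [N hN] := uP e e0.
  have := hN N (leqnn _); have := rnm_tri (squ N) u 0; rewrite !subr0 rnmBC.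
  by have := rnm_squ N; have [_ t1 _] := sqt_bounds N; lra.
exists u => //.
have h : 2%:C *: u - (s + u ** u) = 0.
  apply: rnm_small => e e0; have [|N hN] := uP (e / 4); first by rewrite divr_gt0.
  have h0 := hN N (leqnn _); have h1 := hN N.+1 (leqnSn _).
  have -> : 2%:C *: u - (s + u ** u) = 2%:C *: (u - squ N.+1) +
      (squ N ** (squ N - u) + (squ N - u) ** u).
    have h2 : 2%:C * (2^-1)%:C = 1 :> R[i] by rewrite -rCM divff.
    rewrite [squ N.+1]/= scalerBr scalerA h2; bop_ring.
  have k1 := rnm_bcomp (squ N) (squ N - u); have k2 := rnm_bcomp (squ N - u) u.
  have k3 := rnmD (2%:C *: (u - squ N.+1)) (squ N ** (squ N - u) + (squ N - u) ** u).
  have k4 := rnmD (squ N ** (squ N - u)) ((squ N - u) ** u).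
  move: k3; rewrite rnmZ cab_real ger0_norm// (rnmBC u) => k3.
  have aux (p q q1 q2 d : R) : p < e / 4 -> d < e / 4 -> q <= q1 + q2 ->
      q1 <= d -> q2 <= d -> 2 * p + q <= e by clear; move=> *; lra.
  apply: (le_trans k3); apply: aux h1 h0 k4 (le_trans k1 _) (le_trans k2 _).
    by rewrite ler_piMl ?rnm_ge0 ?rnm_squ1.
  by rewrite ler_piMr ?rnm_ge0.
have {h} -> : s = 2%:C *: u - u ** u.
  by apply/eqP; rewrite -subr_eq0 -oppr_eq0 -h opprB opprD addrCA addrC addrAC.
by rewrite (rCD 1 1) rC1; bop_ring.
Qed.

Lemma squ_adj n : adj s = s -> adj (squ n) = squ n.
Proof.
move=> sa; elim: n => [|n IH]/=; first exact: adj0.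
by rewrite adjZ adjD adjM sa IH; congr (_ *: _); exact: conjc_real.
Qed.

End SquareRoot.

Section CstarBasics.
Variables (R : realType) (H : hilbert R).
Implicit Types (A : set (bop H H)) (a b : bop H H).

Lemma lim_adj (u : nat -> bop H H) a : lim_rnm u a -> lim_rnm (fun n => adj (u n)) (adj a).
Proof.
by move=> ua e e0; have [N hN] := ua e e0; exists N => n /hN; rewrite -adjB rnm_adj.
Qed.

Lemma sqrt_selfadj (s : bop H H) : rnm s <= 1 -> adj s = s ->
  exists2 u, lim_rnm (squ s) u &
    adj u = u /\ (bid H - u) ** (bid H - u) = bid H - s.
Proof.
move=> s1 sa; have [u su uu] := squ_cvg s1; exists u => //; split=> //.
apply: lim_rnm_uniq (lim_adj su) _ => e e0; have [N hN] := su e e0.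
by exists N => n /=; rewrite squ_adj//; exact: hN.
Qed.

Lemma squ_mem A s n : cstar_algebra A -> A s -> A (squ s n).
Proof.
case=> sA _ Am _ As; elim: n => [|n IH]/=; first exact: sub0.
by apply: (subZ sA); apply: (subD sA) => //; exact: Am.
Qed.

(** [A] may lack a unit, so the iterates for [s = 1 - a] lie in [A] only up to the scalar [sqt n];
    as [sqt n] tends to 1, the limit [u] still has [1 - u] in [A]. *)
Lemma squ_mem1 A a n : cstar_algebra A -> A a ->
  A (squ (bid H - a) n - (sqt R n)%:C *: bid H).
Proof.
case=> sA _ Am _ Aa; elim: n => [|n IH]; first by rewrite /= scale0r subr0; exact: sub0.
set u := squ _ n in IH; set t := sqt R n in IH.
have -> : squ (bid H - a) n.+1 - (sqt R n.+1)%:C *: bid H = (2^-1)%:C *: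
  ((u - t%:C *: bid H) ** (u - t%:C *: bid H) + (2 * t)%:C *: (u - t%:C *: bid H) - a).
  rewrite [squ _ n.+1]/= -/u [sqt R n.+1]/= -/t.
  have -> : ((1 + t ^+ 2) / 2)%:C = (2^-1)%:C * (1 + t%:C * t%:C) :> R[i].
    by rewrite mulrC rCM rCD rC1 expr2 rCM.
  by rewrite (rCM 2 t) (rCD 1 1) rC1; bop_ring.
apply: (subZ sA); apply: (subB sA) => //; apply: (subD sA); first exact: Am.
exact: (subZ sA).
Qed.
End CstarBasics.

(** * Contractivity of homomorphisms of C*-algebras *)

Section StarHom.
Variables (R : realType) (H K : hilbert R) (A : set (bop H H)).
Variable p : bop H H -> bop K K.
Hypotheses (csA : cstar_algebra A) (hp : star_hom A p).

Lemma star_hom0 : p 0 = 0.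
Proof.
have [pl _ _] := hp; have [sA _ _ _] := csA.
by have := pl (-1) 0 0 (sub0 sA) (sub0 sA); rewrite !scaleN1r oppr0 add0r addNr.
Qed.

Lemma star_homD a b : A a -> A b -> p (a + b) = p a + p b.
Proof. by have [pl _ _] := hp => Aa Ab; have := pl 1 a b Aa Ab; rewrite !scale1r. Qed.

Lemma star_homZ c a : A a -> p (c *: a) = c *: p a.
Proof.
have [pl _ _] := hp; have [sA _ _ _] := csA => Aa.
by have := pl c a 0 Aa (sub0 sA); rewrite !addr0 star_hom0 addr0.
Qed.

Lemma star_homB a b : A a -> A b -> p (a - b) = p a - p b.
Proof.
have [sA _ _ _] := csA => Aa Ab; rewrite star_homD//; last exact: subN.
by rewrite -scaleN1r star_homZ// scaleN1r.
Qed.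

Lemma star_hom_sum (I : Type) (r : seq I) (F : I -> bop H H) :
  (forall i, A (F i)) -> p (\sum_(i <- r) F i) = \sum_(i <- r) p (F i).
Proof.
have [sA _ _ _] := csA => AF; elim: r => [|i r IH].
  by rewrite !big_nil star_hom0.
by rewrite !big_cons star_homD ?IH//; exact: sub_sum.
Qed.

(** For a contraction [b] the square root gives a self-adjoint [u] in [A] with
    [adj b ** b = 2 u - u^2]. Applying [p] keeps this form, so [1 - adj (p b) ** p b] is the square
    of the self-adjoint [1 - p u], hence positive. *)
Lemma star_hom_contr a : A a -> rnm (p a) <= rnm a.
Proof.
have [sA cA mA aA] := csA; have [pl pm pa] := hp.
have key b : A b -> rnm b <= 1 -> rnm (p b) <= 1.
  move=> Ab b1; pose s := adj b ** b.
  have As : A s by apply: mA => //; exact: aA.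
  have s1 : rnm s <= 1 by rewrite rnm_cstar expr_le1// rnm_ge0.
  have [|u su [ua uu]] := sqrt_selfadj s1; first by rewrite /s adjM adjK.
  have Au : A u by apply: closed_lim su => // n; apply: squ_mem.
  have Auu : A (u ** u) by exact: mA.
  have sE : s = 2%:C *: u - u ** u.
    have -> : s = bid H - (bid H - s) by bop_ring.
    by rewrite -uu (rCD 1 1) rC1; bop_ring.
  have psE : adj (p b) ** p b = 2%:C *: p u - p u ** p u.
    rewrite -pa// -pm//; last exact: aA.
    by rewrite -/s sE star_homB ?star_homZ ?pm//; exact: subZ.
  have pua : adj (p u) = p u by rewrite -pa// ua.
  apply: rnm_bopP => // x; rewrite mul1r -(ler_pXn2r (n := 2)) ?nnegrE ?rnm_ge0//.
  have h : adj (bid K - p u) ** (bid K - p u) = bid K - adj (p b) ** p b.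
    by rewrite adjB adj1 pua psE (rCD 1 1) rC1; bop_ring.
  have := adj_comp_dot (bid K - p u) x; rewrite h bopB dotBl adj_comp_dot dotxx.
  rewrite -rCB => /rC_inj; have := sqr_ge0 (rnm ((bid K - p u) x)).
  by move=> h1 h2; rewrite -subr_ge0 h2.
move=> Aa; have [a0|a0] := eqVneq (rnm a) 0.
  by rewrite (rnm_eq0 a0) star_hom0 !rnm0.
have ap : 0 < rnm a by rewrite lt_neqAle eq_sym a0 rnm_ge0.
have := key ((rnm a)^-1%:C *: a) (subZ sA _ Aa).
rewrite star_homZ// !rnmZ cab_real ger0_norm ?invr_ge0 ?rnm_ge0// mulVf// => /(_ (lexx _)).
by rewrite ler_pdivrMl// mulr1.
Qed.

End StarHom.

(** * Positive operators *)

Section Positive.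
Variables (R : realType) (H : hilbert R) (A : set (bop H H)).
Implicit Types a b h : bop H H.

(** Positivity as an operator, with no reference to [A]; [qpos_sqrt] shows that for elements of a
    C*-algebra it yields [positive]. *)
Definition qpos a := adj a = a /\ forall x, 0 <= complex.Re (hdot H (a x) x).

Lemma qpos_cstar (K : hilbert R) (b : bop H K) : qpos (adj b ** b).
Proof.
split; first by rewrite adjM adjK.
by move=> x; rewrite adj_comp_dot/= sqr_ge0.
Qed.

Lemma qposD a b : qpos a -> qpos b -> qpos (a + b).
Proof.
move=> [a1 a2] [b1 b2]; split; first by rewrite adjD a1 b1.
by move=> x; rewrite bopD dotDl ReD addr_ge0.
Qed.

Lemma qposZ (r : R) a : 0 <= r -> qpos a -> qpos (r%:C *: a).
Proof.
move=> r0 [a1 a2]; split; first by rewrite adjZ a1; congr (_ *: _); exact: conjc_real.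
by move=> x; rewrite bopZ dotZl Re_scale mulr_ge0.
Qed.

Lemma qpos0 : qpos 0.
Proof. by split=> [|x]; rewrite ?adj0// bop0 dot0l. Qed.

Lemma qpos_sum (I : Type) (r : seq I) (F : I -> bop H H) :
  (forall i, qpos (F i)) -> qpos (\sum_(i <- r) F i).
Proof.
by move=> h; elim/big_rec: _ => [|i x _]; [exact: qpos0|apply: qposD].
Qed.

(** This is [a^2 <= a]: test the positivity of [a] at [x - a x]. *)
Lemma qpos_sq_le a x : qpos a -> rnm a <= 1 ->
  rnm (a x) ^+ 2 <= complex.Re (hdot H (a x) x).
Proof.
move=> [aa ap] a1; have := ap (x - a x).
rewrite bop_rB dotBl !dotBr !ReB dotxx (adjP a (a x) x) aa dotxx/=.
have : complex.Re (hdot H (a (a x)) (a x)) <= rnm (a x) ^+ 2.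
  rewrite (le_trans (Re_le _))// (le_trans (dot_bop_le _ _ _))// -mulrA -expr2.
  by rewrite ler_piMl// sqr_ge0.
move: (complex.Re _) (complex.Re _) (rnm (a x) ^+ 2) => r s t; lra.
Qed.

Lemma qpos_compl a : qpos a -> rnm a <= 1 -> rnm (bid H - a) <= 1.
Proof.
move=> ap a1; apply: rnm_bopP => // x.
rewrite mul1r -(ler_pXn2r (n := 2)) ?nnegrE ?rnm_ge0//.
rewrite bopB bidE rnm_sqB (Re_dotC x).
have := qpos_sq_le x ap a1; have := ap.2 x.
move: (complex.Re _) (rnm (a x) ^+ 2) (rnm x ^+ 2) => r s t; lra.
Qed.

(** Scaled to a contraction [b], the operator has the square root [1 - u] with [u] the limit of
    [squ (1 - b)]; by [squ_mem1] this root belongs to [A]. *)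
Lemma qpos_sqrt a : cstar_algebra A -> A a -> qpos a -> positive A a.
Proof.
move=> csA Aa ap; have [sA cA mA aA] := csA.
pose r := (rnm a + 1)^-1; have a1 : 0 < rnm a + 1 by rewrite ltr_wpDl ?rnm_ge0.
have r0 : 0 < r by rewrite invr_gt0.
pose b := r%:C *: a; have Ab : A b by exact: subZ.
have bp : qpos b by apply: qposZ => //; exact: ltW.
have b1 : rnm b <= 1.
  by rewrite /b rnmZ cab_real gtr0_norm// ler_pdivrMl// mulr1 lerDl.
have s1 := qpos_compl bp b1.
have [|u su [ua uu]] := sqrt_selfadj s1; first by rewrite adjB adj1 bp.1.
have Au : A (bid H - u).
  have h : lim_rnm (fun n => (sqt R n)%:C *: bid H - squ (bid H - b) n) (bid H - u).
    move=> e e0; have e2 : 0 < e / 2 by rewrite divr_gt0.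
    have [N hN] := su _ e2; have [N' hN'] := sqt_near1 e2.
    exists (maxn N N') => n; rewrite geq_max => /andP[/hN h1 /hN' h2].
    have -> : (sqt R n)%:C *: bid H - squ (bid H - b) n - (bid H - u) =
       - (squ (bid H - b) n - u) - (1 - sqt R n)%:C *: bid H.
      by rewrite rCB rC1; bop_ring.
    rewrite (le_lt_trans (rnmB _ _))// rnmN rnmZ cab_real.
    have [_ t1 _] := sqt_bounds R n; rewrite ger0_norm ?subr_ge0//.
    have h3 : (1 - sqt R n) * rnm (bid H) <= 1 - sqt R n.
      by rewrite ler_piMr ?rnm_bid ?subr_ge0.
    by rewrite [ltRHS](splitr e) ltr_leD// (le_trans h3)// ltW.
  apply: closed_lim h => // n; rewrite -opprB; apply: subN => //.
  exact: squ_mem1.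
exists ((Num.sqrt r)^-1%:C *: (bid H - u)); first exact: subZ.
have sr0 : Num.sqrt r != 0 by rewrite sqrtr_eq0 -ltNge.
have -> : adj ((Num.sqrt r)^-1%:C *: (bid H - u)) =
    (Num.sqrt r)^-1%:C *: (bid H - u).
  by rewrite adjZ adjB adj1 ua; congr (_ *: _); exact: conjc_real.
rewrite bcompZl bcompZr scalerA uu opprB addrCA subrr addr0 scalerA -!rCM.
by rewrite -invfM -expr2 sqr_sqrtr ?mulVf ?rC1 ?scale1r ?gt_eqF// ltW.
Qed.

Lemma positive_qpos a : positive A a -> qpos a.
Proof. by move=> [b _ <-]; exact: qpos_cstar. Qed.

End Positive.
(** * Approximate units *)

Section ApproximateUnit.
Variables (R : realType) (H : hilbert R) (A : set (bop H H)).
Hypothesis csA : cstar_algebra A.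

Let bpow (g : bop H H) n := iter n (fun b => g ** b) (bid H).

Let bpow_add g m n : bpow g (m + n) = bpow g m ** bpow g n.
Proof. by elim: m => [|m IH]; rewrite ?bcomp1l//= IH bcompA. Qed.

Let bpow_comm g n : g ** bpow g n = bpow g n ** g.
Proof.
by elim: n => [|n IH]; [rewrite /= bcomp1l bcomp1r|rewrite /= {1}IH bcompA].
Qed.

Let bpow_adj g n : adj g = g -> adj (bpow g n) = bpow g n.
Proof.
by move=> ga; elim: n => [|n IH]/=; [exact: adj1|rewrite adjM IH ga bpow_comm].
Qed.

(** The decrements of [f] decrease and their sum is at most [f 0]. *)
Let decay_seq (e f : nat -> R) : (forall k, 0 <= f k) ->
  (forall k, e k = f k - f k.+1) -> (forall k, e k.+1 <= e k) ->
  forall n, e n <= f 0 / n.+1%:R.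
Proof.
move=> f0 eE e_dec n; rewrite ler_pdivlMr ?ltr0n// mulrC.
suff : n.+1%:R * e n <= f 0 - f n.+1 by have := f0 n.+1; lra.
elim: n => [|k IH]; first by rewrite mul1r eE.
rewrite -natr1 mulrDl mul1r.
have : k.+1%:R * e k.+1 <= k.+1%:R * e k by rewrite ler_wpM2l.
by move: IH; have := eE k.+1; lra.
Qed.

(** The squared norms of [y k = (1 - h)^k (y 0)] form a convex sequence, because [<y k, y k.+2>] is
    the squared norm of [y k.+1]. Their decrements dominate [<h (y k), y k>], so [decay_seq]
    applies. *)
Lemma qpos_pow_decay (h : bop H H) (y : nat -> H) n :
  qpos h -> rnm h <= 1 -> (forall k, y k.+1 = (bid H - h) (y k)) ->
  complex.Re (hdot H (h (y n)) (y n)) <= rnm (y 0) ^+ 2 / n.+1%:R.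
Proof.
move=> hp h1 yS.
have ga : adj (bid H - h) = bid H - h by rewrite adjB adj1 hp.1.
pose f k := rnm (y k) ^+ 2.
apply: (@le_trans _ _ (f n - f n.+1)).
  rewrite /f yS bopB bidE rnm_sqB (Re_dotC (y n)).
  have := qpos_sq_le (y n) hp h1.
  by move: (complex.Re _) (rnm (y n) ^+ 2) (rnm (h _) ^+ 2) => *; lra.
apply: (@decay_seq (fun k => f k - f k.+1) f) => // k; first exact: sqr_ge0.
have := sqr_ge0 (rnm (y k - y k.+2)); rewrite rnm_sqB.
have -> : hdot H (y k) (y k.+2) = hdot H (y k.+1) (y k.+1).
  by rewrite !yS [RHS]adjP ga.
rewrite dotxx /f/=; move: (rnm (y k) ^+ 2) (rnm (y k.+1) ^+ 2) (rnm (y k.+2) ^+ 2).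
by move=> *; lra.
Qed.

(** Take [u = 1 - (1 - h)^(2N)] with [h] a small multiple of the sum of all [b b' + b' b]. It is a
    polynomial in [h] without constant term, so it lies in [A], and [h] dominates a multiple of each
    [b' b], so [qpos_pow_decay] makes [b (1 - u)] small. *)
Lemma approx_unit_exists (s : seq (bop H H)) (r : R) :
  (forall b, b \in s -> A b) -> 0 < r ->
  exists u, [/\ A u, rnm u <= 1, adj u = u &
    forall b, b \in s -> rnm (u ** b - b) < r /\ rnm (b ** u - b) < r].
Proof.
have [sA cA mA aA] := csA => sAb r0.
pose h0 := \sum_(b <- s) (b ** adj b + adj b ** b).
pose c := (rnm h0 + 1)^-1; have d0 : 0 < rnm h0 + 1 by rewrite ltr_wpDl ?rnm_ge0.
have c0 : 0 < c by rewrite invr_gt0.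
pose h := c%:C *: h0.
have h0p : qpos h0.
  apply: qpos_sum => b; apply: qposD; last exact: qpos_cstar.
  by rewrite -{1}(adjK b); exact: qpos_cstar.
have hp : qpos h by apply: qposZ => //; exact: ltW.
have h1 : rnm h <= 1.
  by rewrite /h rnmZ cab_real gtr0_norm// ler_pdivrMl// mulr1 lerDl.
have Ah : A h.
  apply: subZ => //; rewrite /h0 big_seq; apply: sub_sum => // b bs.
  have Ab := sAb b bs.
  by apply: subD => //; apply: mA => //; exact: aA.
have Reh y : complex.Re (hdot H (h y) y) =
    c * \sum_(b <- s) (rnm (adj b y) ^+ 2 + rnm (b y) ^+ 2).
  rewrite /h bopZ dotZl Re_scale /h0 bop_sum dot_suml Re_sum.
  congr (_ * _); apply: eq_bigr => b _.
  by rewrite bopD dotDl ReD adj_comp_dot -{1}(adjK b) adj_comp_dot.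
have Reb b y : b \in s -> c * rnm (b y) ^+ 2 <= complex.Re (hdot H (h y) y) /\
    c * rnm (adj b y) ^+ 2 <= complex.Re (hdot H (h y) y).
  move=> bs; rewrite Reh !ler_pM2l// (big_rem b)//=.
  have S0 : 0 <= \sum_(j <- rem b s) (rnm (adj j y) ^+ 2 + rnm (j y) ^+ 2).
    by apply: sumr_ge0 => j _; rewrite addr_ge0// sqr_ge0.
  have := sqr_ge0 (rnm (adj b y)); have := sqr_ge0 (rnm (b y)).
  by move: S0; move: (bigop.body _ _ _) (rnm _ ^+ 2) (rnm _ ^+ 2) => *; lra.
(* Chosen so that [c * rnm (b (w x)) ^+ 2 <= q * rnm x ^+ 2] means [rnm (b ** w) <= r / 2]. *)
pose q := c * (r / 2) ^+ 2; have q0 : 0 < q by rewrite mulr_gt0// exprn_gt0// divr_gt0.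
have [N _ hN] := near_infty_natSinv_lt (PosNum q0).
have {}hN : (N + N).+1%:R^-1 < q by apply: (hN (N + N)%N); rewrite /= leq_addr.
(* With an even exponent [w] is a square, so it is positive and [1 - w] is a contraction. *)
pose w := bpow (bid H - h) (N + N); exists (bid H - w).
have wa : adj (bpow (bid H - h) N) = bpow (bid H - h) N.
  by apply: bpow_adj; rewrite adjB adj1 hp.1.
have wE : w = adj (bpow (bid H - h) N) ** bpow (bid H - h) N.
  by rewrite wa /w bpow_add.
have wwa : adj w = w by rewrite wE adjM adjK.
have w1 : rnm w <= 1.
  rewrite /w; elim: (N + N)%N => [|k IH]; first exact: rnm_bid.
  rewrite /= (le_trans (rnm_bcomp _ _))// mulr_ile1 ?rnm_ge0//.
  exact: qpos_compl.
have bw b : (b \in s \/ adj b \in s) -> rnm (b ** w) < r.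
  move=> bs; apply: (@le_lt_trans _ _ (r / 2)); last first.
    by rewrite ltr_pdivrMr// mulr_natr mulr2n ltrDl.
  apply: rnm_bopP => [|x]; first by rewrite divr_ge0// ltW.
  rewrite -(ler_pXn2r (n := 2)) ?nnegrE ?rnm_ge0//; last first.
    by rewrite mulr_ge0 ?rnm_ge0// divr_ge0// ltW.
  rewrite exprMn -(ler_pM2l c0) [leRHS]mulrA bcompE.
  apply: (@le_trans _ _ (complex.Re (hdot H (h (w x)) (w x)))).
    case: bs => /(Reb _ (w x)) []; first by [].
    by move=> _; rewrite adjK.
  apply: le_trans (@qpos_pow_decay h (fun k => bpow (bid H - h) k x) (N + N) hp h1 _) _ => //.
  rewrite mulrC.
  by rewrite ler_wpM2r ?sqr_ge0// ltW.
split.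
- rewrite /w; elim: (N + N)%N => [|k IH]; first by rewrite /= subrr; exact: sub0.
  have -> : bid H - bpow (bid H - h) k.+1 =
      (bid H - bpow (bid H - h) k) + h - h ** (bid H - bpow (bid H - h) k).
    by rewrite /=; bop_ring.
  by apply: subB => //; [exact: subD|exact: mA].
- by apply: qpos_compl => //; rewrite wE; exact: qpos_cstar.
- by rewrite adjB adj1 wwa.
move=> b bs; split.
  have -> : (bid H - w) ** b - b = - adj (adj b ** w).
    by rewrite adjM adjK wwa; bop_ring.
  by rewrite rnmN rnm_adj; apply: bw; right; rewrite adjK.
have -> : b ** (bid H - w) - b = - (b ** w) by bop_ring.
by rewrite rnmN; apply: bw; left.
Qed.

Lemma approx_unit_proper : ProperFilter (approx_unit A).
Proof.
apply: Build_ProperFilter_ex => [|].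
  move=> U [s [r0 [/posC[r r0' ->] sA hU]]].
  have [u [Au u1 _ us]] := approx_unit_exists sA r0'.
  exists u; apply: hU => //; first by rewrite rnm_le.
  move=> b /us[h1 h2]; split; first exact: (@rnm_lt_i _ _ (u ** b - b) r h1).
  exact: (@rnm_lt_i _ _ (b ** u - b) r h2).
split.
- by exists [::], 1.
- move=> P Q [s [r0 [/posC[r rp ->] sA hP]]] [s' [r0' [/posC[r' rp' ->] sA' hQ]]].
  exists (s ++ s'), (Num.min r r')%:C; split.
  + by rewrite ltcC lt_min rp.
  + by move=> b; rewrite mem_cat => /orP[/sA|/sA'].
  move=> u Au u1 h; split; [apply: hP => //|apply: hQ => //] => b bs.
    have [|h1 h2] := h b; first by rewrite mem_cat bs.
    by split; [apply: (lt_le_trans h1)|apply: (lt_le_trans h2)];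
      rewrite lecC ge_min lexx.
  have [|h1 h2] := h b; first by rewrite mem_cat bs orbT.
  by split; [apply: (lt_le_trans h1)|apply: (lt_le_trans h2)];
    rewrite lecC ge_min lexx orbT.
- move=> P Q PQ [s [r [r0 sA hP]]]; exists s, r; split=> // u Au u1 h.
  exact/PQ/hP.
Qed.

Lemma approx_unit_near b (e : R) : A b -> 0 < e ->
  approx_unit A [set u | [/\ A u, rnm u <= 1, rnm (u ** b - b) < e &
    rnm (b ** u - b) < e]].
Proof.
move=> Ab e0; exists [:: b], e%:C; split; first by rewrite ltcC.
  by move=> b'; rewrite inE => /eqP ->.
move=> u Au u1 h; have := h b (mem_head _ _).
move=> -[h1 h2]; split=> //; first by rewrite -rnm_le.
  exact: (@rnm_lt_e _ _ (u ** b - b) e h1).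
exact: (@rnm_lt_e _ _ (b ** u - b) e h2).
Qed.

End ApproximateUnit.
(** * Functionals on a C*-algebra *)

(** A row of squared norm at most [N] times a column of squared norm at most [M]. The geometric mean
    of [M] and [N] is replaced by the arithmetic one, which is just as good when both are close to
    1. *)
Lemma rnm_rowcol (R : realType) (H K K' L : hilbert R) (a : bop K L) (b : bop K' L)
    (c : bop H K) (d : bop H K') (M N : R) : 0 <= M -> 0 <= N ->
  (forall v, rnm (c v) ^+ 2 + rnm (d v) ^+ 2 <= M * rnm v ^+ 2) ->
  (forall u, rnm (adj a u) ^+ 2 + rnm (adj b u) ^+ 2 <= N * rnm u ^+ 2) ->
  rnm (a ** c + b ** d) <= (M + N) / 2.
Proof.
move=> M0 N0 cd ab; have MN0 : 0 <= (M + N) / 2 by rewrite divr_ge0 ?addr_ge0.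
apply: rnm_dotP => // x y; rewrite bopD !bcompE dotDl (adjP a) (adjP b).
apply: (le_trans (cabD _ _)).
apply: (le_trans (lerD (cauchy_schwarz _ _) (cauchy_schwarz _ _))).
have := cd x; have := ab y; move: (rnm_ge0 (c x)) (rnm_ge0 (d x)) (rnm_ge0 (adj a y))
  (rnm_ge0 (adj b y)) (rnm_ge0 x) (rnm_ge0 y).
move: (rnm (c x)) (rnm (d x)) (rnm (adj a y)) (rnm (adj b y)) (rnm x) (rnm y).
move=> p q r s X Y p0 q0 r0 s0 X0 Y0 h1 h2.
rewrite -(ler_pXn2r (n := 2)) ?nnegrE ?addr_ge0 ?mulr_ge0 ?addr_ge0//.
apply: (@le_trans _ _ ((p ^+ 2 + q ^+ 2) * (r ^+ 2 + s ^+ 2))).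
  rewrite -subr_ge0.
  have -> : (p ^+ 2 + q ^+ 2) * (r ^+ 2 + s ^+ 2) - (p * r + q * s) ^+ 2 =
    (p * s - q * r) ^+ 2 by ring.
  exact: sqr_ge0.
apply: (@le_trans _ _ (M * X ^+ 2 * (N * Y ^+ 2))).
  by rewrite ler_pM// addr_ge0 ?sqr_ge0.
rewrite -subr_ge0.
have -> : ((M + N) / 2 * X * Y) ^+ 2 - M * X ^+ 2 * (N * Y ^+ 2) =
  ((M - N) / 2 * X * Y) ^+ 2 by field.
exact: sqr_ge0.
Qed.

(** A term linear in [k] that is dominated by [e^2] plus a quadratic must be small: optimize over
    [k]. *)
Lemma cab_perturb (R : realType) (z : R[i]) (e n : R) : 0 < e -> 0 <= n ->
  (forall k, complex.Re (k * z) <= e ^+ 2 + 2 * (cab k * n) ^+ 2) -> cab z <= 3 * e * n.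
Proof.
move=> e0 n0 h; have [s s1 sz] := Re_phase z; have z0 := cab_ge0 z.
have {}h (r : R) : 0 <= r -> r * cab z <= e ^+ 2 + 2 * (r * n) ^+ 2.
  move=> r0; have := h (r%:C * s).
  by rewrite -mulrA sz -rCM/= cabM s1 mulr1 cab_real ger0_norm.
have [n1|n1] := eqVneq n 0.
  have [->|z1] := eqVneq (cab z) 0; first by rewrite n1 mulr0.
  (* Without a quadratic term [k] is unrestricted; this value would give [e^2 + 1 <= e^2]. *)
  have := h ((e ^+ 2 + 1) / cab z); rewrite mulfVK// n1 mulr0 expr0n/= mulr0 addr0.
  by rewrite divr_ge0 ?addr_ge0 ?sqr_ge0// => /(_ isT); lra.
have n2 : 0 < n by rewrite lt_neqAle eq_sym n1.
(* At this value the right side is [e^2 + 2 e^2], the origin of the factor 3. *)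
have := h (e / n) (ltW (divr_gt0 e0 n2)); rewrite divfK//.
rewrite mulrAC ler_pdivrMr// => h1.
rewrite -(ler_pM2l e0) (le_trans h1)//.
by have -> : (e ^+ 2 + 2 * e ^+ 2) * n = e * (3 * e * n) by ring.
Qed.

Section Functional.
Variables (R : realType) (H : hilbert R) (A : set (bop H H)).
Hypothesis csA : cstar_algebra A.
Implicit Types (w : bop H H -> R[i]) (a b y : bop H H).

Definition fun_bound w (M : R) := 0 <= M /\ forall a, A a -> cab (w a) <= M * rnm a.

Section Linear.
Variable w : bop H H -> R[i].
Hypothesis fw : functional A w.

Lemma fun_lin c a b : A a -> A b -> w (c *: a + b) = c * w a + w b.
Proof. by case: fw => lw _; exact: lw. Qed.

Lemma fun0 : w 0 = 0.
Proof.
have [sA _ _ _] := csA; have := fun_lin (-1) (sub0 sA) (sub0 sA).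
by rewrite scaler0 addr0 mulN1r addNr.
Qed.

Lemma funD a b : A a -> A b -> w (a + b) = w a + w b.
Proof. by move=> Aa Ab; have := fun_lin 1 Aa Ab; rewrite scale1r mul1r. Qed.

Lemma funZ c a : A a -> w (c *: a) = c * w a.
Proof.
have [sA _ _ _] := csA => Aa.
by have := fun_lin c Aa (sub0 sA); rewrite !addr0 fun0 addr0.
Qed.

Lemma funN a : A a -> w (- a) = - w a.
Proof. by move=> Aa; rewrite -scaleN1r funZ// mulN1r. Qed.

Lemma funB a b : A a -> A b -> w (a - b) = w a - w b.
Proof.
have [sA _ _ _] := csA => Aa Ab; rewrite funD ?funN//; exact: subN.
Qed.

Lemma fun_boundP : exists M, fun_bound w M.
Proof.
have [_ [M wM]] := fw; exists (cab M); split; first exact: cab_ge0.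
move=> a Aa; rewrite -lecC rCM -!cabE.
have := wM a Aa; rewrite rnmE => h; rewrite (le_trans h)// -rnmE.
have h0 : 0 <= (rnm (w a : R[i]^o))%:C :> R[i] by rewrite -[0]/(0%:C) lecC rnm_ge0.
have := le_trans h0 h.
move=> /ger0_norm <-; by rewrite normrM normr_id.
Qed.

End Linear.

Lemma functional_intro w (M : R) :
  (forall c a b, A a -> A b -> w (c *: a + b) = c * w a + w b) ->
  (forall a, A a -> cab (w a) <= M * rnm a) -> functional A w.
Proof.
move=> lw wM; split; first by move=> c a b Aa Ab; exact: lw.
exists M%:C => a Aa; rewrite rnmE -rCM.
by have := wM a Aa; rewrite -lecC -cabE.
Qed.

Definition fadj w : bop H H -> R[i] := fun a => cj (w (adj a)).

Lemma fadj_functional w : functional A w -> functional A (fadj w).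
Proof.
have [sA _ _ aA] := csA => fw; have [M [M0 wM]] := fun_boundP fw.
apply: (@functional_intro _ M) => [c a b Aa Ab|a Aa].
  rewrite /fadj adjD adjZ fun_lin//; [|exact: aA|exact: aA].
  by rewrite rmorphD rmorphM/= conjCK.
by rewrite /fadj cab_conj -(rnm_adj a) wM//; exact: aA.
Qed.

Lemma fadj_bound w M : fun_bound w M -> fun_bound (fadj w) M.
Proof.
have [_ _ _ aA] := csA => -[M0 wM]; split=> // a Aa.
by rewrite /fadj cab_conj -(rnm_adj a) wM//; exact: aA.
Qed.

Lemma fadjK w a : fadj (fadj w) a = w a.
Proof. by rewrite /fadj adjK conjCK. Qed.

(** The row [(c, 1 - c c')] is a contraction, so [c + k (b - c c' b)], its product with the column
    [(1, k b)], has norm [1 + O(|k|^2)]. As [w c] is within [e^2] of the maximum, the part linear in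
    [k] is small by [cab_perturb]. *)
Lemma norming_unit w (e : R) c b : functional A w -> fun_bound w 1 -> 0 < e ->
  A c -> rnm c <= 1 -> 1 - e ^+ 2 <= complex.Re (w c) -> A b ->
  cab (w (c ** adj c ** b) - w b) <= 3 * e * rnm b.
Proof.
have [sA cA mA aA] := csA.
move=> fw w1 e0 Ac c1 wc Ab; rewrite cabBC; apply: cab_perturb => // [|k]; first exact: rnm_ge0.
pose y := c ** bid H + (bid H - c ** adj c) ** (k *: b).
have Acc : A (c ** adj c ** b) by apply: (mA) => //; apply: mA => //; exact: aA.
have yE : y = c + k *: (b - c ** adj c ** b).
  by rewrite /y bcomp1r bcompZr bcompBl bcomp1l.
have Ay : A y by rewrite yE; apply: subD => //; apply: subZ => //; exact: subB.
have ny : rnm y <= (1 + (cab k * rnm b) ^+ 2 + 1) / 2.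
  apply: rnm_rowcol => // [|v|u]; first by have := sqr_ge0 (cab k * rnm b); lra.
    rewrite bidE bopZ rnmZ mulrDl mul1r lerD2l -exprMn -mulrA.
    rewrite ler_pXn2r ?nnegrE ?mulr_ge0 ?rnm_ge0 ?cab_ge0//.
    by rewrite ler_wpM2l ?cab_ge0// rnm_bop.
  rewrite adjB adjM adjK adj1 mul1r bopB bidE rnm_sqB bcompE.
  rewrite adjP' dotxx/=.
  have : rnm (c (adj c u)) ^+ 2 <= rnm (adj c u) ^+ 2.
    rewrite ler_pXn2r ?nnegrE ?rnm_ge0// (le_trans (rnm_bop _ _))//.
    by rewrite ler_piMl ?rnm_ge0.
  by move: (rnm _ ^+ 2) (rnm _ ^+ 2) (rnm _ ^+ 2) => p q r; lra.
have := le_trans (Re_le _) (w1.2 y Ay); rewrite mul1r => /le_trans/(_ ny).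
rewrite {1}yE (funD fw) ?(funZ fw) ?(funB fw)//; last 2 first.
- exact: subB.
- by apply: subZ => //; exact: subB.
rewrite ReD; have := sqr_ge0 (cab k * rnm b); move: (complex.Re (k * _)) => z.
move: wc; move: (e ^+ 2) ((cab k * rnm b) ^+ 2) (complex.Re (w c)) => *; lra.
Qed.

(** After normalization, [c c'] for a nearly norming [c] serves by [norming_unit]. Such a cut-off
    lets estimates on products with elements of [A] control the slices of multipliers. *)
Lemma fun_left_unit w (e : R) : functional A w -> 0 < e ->
  exists c : bop H H, [/\ A c, rnm c <= 1 &
    forall y, A y -> cab (w (y - c ** y)) <= e * rnm y].
Proof.
have [sA cA mA aA] := csA => fw e0; have [M [M0 wM]] := fun_boundP fw.
pose E := [set cab (w a) | a in [set a | A a /\ rnm a <= 1]].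
have E0 : E 0 by exists 0; rewrite /= ?(fun0 fw) ?cab0// rnm0; split=> //; exact: sub0.
have hE : has_sup E.
  split; first by exists 0.
  exists M => _ [a [Aa a1] <-]; rewrite (le_trans (wM a Aa))//.
  by rewrite ler_piMr.
pose N := sup E; have N0 : 0 <= N by exact: ub_le_sup hE.2 _ E0.
have wN a : A a -> cab (w a) <= N * rnm a.
  move=> Aa; have [a0|a0] := eqVneq (rnm a) 0.
    by rewrite (rnm_eq0 a0) (fun0 fw) cab0 rnm0 mulr0.
  have ap : 0 < rnm a by rewrite lt_neqAle eq_sym a0 rnm_ge0.
  rewrite -ler_pdivrMr// mulrC; apply: (ub_le_sup hE.2).
  exists ((rnm a)^-1%:C *: a).
    split; first exact: subZ.
    by rewrite rnmZ cab_real ger0_norm ?invr_ge0 ?rnm_ge0// mulVf.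
  by rewrite (funZ fw)// cabM cab_real ger0_norm// invr_ge0 rnm_ge0.
have [N00|N1] := eqVneq N 0.
  exists 0; split=> [||y Ay]; [exact: sub0|by rewrite rnm0|].
  by rewrite bcomp0l subr0 (le_trans (wN _ Ay))// N00 mul0r mulr_ge0 ?rnm_ge0// ltW.
have Np : 0 < N by rewrite lt_neqAle eq_sym N1.
pose v a := N^-1%:C * w a.
have v1 a : A a -> cab (v a) <= 1 * rnm a.
  move=> Aa; rewrite /v cabM cab_real ger0_norm ?invr_ge0// mul1r.
  by rewrite ler_pdivrMl// wN.
have fv : functional A v.
  apply: functional_intro v1 => k a b Aa Ab.
  by rewrite /v (fun_lin fw)//; ring.
(* Cancels the factor 3 of [norming_unit] and the normalization by [N]. *)
have d0 : 0 < e / (3 * N) by rewrite divr_gt0// mulr_gt0.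
have [_ [a [Aa a1] <-] aN] := sup_adherent (mulr_gt0 Np (exprn_gt0 2 d0)) hE.
have [s s1 sa] := Re_phase (w a); pose c := s *: a; have Ac : A c by exact: subZ.
have c1 : rnm c <= 1 by rewrite rnmZ s1 mul1r.
have vc : 1 - (e / (3 * N)) ^+ 2 <= complex.Re (v c).
  rewrite /v (funZ fw)// sa -rCM/= ler_pdivlMl// mulrBr mulr1.
  exact: ltW.
exists (c ** adj c); split=> [||y Ay]; first by apply: mA => //; exact: aA.
  by rewrite rnm_cstar' expr_le1 ?rnm_ge0.
have := norming_unit fv (conj ler01 v1) d0 Ac c1 vc Ay.
rewrite /v -mulrBr cabM cab_real ger0_norm ?invr_ge0// ler_pdivrMl// cabBC => h.
rewrite (funB fw)//; last by apply: (mA) => //; apply: (mA) => //; exact: aA.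
by apply: (le_trans h); rewrite le_eqVlt; apply/orP; left; apply/eqP; field.
Qed.

Lemma fun_right_unit w (e : R) : functional A w -> 0 < e ->
  exists c : bop H H, [/\ A c, rnm c <= 1 &
    forall y, A y -> cab (w (y - y ** c)) <= e * rnm y].
Proof.
have [sA cA mA aA] := csA => fw e0.
have [c [Ac c1 h]] := fun_left_unit (fadj_functional fw) e0.
exists (adj c); split; [exact: aA|by rewrite rnm_adj|move=> y Ay].
have := h (adj y) (aA _ Ay); rewrite /fadj cab_conj rnm_adj.
by rewrite adjB adjM !adjK.
Qed.

End Functional.

(** * Closed spans and extension by density *)

Section Span.
Variables (R : realType) (V : normedModType R[i]).
Implicit Types X P : set V.

Lemma lin_span_sub X x : X x -> lin_span X x.
Proof.
move=> Xx; exists 1%N, (fun=> 1), (fun=> x); split=> //.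
by rewrite big_ord_recl big_ord0 scale1r addr0.
Qed.

Lemma closure_sub X x : X x -> closure X x.
Proof. by move=> Xx; exact: subset_closure. Qed.

Lemma closed_span_sub X x : X x -> closed_span X x.
Proof. by move=> Xx; apply: closure_sub; exact: lin_span_sub. Qed.

Lemma lin_span_subspace X : Defs.subspace (lin_span X).
Proof.
split; first by exists 0%N, (fun=> 0), (fun=> 0); split=> [[]//|]; rewrite big_ord0.
move=> c _ _ [n [f [u [Xu ->]]]] [m [g [v [Xv ->]]]].
exists (n + m)%N, (fun i => match fintype.split i with inl j => c * f j | inr k => g k end),
  (fun i => match fintype.split i with inl j => u j | inr k => v k end); split.
  by move=> i; case: (fintype.split i).
rewrite big_split_ord/= scaler_sumr; congr (_ + _); apply: eq_bigr => i _.
  by rewrite (unsplitK (inl i)) scalerA.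
by rewrite (unsplitK (inr i)).
Qed.

Lemma closure_subspace P : Defs.subspace P -> Defs.subspace (closure P).
Proof.
move=> sP; split; first by apply: closure_sub; exact: sub0.
move=> c u v /closure_rnm Pu /closure_rnm Pv; apply/closure_rnm => e e0.
have c1 : 0 < cab c + 1 by rewrite ltr_wpDl ?cab_ge0.
have [|u' Pu' uu'] := Pu (e / 2 / (cab c + 1)); first by rewrite !divr_gt0.
have [|v' Pv' vv'] := Pv (e / 2); first by rewrite divr_gt0.
exists (c *: u' + v'); first by case: sP => _; apply.
rewrite opprD addrACA -scalerBr (le_lt_trans (rnmD _ _))// rnmZ.
rewrite [ltRHS](splitr e) ler_ltD//.
rewrite (@le_trans _ _ ((cab c + 1) * rnm (u - u')))//.
  by rewrite ler_wpM2r ?rnm_ge0// lerDl.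
by rewrite mulrC -ler_pdivlMr// ltW.
Qed.

Lemma closed_span_subspace X : Defs.subspace (closed_span X).
Proof. exact: closure_subspace (lin_span_subspace X). Qed.

Lemma closed_span_closed X : closed (closed_span X).
Proof. exact: closed_closure. Qed.

Lemma lin_span_ind X P : Defs.subspace P -> X `<=` P -> lin_span X `<=` P.
Proof.
move=> sP XP _ [n [c [u [Xu ->]]]]; apply: sub_sum => // i _.
by apply: subZ => //; exact: XP.
Qed.

Lemma closed_span_ind X P : Defs.subspace P -> closed P -> X `<=` P ->
  closed_span X `<=` P.
Proof.
move=> sP /closed_rnm cP XP x /closure_rnm Xx; apply: cP => e /Xx[y Xy xy].
by exists y => //; exact: (lin_span_ind sP XP).
Qed.

End Span.

Section PreimageClosed.
Variables (R : realType) (V W : normedModType R[i]).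

Lemma closed_lip (P : set W) (f : V -> W) (M : R) : closed P ->
  (forall x y, rnm (f x - f y) <= M * rnm (x - y)) -> closed (f @^-1` P).
Proof.
move=> /closed_rnm cP fM; apply/closed_rnm => x h; apply: cP => e e0.
have M1 : 0 < `|M| + 1 by rewrite ltr_wpDl ?normr_ge0.
have [|y Py xy] := h (e / (`|M| + 1)); first by rewrite divr_gt0.
exists (f y) => //; apply: (le_lt_trans (fM _ _)).
rewrite (@le_lt_trans _ _ ((`|M| + 1) * rnm (x - y)))//.
  by rewrite ler_wpM2r ?rnm_ge0// (le_trans (ler_norm M))// lerDl.
by rewrite mulrC -ltr_pdivlMr.
Qed.

Lemma closed_bop (P : set W) (a : bop V W) : closed P -> closed (a @^-1` P).
Proof.
move=> cP; apply: (@closed_lip _ _ (rnm a)) => // x y.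
by rewrite -bop_rB rnm_bop.
Qed.

Lemma subspace_bop (P : set W) (a : bop V W) :
  Defs.subspace P -> Defs.subspace (a @^-1` P).
Proof.
move=> sP; split; first by rewrite /= bop_r0; exact: sub0.
by move=> c u v /= Pu Pv; rewrite bop_rD bop_rZ; case: sP => _; apply.
Qed.

Lemma closed0 : closed [set 0 : W].
Proof.
apply/closed_rnm => x h; apply: rnm_small => e e0.
by have [_ -> ] := h e e0; rewrite subr0 => /ltW.
Qed.

Lemma subspace0 : Defs.subspace [set 0 : W].
Proof. by split=> // c u v /= -> ->; rewrite scaler0 addr0. Qed.

Lemma bop_ext_span (X : set V) (a b : bop V W) : closed_span X = setT ->
  (forall x, X x -> a x = b x) -> a = b.
Proof.
move=> dX ab; apply: bop_eq => x; apply/eqP; rewrite -subr_eq0 -bopB; apply/eqP.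
have := closed_span_ind (subspace_bop (a - b) subspace0) (closed_bop (a := a - b) closed0).
move=> /(_ X); apply; last by rewrite dX.
by move=> y Xy; change ((a - b) y = 0); rewrite bopB ab// subrr.
Qed.

End PreimageClosed.

Section Extension.
Variables (R : realType) (V W : normedModType R[i]) (I : Type).
Variables (s : I -> V) (g : I -> W) (M : R).

(** Formal linear combinations, so that one combination can be evaluated in [V] and in [W] before
    the value in [W] is known to depend only on that in [V]. *)
Definition comb (U : normedModType R[i]) (f : I -> U) (l : seq (R[i] * I)) : U :=
  \sum_(p <- l) p.1 *: f p.2.

Lemma comb_cat (U : normedModType R[i]) (f : I -> U) l l' :
  comb f (l ++ l') = comb f l + comb f l'.
Proof. exact: big_cat. Qed.

Definition scale_comb (c : R[i]) (l : seq (R[i] * I)) := [seq (c * p.1, p.2) | p <- l].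

Lemma comb_scale (U : normedModType R[i]) (f : I -> U) c l :
  comb f (scale_comb c l) = c *: comb f l.
Proof.
by rewrite /comb big_map scaler_sumr; apply: eq_bigr => p _; rewrite scalerA.
Qed.

Lemma lin_spanP v : lin_span (range s) v -> exists l, v = comb s l.
Proof.
move=> [n [c [u [su ->]]]].
have /choice[i iP] : forall k, exists i, s i = u k.
  by move=> k; have [j _ <-] := su k; exists j.
exists [seq (c k, i k) | k <- index_enum 'I_n].
by rewrite /comb big_map; apply: eq_bigr => k _; rewrite /= iP.
Qed.

Hypothesis W_complete : forall u : nat -> W, cauchy_rnm u -> exists x, lim_rnm u x.
Hypothesis M0 : 0 <= M.
Hypothesis sgM : forall l, rnm (comb g l) <= M * rnm (comb s l).

(** The closure of the graph of [comb s l -> comb g l]. *)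
Let G v w := forall e : R, 0 < e ->
  exists2 l, rnm (v - comb s l) < e & rnm (w - comb g l) < e.

Let G_lin c v w v' w' : G v w -> G v' w' -> G (c *: v + v') (c *: w + w').
Proof.
move=> Gv Gv' e e0; have c1 : 0 < cab c + 1 by rewrite ltr_wpDl ?cab_ge0.
have [|l lv lw] := Gv (e / 2 / (cab c + 1)); first by rewrite !divr_gt0.
have [|l' lv' lw'] := Gv' (e / 2); first by rewrite divr_gt0.
have key (U : normedModType R[i]) (x y x' y' : U) :
    rnm (x - y) < e / 2 / (cab c + 1) -> rnm (x' - y') < e / 2 ->
    rnm (c *: x + x' - (c *: y + y')) < e.
  move=> xy xy'; rewrite opprD addrACA -scalerBr (le_lt_trans (rnmD _ _))// rnmZ.
  rewrite [ltRHS](splitr e) ler_ltD//.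
  rewrite (@le_trans _ _ ((cab c + 1) * rnm (x - y)))//.
    by rewrite ler_wpM2r ?rnm_ge0// lerDl.
  by rewrite mulrC -ler_pdivlMr// ltW.
by exists (scale_comb c l ++ l'); rewrite comb_cat comb_scale; exact: key.
Qed.

Let G_bd v w : G v w -> rnm w <= M * rnm v.
Proof.
move=> Gv; apply/ler_addgt0Pr => e e0.
have M1 : 0 < M + 1 by rewrite ltr_wpDl.
have [|l lv lw] := Gv (e / (M + 1)); first by rewrite divr_gt0.
have k1 := rnm_tri (comb g l) w 0; have k2 := rnm_tri v (comb s l) 0.
rewrite !subr0 in k1 k2; rewrite (rnmBC (comb s l)) in k2.
have k3 : M * rnm (comb s l) <= M * (rnm (v - comb s l) + rnm v) by rewrite ler_wpM2l.
have k4 : M * rnm (v - comb s l) <= M * (e / (M + 1)) by rewrite ler_wpM2l// ltW.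
have k5 : e / (M + 1) + M * (e / (M + 1)) = e.
  by rewrite -{1}(mul1r (e / _)) -mulrDl addrC mulrC divfK// gt_eqF.
have := sgM l; move: k1 k3 k4 k5 lw; rewrite mulrDr.
move: (rnm w) (rnm v) (rnm (comb g l)) (rnm (comb s l)) (rnm (w - _)) (rnm (v - _)).
by move: (e / _) => *; lra.
Qed.

(** The bound [sgM] passes to the closed graph [G] and makes it single-valued; completeness of [W]
    gives a value at each vector of the closed span. *)
Lemma comb_extension : exists E : V -> W,
  [/\ linear_on (closed_span (range s)) E,
      forall v, closed_span (range s) v -> rnm (E v) <= M * rnm v &
      forall i, E (s i) = g i].
Proof.
have Gex v : closed_span (range s) v -> exists w, G v w.
  move=> /closure_rnm h.
  have /choice[u uP] : forall n, exists l, rnm (v - comb s l) < n.+1%:R^-1.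
    move=> n; have [|_ /lin_spanP[l ->] vl] := h n.+1%:R^-1; first by rewrite invr_gt0.
    by exists l.
  have small (e : R) : 0 < e -> exists N, forall n, (N <= n)%N -> rnm (v - comb s (u n)) < e.
    move=> e0; have [N _ hN] := near_infty_natSinv_lt (PosNum e0).
    by exists N => n Nn; apply: lt_trans (uP n) (hN n Nn).
  have M1 : 0 < M + 1 by rewrite ltr_wpDl.
  have [|w wP] := W_complete (u := fun n => comb g (u n)).
    move=> e e0; have [|N hN] := small (e / 2 / (M + 1)); first by rewrite !divr_gt0.
    exists N => m n /hN h1 /hN h2.
    have -> : comb g (u m) - comb g (u n) = comb g (u m ++ scale_comb (-1) (u n)).
      by rewrite comb_cat comb_scale scaleN1r.
    rewrite (le_lt_trans (sgM _))// comb_cat comb_scale scaleN1r.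
    have := rnm_tri v (comb s (u m)) (comb s (u n)); rewrite (rnmBC _ v).
    move: (rnm (_ - comb s (u n))) => q h3.
    have h4 : q <= 2 * (e / 2 / (M + 1)) by lra.
    have h5 : M * q <= M * (2 * (e / 2 / (M + 1))) by rewrite ler_wpM2l.
    apply: (le_lt_trans h5).
    have -> : M * (2 * (e / 2 / (M + 1))) = M * (e / (M + 1)).
      by congr (_ * _); rewrite mulrA (mulrC 2) divfK.
    by rewrite mulrCA gtr_pMr// ltr_pdivrMr// mul1r ltrDl.
  exists w => e e0; have [N hN] := small e e0; have [N' hN'] := wP e e0.
  exists (u (maxn N N')); first by apply: hN; exact: leq_maxl.
  by rewrite rnmBC; apply: hN'; exact: leq_maxr.
have Guniq v w w' : G v w -> G v w' -> w = w'.
  move=> h h'; have := G_lin (-1) h' h.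
  rewrite !scaleN1r addNr => /G_bd; rewrite rnm0 mulr0 => h0.
  by apply/eqP; rewrite -subr_eq0 addrC; apply/eqP/rnm_eq0/le_anti; rewrite h0 rnm_ge0.
have /choice[E EP] : forall v, exists w, closed_span (range s) v -> G v w.
  move=> v; have [/Gex[w wP]|nv] := pselect (closed_span (range s) v).
    by exists w.
  by exists 0.
have sS := closed_span_subspace (range s).
exists E; split.
- move=> c u v Su Sv; apply: (Guniq (c *: u + v)).
    by apply: EP; case: sS => _; apply.
  by apply: G_lin; exact: EP.
- by move=> v /EP/G_bd.
- move=> i; apply: (Guniq (s i)); first by apply: EP; apply: closed_span_sub; exists i.
  move=> e e0; exists [:: (1, i)];
    by rewrite /comb big_seq1 scale1r subrr rnm0.
Qed.

End Extension.

(** Reduces an estimate on finitely many elementary tensors to finitely many orthogonal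
    components. *)
Lemma gram_schmidt (R : realType) (K : hilbert R) (ys : seq K) :
  exists n (e : 'I_n -> K), (forall i j, hdot K (e i) (e j) = (i == j)%:R) /\
    forall y, y \in ys -> y = \sum_i hdot K y (e i) *: e i.
Proof.
elim: ys => [|y ys [n [e [eo es]]]]; first by exists 0%N, (fun=> 0); split=> [[]|].
pose r := y - \sum_i hdot K y (e i) *: e i.
have re j : hdot K r (e j) = 0.
  rewrite dotBl dot_suml (bigD1 j)//= dotZl eo eqxx mulr1 big1 ?addr0 ?subrr//.
  by move=> i ij; rewrite dotZl eo (negbTE ij) mulr0.
have [r0|r0] := eqVneq r 0.
  exists n, e; split=> // z; rewrite inE => /orP[/eqP ->|/es//].
  by apply/eqP; rewrite -subr_eq0 -/r r0.
have rp : rnm r != 0 by apply: contra_neq r0 => /rnm_eq0.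
pose f := (rnm r)^-1%:C *: r.
have fe j : hdot K f (e j) = 0 by rewrite dotZl re mulr0.
have ef j : hdot K (e j) f = 0 by rewrite dotC fe conjC0.
have ff : hdot K f f = 1.
  rewrite dotZl dotZr dotxx (_ : cj (rnm r)^-1%:C = (rnm r)^-1%:C); last exact: conjc_real.
  by rewrite -!rCM mulrA -invfM -expr2 mulVf// expf_neq0.
exists n.+1, (fun i => if unlift ord0 i is Some j then e j else f); split.
  move=> i j; case: (unliftP ord0 i) => [i'|] ->; case: (unliftP ord0 j) => [j'|] ->.
  - by rewrite eo (inj_eq lift_inj).
  - by rewrite ef eq_sym (negbTE (neq_lift _ _)).
  - by rewrite fe (negbTE (neq_lift _ _)).
  - by rewrite ff eqxx.
have decomp z : z = \sum_i hdot K z (e i) *: e i + hdot K z f *: f ->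
    z = \sum_(i < n.+1) hdot K z (if unlift ord0 i is Some j then e j else f) *:
      (if unlift ord0 i is Some j then e j else f).
  move=> zE; rewrite big_ord_recl unlift_none [RHS]addrC {1}zE; congr (_ + _).
  by apply: eq_bigr => i _; rewrite liftK.
move=> z; rewrite inE => /orP[/eqP ->|/es zE]; apply: decomp.
  have yE : y = \sum_i hdot K y (e i) *: e i + r by rewrite addrC subrK.
  have -> : hdot K y f = (rnm r)%:C.
    rewrite {1}yE dotDl dot_suml big1 ?add0r => [|i _]; last by rewrite dotZl ef mulr0.
    rewrite dotZr (_ : cj (rnm r)^-1%:C = (rnm r)^-1%:C); last exact: conjc_real.
    by rewrite dotxx -rCM expr2 mulKf.
  by rewrite scalerA -rCM divff// rC1 scale1r.
rewrite [X in _ + X](_ : _ = 0) ?addr0//.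
by rewrite {1}zE dot_suml big1 ?scale0r// => i _; rewrite dotZl ef mulr0.
Qed.
(** * Hilbert space tensor products *)

Section TensorFlip.
Variables (R : realType) (H K L : hilbert R) (t : htensor H K L).

Lemma flip_dense : closed_span [set t x y | y in setT & x in setT] = setT.
Proof.
rewrite -(htens_dense t); congr closed_span; apply/seteqP; split=> z /=.
  by move=> [y _ [x _ <-]]; exists x => //; exists y.
by move=> [x _ [y _ <-]]; exists y => //; exists x.
Qed.

Lemma flip_dot y y' x x' :
  hdot L (t x y) (t x' y') = hdot K y y' * hdot H x x'.
Proof. by rewrite htens_dot mulrC. Qed.

(** Transfers statements on the first leg to the second, on the same space [L]. *)
Definition htens_flip : htensor K H L :=
  @HTensor R K H L (fun y x => t x y) (fun x => htens_linearr t x)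
    (fun y => htens_linearl t y) flip_dot flip_dense.

End TensorFlip.

Section TensorLegs.
Variables (R : realType) (H K L : hilbert R) (t : htensor H K L).

Lemma htens_Dr x y y' : t x (y + y') = t x y + t x y'.
Proof. by have := htens_linearr t x 1 y y'; rewrite !scale1r. Qed.
Lemma htens_0l y : t 0 y = 0.
Proof. by have := htens_linearl t y (-1) 0 0; rewrite !scaleN1r addr0 oppr0 addNr. Qed.
Lemma htens_0r x : t x 0 = 0.
Proof. by have := htens_linearr t x (-1) 0 0; rewrite !scaleN1r addr0 oppr0 addNr. Qed.
Lemma htens_Zl c x y : t (c *: x) y = c *: t x y.
Proof. by have := htens_linearl t y c x 0; rewrite htens_0l !addr0. Qed.
Lemma htens_Zr c x y : t x (c *: y) = c *: t x y.
Proof. by have := htens_linearr t x c y 0; rewrite htens_0r !addr0. Qed.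

Lemma rnm_htens x y : rnm (t x y) = rnm x * rnm y.
Proof.
apply/eqP; rewrite -(eqrXn2 (n := 2)) ?mulr_ge0 ?rnm_ge0//; apply/eqP.
by apply: rC_inj; rewrite -dotxx htens_dot !dotxx -rCM exprMn.
Qed.

Lemma leg_subproof y : (fun x => t x y) \in @bounded_linear R H L.
Proof.
apply/asboolP; split; first by move=> c x x'; rewrite htens_linearl.
by exists (rnm y)%:C => x; rewrite !rnmE rnm_htens -rCM mulrC.
Qed.

Definition leg (y : K) : bop H L := Bop (leg_subproof y).

Lemma legE y x : leg y x = t x y. Proof. by []. Qed.

Lemma rnm_leg y : rnm (leg y) <= rnm y.
Proof. by apply: rnm_bopP => [|x]; rewrite ?rnm_ge0// legE rnm_htens mulrC. Qed.

Lemma leg_lin c y y' : leg (c *: y + y') = c *: leg y + leg y'.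
Proof. by apply: bop_eq => x; rewrite bopD bopZ !legE htens_Dr htens_Zr. Qed.

Lemma adj_leg_htens y x y' : adj (leg y) (t x y') = hdot K y' y *: x.
Proof.
by apply: dot_ext_eq => z; rewrite -adjP' legE htens_dot dotZl mulrC.
Qed.

Lemma adj_leg_leg y y' : adj (leg y) ** leg y' = hdot K y' y *: bid H.
Proof. by apply: bop_eq => x; rewrite bcompE legE adj_leg_htens. Qed.

Lemma tens_ext (M : normedModType R[i]) (a b : bop L M) :
  (forall x y, a (t x y) = b (t x y)) -> a = b.
Proof.
move=> ab; apply: (bop_ext_span (htens_dense t)) => _ [x _ [y _ <-]].
exact: ab.
Qed.

Lemma range_htens : range (fun p : H * K => t p.1 p.2) = [set t x y | x in setT & y in setT].
Proof.
apply/seteqP; split=> z /=; first by move=> [[x y] _ <-]; exists x => //; exists y.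
by move=> [x _ [y _ <-]]; exists (x, y).
Qed.

End TensorLegs.

Section FrameNorm.
Variables (R : realType) (H K L : hilbert R) (t : htensor H K L).

(** For orthonormal [e]: [Z] lies in [H] tensored with the span of [e]. *)
Definition framed n (e : 'I_n -> K) (Z : L) :=
  Z = \sum_i (leg t (e i)) (adj (leg t (e i)) Z).

Lemma framed_norm n (e : 'I_n -> K) Z : framed e Z ->
  rnm Z ^+ 2 = \sum_i rnm (adj (leg t (e i)) Z) ^+ 2.
Proof.
move=> ZE; apply: rC_inj; rewrite -dotxx {1}ZE dot_suml rmorph_sum/=.
by apply: eq_bigr => i _; rewrite -legE adjP dotxx.
Qed.

Lemma framed_htens n (e : 'I_n -> K) x y : y = \sum_i hdot K y (e i) *: e i ->
  framed e (t x y).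
Proof.
move=> yE; rewrite /framed {1}yE.
rewrite (_ : t x _ = \sum_i hdot K y (e i) *: t x (e i)).
  by apply: eq_bigr => i _; rewrite adj_leg_htens legE htens_Zl.
elim/big_rec2: _ => [|i _ z _ <-]; first by rewrite htens_0r.
by rewrite htens_Dr htens_Zr.
Qed.

Lemma framed_lin n (e : 'I_n -> K) c Z Z' : framed e Z -> framed e Z' ->
  framed e (c *: Z + Z').
Proof.
rewrite /framed => ZE ZE'; rewrite {1}ZE {1}ZE' scaler_sumr -big_split/=.
by apply: eq_bigr => i _; rewrite -!legE !bop_rD !bop_rZ.
Qed.

Lemma framed_comb n (e : 'I_n -> K) (l : seq (R[i] * (H * K))) :
  (forall p, p \in l -> p.2.2 = \sum_i hdot K p.2.2 (e i) *: e i) ->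
  framed e (comb (fun p => t p.1 p.2) l).
Proof.
rewrite /comb big_seq => h.
have f0 : framed e 0.
  by rewrite /framed big1// => i _; rewrite !bop_r0.
elim/big_ind: _ => [//|Z Z' hZ hZ'|p pl]; first by have := framed_lin 1 hZ hZ'; rewrite !scale1r.
by rewrite -[_ *: _]addr0; apply: framed_lin => //; apply: framed_htens; exact: h.
Qed.

End FrameNorm.

Section OperatorTensor.
Variables (R : realType).

(** The operator [a (x) 1]. In an orthonormal frame containing all second legs of a combination it
    acts by [a] on each component, so the bound follows from the sum of squares. *)
Let amp_exists (H K L : hilbert R) (t : htensor H K L) (a : bop H H) :
  exists2 c : bop L L, rnm c <= rnm a & forall x y, c (t x y) = t (a x) y.
Proof.
pose s (p : H * K) := t p.1 p.2; pose g (p : H * K) := t (a p.1) p.2.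
have bd l : rnm (comb g l) <= rnm a * rnm (comb s l).
  have [n [e [eo es]]] := gram_schmidt [seq p.2.2 | p <- l].
  have fZ : framed t e (comb s l).
    by apply: framed_comb => p pl; apply: es; apply/mapP; exists p.
  have fY : framed t e (comb g l).
    have -> : comb g l = comb s [seq (p.1, (a p.2.1, p.2.2)) | p <- l].
      by rewrite /comb big_map.
    apply: framed_comb => p /mapP[q ql ->]; apply: es.
    by apply/mapP; exists q.
  have Yi i : adj (leg t (e i)) (comb g l) = a (adj (leg t (e i)) (comb s l)).
    rewrite /comb !bop_r_sum; apply: eq_bigr => p _.
    by rewrite !bop_rZ !adj_leg_htens bop_rZ.
  rewrite -(ler_pXn2r (n := 2)) ?nnegrE ?mulr_ge0 ?rnm_ge0// exprMn.
  rewrite (framed_norm fZ) (framed_norm fY) mulr_sumr; apply: ler_sum => i _.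
  rewrite Yi -exprMn ler_pXn2r ?nnegrE ?mulr_ge0 ?rnm_ge0//; exact: rnm_bop.
have [E [El Eb Es]] := @comb_extension _ _ _ _ s g _
  (@complete_rnm R L) (rnm_ge0 a) bd.
rewrite range_htens htens_dense in El Eb.
have [|c cE] := @bopE_exists R L L E (rnm a) (fun k u v => El k u v I I).
  by move=> v; exact: Eb.
exists c => [|x y]; last by rewrite cE; exact: (Es (x, y)).
by apply: rnm_bopP => [|x]; rewrite ?rnm_ge0// cE; exact: Eb.
Qed.

Variables (H K L : hilbert R) (t : htensor H K L).
Implicit Types (a : bop H H) (b : bop K K).

(** As the product of [a (x) 1] and [1 (x) b], the latter from the flipped tensor product. *)
Lemma op_tens_exists a b :
  exists2 c : bop L L, rnm c <= rnm a * rnm b & forall x y, c (t x y) = t (a x) (b y).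
Proof.
have [c c1 cE] := amp_exists t a.
have [d d1 dE] := amp_exists (htens_flip t) b.
exists (c ** d) => [|x y].
  by rewrite (le_trans (rnm_bcomp _ _))// ler_pM ?rnm_ge0.
by rewrite bcompE (dE y x) /= cE.
Qed.

Lemma op_tensE a b x y : op_tens t a b (t x y) = t (a x) (b y).
Proof.
have [c _ cE] := op_tens_exists a b.
have h : exists c : bop L L, forall x y, c (t x y) = t (a x) (b y) by exists c.
by move: x y; exact: (getPex h).
Qed.

Lemma op_tens_eq a b (c : bop L L) :
  (forall x y, c (t x y) = t (a x) (b y)) -> op_tens t a b = c.
Proof. by move=> cE; apply: (tens_ext (t := t)) => x y; rewrite op_tensE cE. Qed.

Lemma op_tensM a a' b b' :
  op_tens t a b ** op_tens t a' b' = op_tens t (a ** a') (b ** b').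
Proof. by apply/esym/op_tens_eq => x y; rewrite !bcompE !op_tensE. Qed.

Lemma op_tens_adj a b : adj (op_tens t a b) = op_tens t (adj a) (adj b).
Proof.
apply/esym/op_tens_eq => x y; apply: dot_ext_eq => z.
rewrite -adjP' dotC [RHS]dotC; congr cj.
pose f1 : bop L H := adj (leg t y) ** op_tens t a b.
pose f2 : bop L H := adj (leg t (adj b y)).
have -> : hdot L (op_tens t a b z) (t x y) = hdot H (f1 z) x by rewrite bcompE -adjP'.
have -> : hdot L z (t (adj a x) (adj b y)) = hdot H ((a ** f2) z) x.
  by rewrite bcompE adjP -adjP'.
suff -> : f1 = a ** f2 by [].
apply: (tens_ext (t := t)) => x' y'.
by rewrite !bcompE op_tensE !adj_leg_htens bop_rZ adjP.
Qed.

Lemma op_tens_leg a b y : op_tens t a b ** leg t y = leg t (b y) ** a.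
Proof. by apply: bop_eq => x; rewrite !bcompE !legE op_tensE. Qed.

End OperatorTensor.

(** * Bounded maps on closed spans *)

Section BoundedOn.
Variables (R : realType) (V W : normedModType R[i]).

Lemma bounded_onP (X : set V) (E : V -> W) (M : R) : linear_on X E ->
  (forall u, X u -> rnm (E u) <= M * rnm u) -> bounded_linear_on X E.
Proof.
move=> lE EM; split=> //; exists M%:C => u Xu.
by rewrite !rnmE -rCM lecC EM.
Qed.

Lemma bounded_on_real (X : set V) (E : V -> W) : bounded_linear_on X E ->
  exists2 M : R, 0 <= M & forall u, X u -> rnm (E u) <= M * rnm u.
Proof.
move=> [_ [M EM]]; exists (cab M) => [|u Xu]; first exact: cab_ge0.
have := EM u Xu; rewrite !rnmE => h.
have h0 : 0 <= M * (rnm u)%:C by apply: le_trans h; rewrite -[0]/(0%:C) lecC rnm_ge0.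
move: h; rewrite -(ger0_norm h0) cabE cabM cab_real lecC.
by rewrite (ger0_norm (rnm_ge0 u)).
Qed.

Lemma bounded_on_closed (X : set V) (E : V -> W) (P : set W) :
  bounded_linear_on (closed_span X) E -> Defs.subspace P -> closed P ->
  (forall x, X x -> P (E x)) -> forall x, closed_span X x -> P (E x).
Proof.
move=> bE sP /closed_rnm cP PE x Sx; have [M M0 EM] := bounded_on_real bE.
have sX := closed_span_subspace X.
have lE u v : closed_span X u -> closed_span X v -> E (u - v) = E u - E v.
  move=> Su Sv; have := bE.1 (-1) v u Sv Su.
  by rewrite !scaleN1r addrC => ->; rewrite addrC.
have lin : lin_span X `<=` [set u | closed_span X u /\ P (E u)].
  apply: lin_span_ind; last by move=> u Xu; split; [exact: closed_span_sub|exact: PE].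
  split; first split; first exact: (sub0 sX).
    by rewrite -(subr0 0) lE ?subrr; [exact: sub0|exact: sub0|exact: sub0].
  move=> c u v [Su Pu] [Sv Pv]; split; first by case: sX => _; apply.
  by rewrite bE.1//; case: sP => _; apply.
apply: cP => e e0; have M1 : 0 < M + 1 by rewrite ltr_wpDl.
have [|y /lin[Sy Py] xy] := proj1 (closure_rnm _ _) Sx (e / (M + 1)).
  by rewrite divr_gt0.
exists (E y) => //; rewrite -lE//.
rewrite (le_lt_trans (EM _ (subB sX Sx Sy)))//.
move: xy; rewrite ltr_pdivlMr// => /le_lt_trans; apply.
by rewrite mulrDr mulr1 mulrC lerDl rnm_ge0.
Qed.

Lemma agree_span (X : set V) (E F : V -> W) :
  bounded_linear_on (closed_span X) E -> bounded_linear_on (closed_span X) F ->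
  (forall x, X x -> E x = F x) -> forall x, closed_span X x -> E x = F x.
Proof.
move=> bE bF EF x Sx.
have [M M0 EM] := bounded_on_real bE; have [N N0 FN] := bounded_on_real bF.
apply/eqP; rewrite -subr_eq0; apply/eqP.
apply: (@bounded_on_closed X (fun x => E x - F x) [set 0]) Sx.
- apply: (@bounded_onP _ _ (M + N)) => [c u v Xu Xv|u Xu].
    by rewrite bE.1// bF.1// opprD addrACA -scalerBr.
  by rewrite (le_trans (rnmB _ _))// mulrDl lerD ?EM ?FN.
- by split=> // c u v -> ->; rewrite scaler0 addr0.
- exact: closed0.
- by move=> y Xy; rewrite /= EF// subrr.
Qed.

Lemma rnm_dense (X : set V) (a : bop V W) (M : R) : closed_span X = setT -> 0 <= M ->
  (forall x, lin_span X x -> rnm (a x) <= M * rnm x) -> rnm a <= M.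
Proof.
move=> dX M0 aM; apply: rnm_bopP => // x; apply/ler_addgt0Pr => e e0.
have : closed_span X x by rewrite dX.
have S1 : 0 < rnm a + M + 1 by have := rnm_ge0 a; lra.
move=> /closure_rnm /(_ (e / (rnm a + M + 1)))[|y Xy xy]; first by rewrite divr_gt0.
have k1 := rnm_tri (a y) (a x) 0; have k2 := rnm_tri x y 0.
rewrite !subr0 -bop_rB in k1; rewrite !subr0 rnmBC in k2.
have k3 := rnm_bop a (x - y); have k4 := aM y Xy.
have k5 : M * rnm y <= M * (rnm (x - y) + rnm x) by rewrite ler_wpM2l.
have k6 : rnm a * rnm (x - y) + M * rnm (x - y) <= e.
  move: xy; rewrite ltr_pdivlMr//; have := rnm_ge0 (x - y); rewrite -mulrDl.
  by move: (rnm _) => q; rewrite [q * _]mulrC !mulrDl mul1r; lra.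
move: k1 k3 k4 k5 k6; rewrite mulrDr.
move: (rnm (a x)) (rnm (a (x - y))) (rnm (a y)) (rnm y) (rnm x) (rnm a * _) => *.
move: (M * rnm (x - y)) => *; lra.
Qed.

End BoundedOn.

(** * Matrix amplification of homomorphisms *)

Section MatrixAmplification.
Variables (R : realType) (H L H' L' : hilbert R) (n : nat).
Variables (t : 'I_n -> bop H L) (t' : 'I_n -> bop H' L').
Hypothesis tt : forall i j, adj (t i) ** t j = (i == j)%:R *: bid H.
Hypothesis tt' : forall i j, adj (t' i) ** t' j = (i == j)%:R *: bid H'.
Variables (A : set (bop H H)) (p : bop H H -> bop H' H').
Hypotheses (csA : cstar_algebra A) (hp : star_hom A p).

Let Q : bop L L := \sum_i t i ** adj (t i).
Let ent (X : bop L L) i j := adj (t i) ** X ** t j.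
(** A copy of the [n] by [n] matrices over [A], acting on the range of the projection [Q]; [pn]
    applies [p] entrywise. *)
Let C : set (bop L L) := [set X | [/\ X ** Q = X, Q ** X = X & forall i j, A (ent X i j)]].
Let pn (X : bop L L) : bop L' L' := \sum_i \sum_j t' i ** p (ent X i j) ** adj (t' j).

Let Qa : adj Q = Q.
Proof. by rewrite adj_sum; apply: eq_bigr => i _; rewrite adjM adjK. Qed.

Let adj_t_Q i : adj (t i) ** Q = adj (t i).
Proof.
rewrite bcomp_sumr (bigD1 i)//= bcompA tt eqxx scale1r bcomp1l big1 ?addr0// => j ji.
by rewrite bcompA tt eq_sym (negbTE ji) scale0r bcomp0l.
Qed.

Let QQ : Q ** Q = Q.
Proof. by rewrite {1}/Q bcomp_suml; apply: eq_bigr => i _; rewrite -bcompA adj_t_Q. Qed.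

Let Q1 : rnm Q <= 1.
Proof.
have := rnm_cstar Q; rewrite Qa QQ => h; have := rnm_ge0 Q.
by rewrite le_eqVlt => /orP[/eqP <-//|q0]; rewrite -(ler_pM2l q0) -expr2 -h mulr1.
Qed.

Let entM X Y i j : X ** Q = X -> ent (X ** Y) i j = \sum_k ent X i k ** ent Y k j.
Proof.
move=> XQ; rewrite /ent -{1}XQ /Q bcomp_sumr bcomp_suml bcomp_sumr bcomp_suml.
by apply: eq_bigr => k _; rewrite !bcompA.
Qed.

Let Q_t i : Q ** t i = t i.
Proof. by rewrite -[in LHS](adjK (t i)) -Qa -adjM adj_t_Q adjK. Qed.

Let ent_lin c X Y i j : ent (c *: X + Y) i j = c *: ent X i j + ent Y i j.
Proof. by rewrite /ent bcompDr bcompZr bcompDl bcompZl. Qed.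

Let ent_adj X i j : ent (adj X) i j = adj (ent X j i).
Proof. by rewrite /ent !adjM adjK bcompA. Qed.

Let csC : cstar_algebra C.
Proof.
have [sA cA mA aA] := csA; split.
- split; first by split=> [||i j]; rewrite ?bcomp0l ?bcomp0r// /ent bcomp0r bcomp0l; exact: sub0.
  move=> c X Y [X1 X2 X3] [Y1 Y2 Y3]; split.
  + by rewrite bcompDl bcompZl X1 Y1.
  + by rewrite bcompDr bcompZr X2 Y2.
  + by move=> i j; rewrite ent_lin; case: sA => _; apply.
- have -> : C = (fun X => X ** Q - X) @^-1` [set 0] `&` ((fun X => Q ** X - X) @^-1` [set 0] `&`
      \bigcap_(ij in setT) ((fun X => ent X ij.1 ij.2) @^-1` A)).
    apply/seteqP; split=> X /=.
      by move=> [X1 X2 X3]; rewrite X1 X2 subrr; split=> //; split=> // -[i j] _; exact: X3.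
    move=> [/subr0_eq X1 [/subr0_eq X2 X3]]; split=> // i j.
    exact: (X3 (i, j)).
  apply: closedI; [|apply: closedI].
  + apply: (@closed_lip _ _ _ _ _ 2); first exact: closed0.
    move=> X Y; rewrite (_ : _ - _ - _ = (X - Y) ** Q - (X - Y)); last by bop_ring.
    rewrite (le_trans (rnmB _ _))//; have := rnm_bcomp (X - Y) Q.
    by have := rnm_ge0 (X - Y); have := rnm_ge0 Q; move: Q1; nra.
  + apply: (@closed_lip _ _ _ _ _ 2); first exact: closed0.
    move=> X Y; rewrite (_ : _ - _ - _ = Q ** (X - Y) - (X - Y)); last by bop_ring.
    rewrite (le_trans (rnmB _ _))//; have := rnm_bcomp Q (X - Y).
    by have := rnm_ge0 (X - Y); have := rnm_ge0 Q; move: Q1; nra.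
  + apply: closed_bigI => -[i j] _ /=.
    apply: (@closed_lip _ _ _ _ _ (rnm (adj (t i)) * rnm (t j))) => // X Y.
    rewrite /ent -bcompBl -bcompBr (le_trans (rnm_bcomp _ _))// mulrAC.
    by rewrite ler_wpM2r ?rnm_ge0// rnm_bcomp.
- move=> X Y [X1 X2 X3] [Y1 Y2 Y3]; split; rewrite -?bcompA ?Y1 ?bcompA ?X2// => i j.
  by rewrite entM//; apply: sub_sum => // k _; exact: mA.
- move=> X [X1 X2 X3]; split.
  + by rewrite -[in LHS]Qa -adjM X2.
  + by rewrite -[in LHS]Qa -adjM X1.
  + by move=> i j; rewrite ent_adj; exact: aA.
Qed.

Let pn_hom : star_hom C pn.
Proof.
have [sA cA mA aA] := csA; have [pl pm pa] := hp; split.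
- move=> c X Y [_ _ X3] [_ _ Y3]; rewrite /pn scaler_sumr -big_split/=.
  apply: eq_bigr => i _; rewrite scaler_sumr -big_split/=; apply: eq_bigr => j _.
  by rewrite ent_lin pl// bcompDr bcompZr bcompDl bcompZl.
- move=> X Y [X1 _ X3] [_ _ Y3]; rewrite /pn bcomp_suml; apply: eq_bigr => i _.
  rewrite bcomp_suml.
  transitivity (\sum_k \sum_j t' i ** (p (ent X i k) ** p (ent Y k j)) ** adj (t' j)).
    rewrite exchange_big/=; apply: eq_bigr => j _.
    rewrite entM// (star_hom_sum csA hp) => [|k]; last exact: mA.
    rewrite bcomp_sumr bcomp_suml; apply: eq_bigr => k _.
    by rewrite pm.
  apply: eq_bigr => k _; rewrite [RHS]bcomp_sumr [RHS](bigD1 k)//= [X in _ + X]big1 ?addr0.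
    rewrite [RHS]bcomp_sumr; apply: eq_bigr => j _.
    by rewrite !bcompA -(bcompA _ (adj (t' k))) tt' eqxx scale1r bcomp1r.
  move=> l lk; rewrite bcomp_sumr big1// => j _.
  rewrite !bcompA -(bcompA _ (adj (t' k))) tt' eq_sym (negbTE lk) scale0r.
  by rewrite bcomp0r !bcomp0l.
- move=> X [_ _ X3]; rewrite /pn adj_sum exchange_big/=; apply: eq_bigr => i _.
  rewrite adj_sum; apply: eq_bigr => j _.
  by rewrite ent_adj pa// !adjM adjK bcompA.
Qed.

(** This is complete contractivity of [p]: compress [X] by [Q] into the matrix algebra [C], where
    [pn] is a homomorphism and [star_hom_contr] applies. *)
Lemma amplification_contr (X : bop L L) :
  (forall i j, A (adj (t i) ** X ** t j)) ->
  rnm (\sum_i \sum_j t' i ** p (adj (t i) ** X ** t j) ** adj (t' j)) <= rnm X.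
Proof.
move=> AX; pose Y := Q ** X ** Q.
have eY i j : ent Y i j = adj (t i) ** X ** t j.
  by rewrite /ent /Y !bcompA adj_t_Q -bcompA Q_t.
have CY : C Y.
  split; [by rewrite /Y -bcompA QQ|by rewrite /Y !bcompA QQ|].
  by move=> i j; rewrite eY.
apply: (@le_trans _ _ (rnm Y)).
  have := star_hom_contr csC pn_hom CY; rewrite /pn.
  by under eq_bigr => i _ do under eq_bigr => j _ do rewrite eY.
rewrite (le_trans (rnm_bcomp _ _))//.
have h := rnm_bcomp Q X; have := rnm_ge0 (Q ** X); have := rnm_ge0 X; have := rnm_ge0 Q.
move: Q1 h; move: (rnm (Q ** X)) (rnm X) (rnm Q) => x y q *; nra.
Qed.

End MatrixAmplification.

(** * Minimal tensor products *)

Section MinTens.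
Variables (R : realType) (H K L : hilbert R) (t : htensor H K L).
Variables (A : set (bop H H)) (B : set (bop K K)).

Lemma min_tens_mem a b : A a -> B b -> min_tens t A B (op_tens t a b).
Proof. by move=> Aa Bb; apply: closed_span_sub; exists a => //; exists b. Qed.

Lemma min_tens_subspace : Defs.subspace (min_tens t A B).
Proof. exact: closed_span_subspace. Qed.

Lemma min_tens_closed : closed (min_tens t A B).
Proof. exact: closed_span_closed. Qed.

Lemma min_tens_ind (P : set (bop L L)) : Defs.subspace P -> closed P ->
  (forall a b, A a -> B b -> P (op_tens t a b)) -> min_tens t A B `<=` P.
Proof.
by move=> sP cP PAB; apply: closed_span_ind => // _ [a Aa [b Bb <-]]; exact: PAB.
Qed.

Lemma op_tens_flip a b : op_tens (htens_flip t) b a = op_tens t a b.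
Proof. by apply/op_tens_eq => y x; rewrite /= op_tensE. Qed.

Lemma min_tens_flip : min_tens (htens_flip t) B A = min_tens t A B.
Proof.
rewrite /min_tens; congr closed_span; apply/seteqP; split=> X /=.
  by move=> [b Bb [a Aa <-]]; exists a => //; exists b; rewrite ?op_tens_flip.
by move=> [a Aa [b Bb <-]]; exists b => //; exists a; rewrite ?op_tens_flip.
Qed.

Lemma closed_bcompl (V W U : normedModType R[i]) (P : set (bop V U)) (b : bop V W) :
  closed P -> closed [set X : bop W U | P (X ** b)].
Proof.
move=> cP; apply: (@closed_lip _ _ _ P (fun X : bop W U => X ** b) (rnm b)) => // X Y.
by rewrite -bcompBl mulrC rnm_bcomp.
Qed.

Lemma closed_bcompr (V W U : normedModType R[i]) (P : set (bop V U)) (b : bop W U) :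
  closed P -> closed [set X : bop V W | P (b ** X)].
Proof.
move=> cP; apply: (@closed_lip _ _ _ P (fun X : bop V W => b ** X) (rnm b)) => // X Y.
by rewrite -bcompBr rnm_bcomp.
Qed.

Lemma subspace_bcompl (V W U : normedModType R[i]) (P : set (bop V U)) (b : bop V W) :
  Defs.subspace P -> Defs.subspace [set X : bop W U | P (X ** b)].
Proof.
move=> sP; split; first by rewrite /= bcomp0l; exact: sub0.
by move=> c X Y /= PX PY; rewrite bcompDl bcompZl; case: sP => _; apply.
Qed.

Lemma subspace_bcompr (V W U : normedModType R[i]) (P : set (bop V U)) (b : bop W U) :
  Defs.subspace P -> Defs.subspace [set X : bop V W | P (b ** X)].
Proof.
move=> sP; split; first by rewrite /= bcomp0r; exact: sub0.
by move=> c X Y /= PX PY; rewrite bcompDr bcompZr; case: sP => _; apply.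
Qed.

Lemma min_tens_mult X Y : (forall a b, A a -> A b -> A (a ** b)) ->
  (forall a b, B a -> B b -> B (a ** b)) ->
  min_tens t A B X -> min_tens t A B Y -> min_tens t A B (X ** Y).
Proof.
move=> mA mB AX AY; move: X AX; apply: min_tens_ind.
- exact: subspace_bcompl min_tens_subspace.
- exact: closed_bcompl min_tens_closed.
move=> a b Aa Bb /=; move: Y AY; apply: min_tens_ind.
- exact: subspace_bcompr min_tens_subspace.
- exact: closed_bcompr min_tens_closed.
move=> a' b' Aa' Bb' /=; rewrite op_tensM; apply: min_tens_mem; first exact: mA.
exact: mB.
Qed.

Lemma min_tens_cstar : cstar_algebra A -> cstar_algebra B ->
  cstar_algebra (min_tens t A B).
Proof.
move=> [sA cA mA aA] [sB cB mB aB]; split.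
- exact: min_tens_subspace.
- exact: min_tens_closed.
- by move=> X Y; exact: min_tens_mult.
apply: (@min_tens_ind [set X | min_tens t A B (adj X)]).
- split; first by rewrite /= adj0; exact: sub0 min_tens_subspace.
  move=> c X Y /= PX PY; rewrite adjD adjZ.
  by case: min_tens_subspace => _; apply.
- apply: (@closed_lip _ _ _ (min_tens t A B) (fun X : bop L L => adj X) 1).
    exact: min_tens_closed.
  by move=> X Y; rewrite -adjB rnm_adj mul1r.
by move=> a b Aa Bb /=; rewrite op_tens_adj; apply: min_tens_mem; [exact: aA|exact: aB].
Qed.

Lemma min_tens_nondegenerate : Defs.nondegenerate A -> Defs.nondegenerate B ->
  Defs.nondegenerate (min_tens t A B).
Proof.
move=> nA nB; set X := [set (a : bop L L) x | a in min_tens t A B & x in setT].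
have sX := closed_span_subspace X; have cX := @closed_span_closed _ _ X.
suff h x y : closed_span X (t x y).
  apply/seteqP; split=> // z _; have : closed_span [set t x y | x in setT & y in setT] z.
    by rewrite htens_dense.
  by apply: closed_span_ind => // _ [x _ [y _ <-]]; exact: h.
have : closed_span [set (a : bop H H) x | a in A & x in setT] x by rewrite nA.
move: x; apply: (closed_span_ind (P := leg t y @^-1` closed_span X)).
- exact: subspace_bop.
- exact: closed_bop.
move=> _ [a Aa [x _ <-]] /=.
have : closed_span [set (a : bop K K) x | a in B & x in setT] y by rewrite nB.
move: y; apply: (closed_span_ind (P := leg (htens_flip t) (a x) @^-1` closed_span X)).
- exact: subspace_bop.
- exact: closed_bop.
move=> _ [b Bb [y _ <-]] /=; apply: closed_span_sub.
exists (op_tens t a b); first exact: min_tens_mem.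
by exists (t x y) => //; rewrite op_tensE.
Qed.

(** [tens_map] is a choice, meaningful once one such map exists; [tens_map_eq] then computes it,
    since bounded maps agreeing on elementary tensors coincide. *)
Lemma tens_mapP (V : normedModType R[i]) (f : bop H H -> bop K K -> V) :
  (exists E, bounded_linear_on (min_tens t A B) E /\
    forall a b, A a -> B b -> E (op_tens t a b) = f a b) ->
  bounded_linear_on (min_tens t A B) (tens_map t A B f) /\
    forall a b, A a -> B b -> tens_map t A B f (op_tens t a b) = f a b.
Proof. by move=> h; exact: (getPex h). Qed.

Lemma tens_map_eq (V : normedModType R[i]) (f : bop H H -> bop K K -> V)
    (E : bop L L -> V) :
  bounded_linear_on (min_tens t A B) E ->
  (forall a b, A a -> B b -> E (op_tens t a b) = f a b) ->
  forall X, min_tens t A B X -> tens_map t A B f X = E X.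
Proof.
move=> bE Ef; have [|bT Tf] := @tens_mapP V f; first by exists E.
apply: agree_span => // _ [a Aa [b Bb <-]].
by rewrite Tf// Ef.
Qed.

End MinTens.

Section AmplifyHom.
Variables (R : realType) (H K L H' L' : hilbert R).
Variables (t : htensor H K L) (t' : htensor H' K L').
Variables (A : set (bop H H)) (B : set (bop K K)) (p : bop H H -> bop H' H').
Hypotheses (csA : cstar_algebra A) (hp : star_hom A p).

Let I := {q : bop H H * bop K K | A q.1 /\ B q.2}.
Let s (q : I) := op_tens t (sval q).1 (sval q).2.
Let g (q : I) := op_tens t' (p (sval q).1) (sval q).2.

(** Contractivity of [p (x) id], tested on finite sums [Z] of elementary tensors. In a finite
    orthonormal frame for the second leg, the operator acts on [Z] as the matrix amplification of
    [p]. *)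
Let comb_bd l : rnm (comb g l) <= rnm (comb s l).
Proof.
have [sA _ _ _] := csA.
apply: (rnm_dense (htens_dense t')); first exact: rnm_ge0.
rewrite -range_htens => _ /lin_spanP[l' ->].
set Z := comb _ l'; set Y := comb g l; set X := comb s l.
pose ys := [seq q.2.2 | q <- l'].
pose bs (i : 'I_(size l)) : bop K K := (sval (tnth (in_tuple l) i).2).2.
(* The frame must also contain the images of the second legs under each [b], so that [Y Z] is
   recovered from its components. *)
have [n [e [eo es]]] :=
  gram_schmidt (ys ++ [seq bop_fun (bs i) y | i <- enum 'I_(size l), y <- ys]).
have fZ : framed t' e Z.
  apply: framed_comb => q ql; apply: es; rewrite mem_cat; apply/orP; left.
  by apply/mapP; exists q.
have fYZ : framed t' e (Y Z).
  have f0 : framed t' e 0 by rewrite /framed big1// => i _; rewrite !bop_r0.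
  rewrite /Y /comb bop_sum big_tnth.
  elim/big_ind: _ => [//|u v hu hv|r _].
    by have := framed_lin 1 hu hv; rewrite !scale1r.
  rewrite bopZ -[_ *: _]addr0; apply: framed_lin => //.
  rewrite /Z /comb bop_r_sum big_seq.
  elim/big_ind: _ => [//|u v hu hv|q ql].
    by have := framed_lin 1 hu hv; rewrite !scale1r.
  rewrite bop_rZ -[_ *: _]addr0; apply: framed_lin => //.
  rewrite /g op_tensE; apply: framed_htens; apply: es; rewrite mem_cat; apply/orP; right.
  apply/allpairsP; exists (r, q.2.2); split=> //; first exact: mem_enum.
  by apply/mapP; exists q.
have tt (H0 L0 : hilbert R) (t0 : htensor H0 K L0) i j :
    adj (leg t0 (e i)) ** leg t0 (e j) = (i == j)%:R *: bid H0.
  by rewrite adj_leg_leg eo eq_sym.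
have ent i j : adj (leg t (e i)) ** X ** leg t (e j) =
    \sum_(r <- l) (r.1 * hdot K ((sval r.2).2 (e j)) (e i)) *: (sval r.2).1.
  rewrite /X /comb bcomp_sumr bcomp_suml; apply: eq_bigr => r _.
  rewrite bcompZr bcompZl -scalerA; congr (_ *: _).
  by rewrite -bcompA op_tens_leg bcompA adj_leg_leg bcompZl bcomp1l.
have Aent i j : A (adj (leg t (e i)) ** X ** leg t (e j)).
  rewrite ent; apply: sub_sum => // r _; apply: subZ => //.
  by case: (svalP r.2).
have := amplification_contr (tt H L t) (tt H' L' t') csA hp Aent.
set W := \sum_i _ => WX.
have YW : Y Z = W Z.
  rewrite /W [RHS]bop_sum; apply: (etrans fYZ); apply: eq_bigr => i _.
  rewrite [RHS]bop_sum {1}fZ !bop_r_sum; apply: eq_bigr => j _.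
  rewrite !bcompE; congr (leg t' (e i) _); rewrite -!bcompE; congr (bop_fun _ _).
  rewrite ent (star_hom_sum csA hp); last first.
    by move=> r; apply: subZ => //; case: (svalP r.2).
  congr (_ ** adj (leg t' (e j))).
  rewrite /Y /comb bcomp_sumr bcomp_suml; apply: eq_bigr => r _.
  rewrite (star_homZ csA hp); last by case: (svalP r.2).
  rewrite bcompZr bcompZl -scalerA; congr (_ *: _).
  by rewrite -bcompA op_tens_leg bcompA adj_leg_leg bcompZl bcomp1l.
by rewrite YW (le_trans (rnm_bop _ _))// ler_wpM2r ?rnm_ge0.
Qed.

Let range_s : range s = [set op_tens t a b | a in A & b in B].
Proof.
apply/seteqP; split=> X /=.
  by move=> [[[a b] [Aa Bb]] _ <-]; exists a => //; exists b.
by move=> [a Aa [b Bb <-]]; exists (exist _ (a, b) (conj Aa Bb)).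
Qed.

Lemma amplify_hom : exists E : bop L L -> bop L' L',
  [/\ bounded_linear_on (min_tens t A B) E,
      forall X, min_tens t A B X -> rnm (E X) <= rnm X &
      forall a b, A a -> B b -> E (op_tens t a b) = op_tens t' (p a) b].
Proof.
have [|E [El Eb Es]] := @comb_extension _ _ _ _ s g _ (@bop_complete R L' L') ler01.
  by move=> l; rewrite mul1r comb_bd.
rewrite range_s in El Eb; exists E; split.
- exact: bounded_onP Eb.
- by move=> X /Eb; rewrite mul1r.
- by move=> a b Aa Bb; exact: (Es (exist _ (a, b) (conj Aa Bb))).
Qed.

End AmplifyHom.
(** * Slice maps *)

Section Slice.
Variables (R : realType) (H K L : hilbert R) (t : htensor H K L).
Implicit Types (X Y : bop L L) (x y z : K).

Definition slr x y X : bop H H := adj (leg t y) ** X ** leg t x.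

Lemma slr_lin x y c X Y : slr x y (c *: X + Y) = c *: slr x y X + slr x y Y.
Proof. by rewrite /slr bcompDr bcompDl bcompZr bcompZl. Qed.

Lemma slrB x y X Y : slr x y (X - Y) = slr x y X - slr x y Y.
Proof. by rewrite /slr bcompBr bcompBl. Qed.

Lemma slr_linl c x x' y X : slr (c *: x + x') y X = c *: slr x y X + slr x' y X.
Proof. by rewrite /slr leg_lin bcompDr bcompZr. Qed.

Lemma slr_linr c x y y' X : slr x (c *: y + y') X = cj c *: slr x y X + slr x y' X.
Proof. by rewrite /slr leg_lin adjD adjZ !bcompDl !bcompZl. Qed.

Lemma rnm_slr x y X : rnm (slr x y X) <= rnm X * rnm x * rnm y.
Proof.
rewrite (le_trans (rnm_bcomp _ _))//.
rewrite (@le_trans _ _ (rnm y * rnm X * rnm x))//; last first.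
  by rewrite (mulrC (rnm y)) mulrAC.
rewrite ler_pM ?rnm_ge0 ?rnm_leg// (le_trans (rnm_bcomp _ _))//.
by rewrite ler_wpM2r ?rnm_ge0// rnm_adj rnm_leg.
Qed.

Lemma slr_op_tens x y a b : slr x y (op_tens t a b) = hdot K (b x) y *: a.
Proof. by rewrite /slr -bcompA op_tens_leg bcompA adj_leg_leg bcompZl bcomp1l. Qed.

Lemma slr_mul_r x y X a b : slr x y (X ** op_tens t a b) = slr (b x) y X ** a.
Proof. by rewrite /slr -!bcompA op_tens_leg. Qed.

Lemma slr_adj x y X : adj (slr x y X) = slr y x (adj X).
Proof. by rewrite /slr !adjM adjK bcompA. Qed.

Lemma slr_dot x y X u v : hdot H (slr x y X u) v = hdot L (X (t u x)) (t v y).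
Proof. by rewrite /slr !bcompE -adjP' !legE. Qed.

Variables (A : set (bop H H)).
Hypothesis csA : cstar_algebra A.

(** It contains the minimal tensor product and also each [Delta a], which is only a multiplier. On
    it, slicing by a functional on [A] needs no limit. *)
Definition slab : set (bop L L) := [set X | forall x y, A (slr x y X)].

Lemma slab_subspace : Defs.subspace slab.
Proof.
have [sA _ _ _] := csA; split=> [x y|c X Y AX AY x y].
  by rewrite /slr bcomp0r bcomp0l; exact: sub0.
by rewrite slr_lin; case: sA => _; apply.
Qed.

Lemma slab_closed : closed slab.
Proof.
have [_ cA _ _] := csA.
have -> : slab = \bigcap_(xy in setT) [set X | A (slr xy.1 xy.2 X)].
  apply/seteqP; split=> X h; first by move=> [x y] _; exact: h.
  by move=> x y; exact: (h (x, y)).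
apply: closed_bigI => -[x y] _ /=.
apply: (@closed_lip _ _ _ A (slr x y) (rnm x * rnm y)) => // X Y.
by rewrite -slrB (le_trans (rnm_slr x y (X - Y)))// -mulrA mulrC.
Qed.

Lemma slab_adj X : slab X -> slab (adj X).
Proof.
by have [_ _ _ aA] := csA => AX x y; rewrite -slr_adj; apply: aA.
Qed.

Lemma slab_op_tens a b : A a -> slab (op_tens t a b).
Proof.
by have [sA _ _ _] := csA => Aa x y; rewrite slr_op_tens; exact: subZ.
Qed.

Lemma slab_min_tens (B : set (bop K K)) X : min_tens t A B X -> slab X.
Proof.
move: X; apply: min_tens_ind; [exact: slab_subspace|exact: slab_closed|].
by move=> a b Aa _; exact: slab_op_tens.
Qed.

Lemma slab_mul_r X a b : slab X -> A a -> slab (X ** op_tens t a b).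
Proof. by have [_ _ mA _] := csA => AX Aa x y; rewrite slr_mul_r; exact: mA. Qed.

Implicit Type w : bop H H -> R[i].

(** The slice [(w (x) id)(X)], given by its matrix coefficients. *)
Definition fslice w X : bop K K :=
  get [set T : bop K K | forall x y, hdot K (T x) y = w (slr x y X)].

Lemma fslice_exists w M X : functional A w -> fun_bound A w M -> slab X ->
  exists2 T : bop K K, rnm T <= M * rnm X &
    forall x y, hdot K (T x) y = w (slr x y X).
Proof.
have [sA _ _ _] := csA => fw [M0 wM] AX.
apply: (@bop_of_form R K K (fun x y => w (slr x y X))).
- by move=> c x x' y; rewrite slr_linl (fun_lin fw).
- by move=> c x y y'; rewrite slr_linr (fun_lin fw).
- by rewrite mulr_ge0 ?rnm_ge0.
- move=> x y; rewrite (le_trans (wM _ (AX x y)))// -!mulrA ler_wpM2l// mulrA.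
  exact: rnm_slr.
Qed.

Lemma fsliceP w X x y : functional A w -> slab X ->
  hdot K (fslice w X x) y = w (slr x y X).
Proof.
move=> fw AX; have [M wM] := fun_boundP fw.
have [T _ TE] := fslice_exists fw wM AX.
have h : exists T : bop K K, forall x y, hdot K (T x) y = w (slr x y X) by exists T.
by move: x y; exact: (getPex h).
Qed.

Lemma fslice_eq w X (T : bop K K) : functional A w -> slab X ->
  (forall x y, hdot K (T x) y = w (slr x y X)) -> fslice w X = T.
Proof. by move=> fw AX TE; apply: bop_dot_ext => x y; rewrite fsliceP// TE. Qed.

Lemma rnm_fslice w M X : functional A w -> fun_bound A w M -> slab X ->
  rnm (fslice w X) <= M * rnm X.
Proof. by move=> fw wM AX; have [T Tn /(fslice_eq fw AX) ->] := fslice_exists fw wM AX. Qed.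

Lemma fslice_lin w c X Y : functional A w -> slab X -> slab Y ->
  fslice w (c *: X + Y) = c *: fslice w X + fslice w Y.
Proof.
move=> fw AX AY; apply: fslice_eq => //; first by case: slab_subspace => _; apply.
by move=> x y; rewrite bopD bopZ dotDl dotZl !fsliceP// slr_lin (fun_lin fw).
Qed.

Lemma fsliceB w X Y : functional A w -> slab X -> slab Y ->
  fslice w (X - Y) = fslice w X - fslice w Y.
Proof.
by move=> fw AX AY; rewrite addrC -scaleN1r fslice_lin// scaleN1r addrC.
Qed.

Lemma fslice_op_tens w a b : functional A w -> A a ->
  fslice w (op_tens t a b) = w a *: b.
Proof.
move=> fw Aa; apply: fslice_eq => // [|x y]; first exact: slab_op_tens.
by rewrite bopZ dotZl slr_op_tens (funZ csA fw)// mulrC.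
Qed.

Lemma fslice_mul_r w X a b : functional A w -> slab X -> A a ->
  functional A (fun c => w (c ** a)) ->
  fslice w (X ** op_tens t a b) = fslice (fun c => w (c ** a)) X ** b.
Proof.
move=> fw AX Aa fwa; apply: fslice_eq => // [|x y]; first exact: slab_mul_r.
by rewrite bcompE fsliceP// slr_mul_r.
Qed.

Lemma fslice_adj w X : functional A w -> slab X ->
  fslice (fadj w) (adj X) = adj (fslice w X).
Proof.
move=> fw AX; apply: fslice_eq; [exact: fadj_functional|exact: slab_adj|].
move=> x y; rewrite /fadj slr_adj adjK -fsliceP//.
by rewrite -adjP' dotC.
Qed.

Lemma fslice_min_tens w (B : set (bop K K)) X : functional A w ->
  Defs.subspace B -> closed B -> min_tens t A B X -> B (fslice w X).
Proof.
move=> fw sB cB AX; have [M wM] := fun_boundP fw.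
suff h : min_tens t A B `<=` [set X | slab X /\ B (fslice w X)] by have [] := h X AX.
apply: min_tens_ind.
- split; first split.
  + exact: sub0 slab_subspace.
  + have -> : (0 : bop L L) = 0 - 0 by rewrite subr0.
    have s0 : slab 0 by exact: sub0 slab_subspace.
    by rewrite fsliceB// subrr; exact: sub0.
  move=> c u v [Au Bu] [Av Bv]; split; first by case: slab_subspace => _; apply.
  by rewrite fslice_lin//; case: sB => _; apply.
- apply/closed_rnm => Y h.
  have AY : slab Y.
    by apply: (proj1 (closed_rnm _) slab_closed) => e /h[Z [AZ _] YZ]; exists Z.
  split=> //; apply: (proj1 (closed_rnm _) cB) => e e0.
  have M1 : 0 < M + 1 by rewrite ltr_wpDl//; case: wM.
  have [|Z [AZ BZ] YZ] := h (e / (M + 1)); first by rewrite divr_gt0.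
  exists (fslice w Z) => //; rewrite -fsliceB//.
  rewrite (le_lt_trans (rnm_fslice fw wM _))//; first exact: subB slab_subspace _ _ AY AZ.
  move: YZ; rewrite ltr_pdivlMr// => /le_lt_trans; apply.
  by rewrite mulrDr mulr1 mulrC lerDl rnm_ge0.
- move=> a b Aa Bb; split; first exact: slab_op_tens.
  by rewrite fslice_op_tens//; exact: subZ.
Qed.

Lemma tens_map_slice w (B : set (bop K K)) X : functional A w ->
  min_tens t A B X -> tens_map t A B (fun a b => w a *: b) X = fslice w X.
Proof.
move=> fw; move: X; apply: tens_map_eq; last by move=> a b Aa _; exact: fslice_op_tens.
have [M wM] := fun_boundP fw; apply: (@bounded_onP _ _ _ _ _ M).
  by move=> c X Y AX AY; apply: fslice_lin => //; [exact: slab_min_tens AX|exact: slab_min_tens AY].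
by move=> X AX; apply: rnm_fslice => //; exact: slab_min_tens AX.
Qed.

End Slice.

(** * Strict extensions of functionals and slice maps *)

Section ComplexLimits.
Variable R : realType.

Lemma real_complete (u : nat -> R) :
  (forall e : R, 0 < e -> exists N, forall m n, (N <= m)%N -> (N <= n)%N ->
    `|u m - u n| < e) ->
  exists l, forall e : R, 0 < e -> exists N, forall n, (N <= n)%N -> `|u n - l| < e.
Proof.
move=> cu; have : cauchy (u @ \oo).
  apply/cauchy_ballP => e e0; have [N uN] := cu e e0.
  exists (u @` [set n | (N <= n)%N], u @` [set n | (N <= n)%N]) => /=.
    by split; exists N => // n /= Nn; exists n.
  by case=> _ _ [/= [m Nm <-] [n Nn <-]]; exact: uN.
move=> /R_complete cvgu; exists (lim (u @ \oo)) => e e0.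
have /cvgrPdist_lt /(_ e e0) [N _ h] := cvgu.
by exists N => n Nn; rewrite distrC; exact: h.
Qed.

Lemma complex_complete (u : nat -> R[i]) :
  (forall e : R, 0 < e -> exists N, forall m n, (N <= m)%N -> (N <= n)%N ->
    cab (u m - u n) < e) ->
  exists l, forall e : R, 0 < e -> exists N, forall n, (N <= n)%N -> cab (u n - l) < e.
Proof.
move=> cu.
have [|a aP] := @real_complete (fun n => complex.Re (u n)).
  move=> e /cu[N hN]; exists N => m n Nm Nn.
  by rewrite -ReB (le_lt_trans (norm_Re_le _))// hN.
have [|b bP] := @real_complete (fun n => complex.Im (u n)).
  move=> e /cu[N hN]; exists N => m n Nm Nn.
  have -> : complex.Im (u m) - complex.Im (u n) = complex.Im (u m - u n).
    by rewrite [RHS]raddfB.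
  by rewrite (le_lt_trans (norm_Im_le _))// hN.
exists (a +i* b) => e e0; have e2 : 0 < e / 2 by rewrite divr_gt0.
have [N hN] := aP _ e2; have [N' hN'] := bP _ e2.
exists (maxn N N') => n; rewrite geq_max => /andP[/hN h1 /hN' h2].
rewrite (le_lt_trans (cab_ReIm _))// [ltRHS](splitr e).
by move: h1 h2; case: (u n) => c d /= h1 h2; rewrite ltrD.
Qed.

End ComplexLimits.

Lemma approx_unit_mono (R : realType) (H : hilbert R) (A P Q : set (bop H H)) :
  approx_unit A P -> P `<=` Q -> approx_unit A Q.
Proof. by move=> [s [r [r0 sA hP]]] PQ; exists s, r; split=> // u ? ? ?; exact/PQ/hP. Qed.

Section FunctionalExtension.
Variables (R : realType) (H : hilbert R) (A : set (bop H H)).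
Hypothesis csA : cstar_algebra A.
Implicit Type w : bop H H -> R[i].

Lemma functional_ext_lim w m (l : R[i]) :
  (forall e : R, 0 < e -> approx_unit A [set u | cab (l - w (m ** u)) < e]) ->
  functional_ext A w m = l.
Proof.
move=> h; have pF := approx_unit_proper csA.
apply: (@cvg_lim R[i]^o (@norm_hausdorff _ R[i]^o) _ _ pF).
by apply/(@cvg_rnm R R[i]^o) => e e0; exact: h.
Qed.

(** The limit runs over contractions. The value is the factor in the invariance of the Haar
    weight. *)
Lemma functional_unit_le w : functional A w -> fun_bound A w 1 ->
  complex.Re (functional_ext A w (bid H)) <= 1.
Proof.
have [sA _ _ _] := csA; have pF := approx_unit_proper csA => fw wM.
have fF : Filter (approx_unit A) := @filter_filter _ _ pF.
pose F : set_system R[i]^o := (w (bid H ** u) : R[i]^o) @[u --> approx_unit A].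
have [/cvg_ex[l wl]|/dvgP nw] := pselect (cvg F); last first.
  (* a divergent [lim] has value [0] *)
  by rewrite /functional_ext -/F nw; exact: ler01.
have {}wl (e : R) : 0 < e -> approx_unit A [set u | cab (l - w (bid H ** u)) < e].
  by move: e; apply/(@cvg_rnm R R[i]^o).
rewrite (functional_ext_lim wl); apply/ler_addgt0Pr => e e0.
have [u [h [Au u1 _ _]]] := filter_ex (@filterI _ _ fF _ _ (wl e e0)
  (approx_unit_near (sub0 sA) e0)).
rewrite /= bcomp1l in h; have := wM.2 u Au; have := Re_le l.
have := cab_tri (w u) l 0; rewrite !subr0.
by move: h u1; move: (cab _) (cab _) (cab _) (rnm _) => *; lra.
Qed.

End FunctionalExtension.

Section SliceEstimates.
Variables (R : realType) (H K L : hilbert R) (t : htensor H K L).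
Variables (A : set (bop H H)) (w : bop H H -> R[i]) (M : R).
Hypotheses (csA : cstar_algebra A) (fw : functional A w) (wM : fun_bound A w M).

(** Write [w y] as [w (y - y c) + w (y c)]: the first term is small, and in the second [c] and [b]
    are absorbed into [D (c (x) b)]. With [D = m u - m] this is the strict continuity of slicing. *)
Lemma fslice_approx_r (e : R) c b D : 0 <= e -> A c ->
  (forall y, A y -> cab (w (y - y ** c)) <= e * rnm y) -> slab t A D ->
  rnm (fslice t w D ** b) <= e * (rnm D * rnm b) + M * rnm (D ** op_tens t c b).
Proof.
have [_ _ mA _] := csA => e0 Ac cw AD; have M0 := wM.1.
apply: rnm_dotP => [|x y]; first by rewrite addr_ge0 ?mulr_ge0 ?rnm_ge0.
rewrite bcompE (fsliceP csA _ _ fw)//.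
have k1 := cab_tri (w (slr t (b x) y D ** c)) (w (slr t (b x) y D)) 0.
rewrite !subr0 -(funB csA fw) in k1; [|exact: AD|exact: mA].
apply: (le_trans k1); rewrite -(slr_mul_r t x y D c b) !mulrDl; apply: lerD.
  rewrite (slr_mul_r t x y D c b) (le_trans (cw _ (AD _ _)))// -!mulrA ler_wpM2l//.
  rewrite (le_trans (rnm_slr _ _ _ _))// -!mulrA ler_wpM2l ?rnm_ge0// mulrA.
  by rewrite ler_wpM2r ?rnm_ge0// rnm_bop.
rewrite (le_trans (wM.2 _ (slab_mul_r csA b AD Ac x y)))// -!mulrA ler_wpM2l//.
by rewrite (le_trans (rnm_slr _ _ _ _))// mulrA.
Qed.

End SliceEstimates.

Lemma fslice_approx_l (R : realType) (H K L : hilbert R) (t : htensor H K L)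
    (A : set (bop H H)) (w : bop H H -> R[i]) (M e : R) c b D :
  cstar_algebra A -> functional A w -> fun_bound A w M -> 0 <= e -> A c ->
  (forall y, A y -> cab (w (y - c ** y)) <= e * rnm y) -> slab t A D ->
  rnm (b ** fslice t w D) <= e * (rnm D * rnm b) + M * rnm (op_tens t c b ** D).
Proof.
move=> csA fw wM e0 Ac cw AD; have [_ _ _ aA] := csA.
rewrite -(rnm_adj (b ** _)) adjM -(fslice_adj csA fw AD) -(rnm_adj D) -(rnm_adj b).
rewrite -(rnm_adj (op_tens t c b ** D)) adjM op_tens_adj.
apply: (fslice_approx_r csA (fadj_functional csA fw) (fadj_bound csA wM)) => //;
  [exact: aA| |exact: slab_adj].
move=> y Ay; have := cw _ (aA _ Ay).
by rewrite /fadj cab_conj adjB adjM adjK rnm_adj.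
Qed.

Section StrictExtension.
Variables (R : realType) (H K L : hilbert R) (t : htensor H K L).
Variables (A : set (bop H H)) (B : set (bop K K)).
Hypotheses (csA : cstar_algebra A) (csB : cstar_algebra B).
Variable w : bop H H -> R[i].
Hypothesis fw : functional A w.
Let AB := min_tens t A B.
Let csAB : cstar_algebra AB.
Proof. exact: min_tens_cstar. Qed.
Let pF := approx_unit_proper csAB.
Variable m : bop L L.
Hypotheses (mm : multiplier AB m) (sm : slab t A m).

Let D2 u : rnm u <= 1 -> rnm (m ** u - m) <= 2 * rnm m.
Proof.
move=> u1; rewrite (le_trans (rnmB _ _))// mulr_natl mulr2n lerD2r.
by rewrite (le_trans (rnm_bcomp _ _))// ler_piMr ?rnm_ge0.
Qed.

(** Division of the tolerance [e] between the two terms of [fslice_approx_r]; the summand 1 keeps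
    the denominator positive. *)
Let budget (e p q x y : R) : 0 < e -> 0 <= p -> 0 <= q -> x <= p ->
  y <= e / (p + q + 1) -> e / (p + q + 1) * x + q * y < e.
Proof.
move=> e0 p0 q0 xp yd; have s1 : 0 < p + q + 1 by lra.
set d := e / _ in yd *; have d0 : 0 < d by rewrite divr_gt0.
have dE : d * (p + q + 1) = e by rewrite divfK// gt_eqF.
have h1 : d * x <= d * p by rewrite ler_pM2l.
have h2 : q * y <= q * d by rewrite ler_wpM2l.
by rewrite -dE !mulrDr mulr1 (mulrC q) in h1 h2 *; lra.
Qed.

Let slabD u : AB u -> slab t A (m ** u - m).
Proof.
move=> ABu; apply: (subB (slab_subspace t csA)) => //.
by apply: (@slab_min_tens _ _ _ _ t _ csA B); case: (mm ABu).
Qed.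

Let ext_right b (e : R) : B b -> 0 < e -> approx_unit AB
  [set u | AB u /\ rnm (fslice t w m ** b - fslice t w (m ** u) ** b) < e].
Proof.
move=> Bb e0; have [M wM] := fun_boundP fw; have M0 := wM.1.
pose p := 2 * rnm m * rnm b; pose q := M * (rnm m + 1).
have p0 : 0 <= p by rewrite !mulr_ge0 ?rnm_ge0.
have q0 : 0 <= q by rewrite mulr_ge0// addr_ge0 ?rnm_ge0.
have d0 : 0 < e / (p + q + 1) by rewrite divr_gt0// ltr_wpDl// addr_ge0.
have [c [Ac c1 cw]] := fun_right_unit csA fw d0.
have ABcb : AB (op_tens t c b) by exact: min_tens_mem.
apply: (approx_unit_mono (approx_unit_near ABcb d0)) => u /= [ABu u1 uc _]; split=> //.
have smu : slab t A (m ** u) by apply: (@slab_min_tens _ _ _ _ t _ csA B); case: (mm ABu).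
rewrite rnmBC -bcompBl -(fsliceB csA)//.
apply: (le_lt_trans (fslice_approx_r csA fw wM b (ltW d0) Ac cw (slabD ABu))).
apply: (@le_lt_trans _ _ (e / (p + q + 1) * (rnm (m ** u - m) * rnm b) +
    q * rnm (u ** op_tens t c b - op_tens t c b))).
  rewrite lerD2l /q -mulrA ler_wpM2l//.
  have -> : (m ** u - m) ** op_tens t c b = m ** (u ** op_tens t c b - op_tens t c b).
    by rewrite bcompBl bcompBr bcompA.
  by rewrite (le_trans (rnm_bcomp _ _))// ler_wpM2r ?rnm_ge0// lerDl.
apply: budget => //; last exact: ltW.
by rewrite /p ler_wpM2r ?rnm_ge0// D2.
Qed.

Let ext_left b (e : R) : B b -> 0 < e -> approx_unit AB
  [set u | AB u /\ rnm (b ** fslice t w m - b ** fslice t w (m ** u)) < e].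
Proof.
move=> Bb e0; have [M wM] := fun_boundP fw; have M0 := wM.1.
pose p := 2 * rnm m * rnm b.
have p0 : 0 <= p by rewrite !mulr_ge0 ?rnm_ge0.
have d0 : 0 < e / (p + M + 1) by rewrite divr_gt0// ltr_wpDl// addr_ge0.
have [c [Ac c1 cw]] := fun_left_unit csA fw d0.
have ABcb : AB (op_tens t c b) by exact: min_tens_mem.
(* On this side [m] stands between [c (x) b] and [u], so the approximate unit is taken near
   [(c (x) b) m]. *)
have ABcbm : AB (op_tens t c b ** m) by case: (mm ABcb).
apply: (approx_unit_mono (approx_unit_near ABcbm d0)) => u /= [ABu u1 _ uc]; split=> //.
have smu : slab t A (m ** u) by apply: (@slab_min_tens _ _ _ _ t _ csA B); case: (mm ABu).
rewrite rnmBC -bcompBr -(fsliceB csA)//.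
apply: (le_lt_trans (fslice_approx_l b csA fw wM (ltW d0) Ac cw (slabD ABu))).
have -> : op_tens t c b ** (m ** u - m) = op_tens t c b ** m ** u - op_tens t c b ** m.
  by rewrite bcompBr bcompA.
apply: budget => //; last exact: ltW.
by rewrite /p ler_wpM2r ?rnm_ge0// D2.
Qed.

Lemma strict_ext_slice : Defs.nondegenerate B ->
  strict_ext AB B (tens_map t A B (fun a b => w a *: b)) m = fslice t w m.
Proof.
move=> ndB; set E := tens_map _ _ _ _.
have pF' : ProperFilter (approx_unit AB) := pF.
have EE u : AB u -> E (m ** u) = fslice t w (m ** u).
  by move=> ABu; apply: tens_map_slice => //; case: (mm ABu).
have h : [set n : bop K K | forall b, B b ->
    (E (m ** u) ** b @[u --> approx_unit AB] --> n ** b) /\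
    (b ** E (m ** u) @[u --> approx_unit AB] --> b ** n)] (fslice t w m).
  move=> b Bb; split; apply/cvg_rnm => e e0.
    by apply: (approx_unit_mono (ext_right Bb e0)) => u /= [ABu]; rewrite EE.
  by apply: (approx_unit_mono (ext_left Bb e0)) => u /= [ABu]; rewrite EE.
(* [strict_ext] is some operator with the same limits; both agree after multiplication by [B], whose
   vectors [b x] span a dense subspace. *)
apply: (bop_ext_span ndB) => _ [b Bb [x _ <-]].
rewrite -!bcompE; congr (bop_fun _ x).
have [h1 _] := getPex (ex_intro _ _ h) b Bb; have [h2 _] := h b Bb.
exact: (cvg_unique (@norm_hausdorff _ _) h1 h2).
Qed.

(** The slices of [m u] converge only strictly; cutting [v] off by a right unit [c] makes
    convergence after multiplication by [c] sufficient. *)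
Lemma functional_ext_slice (v : bop K K -> R[i]) : functional B v ->
  B (fslice t w m) ->
  functional_ext AB (tens_map t A B (fun a b => w a * v b : R[i]^o)) m =
    v (fslice t w m).
Proof.
have [sB cB mB _] := csB => fv Bm; set E := tens_map _ _ _ _.
have [M wM] := fun_boundP fw; have M0 := wM.1.
have [N vN] := fun_boundP fv; have N0 := vN.1.
have Bf X : AB X -> B (fslice t w X) by exact: fslice_min_tens.
have EE X : AB X -> E X = v (fslice t w X).
  apply: (@tens_map_eq _ _ _ _ t A B R[i]^o _ (fun X => v (fslice t w X))).
    apply: (@bounded_onP _ _ R[i]^o _ _ (N * M)) => [c Y Z AY AZ|Y AY].
      have sY := slab_min_tens csA AY; have sZ := slab_min_tens csA AZ.
      rewrite (fslice_lin csA c fw sY sZ).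
      by rewrite (fun_lin fv)//; exact: Bf.
    rewrite -mulrA (le_trans (vN.2 _ (Bf _ AY)))// ler_wpM2l//.
    exact: (rnm_fslice csA fw wM (slab_min_tens csA AY)).
  by move=> a b Aa Bb; rewrite (fslice_op_tens t csA b fw Aa) (funZ csB fv).
apply: (functional_ext_lim csAB) => e e0.
pose p := M * (2 * rnm m); have p0 : 0 <= p by rewrite !mulr_ge0 ?rnm_ge0.
have d0 : 0 < e / (p + N + 1) by rewrite divr_gt0// ltr_wpDl// addr_ge0.
have [c [Bc c1 cv]] := fun_right_unit csB fv d0.
have nAB : approx_unit AB [set u | [/\ AB u, rnm u <= 1 &
    rnm (fslice t w m ** c - fslice t w (m ** u) ** c) < e / (p + N + 1)]].
  have [s [r [r0 ABs hs]]] := ext_right Bc d0.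
  exists s, r; split=> // u ABu u1 us; have [_ ?] := hs u ABu u1 us.
  by split=> //; rewrite -rnm_le.
apply: (approx_unit_mono nAB) => u /= [ABu u1 uc].
have ABmu : AB (m ** u) by case: (mm ABu).
rewrite EE// -(funB csB fv)//; last exact: Bf.
set y := fslice t w m - _; have By : B y by apply: subB => //; exact: Bf.
have k1 := cab_tri (v (y ** c)) (v y) 0.
rewrite !subr0 -(funB csB fv)// in k1; last exact: mB.
apply: (le_lt_trans k1).
apply: (@le_lt_trans _ _ (e / (p + N + 1) * rnm y + N * rnm (y ** c))).
  by apply: lerD; [exact: cv|apply: vN.2; exact: mB].
apply: budget => //; last by rewrite /y bcompBl ltW.
rewrite rnmBC -(fsliceB csA fw)//; last exact: (slab_min_tens csA ABmu).
by rewrite (le_trans (rnm_fslice csA fw wM (slabD ABu)))// /p ler_wpM2l// D2.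
Qed.

End StrictExtension.

(** * Extension of homomorphisms to multipliers *)

Section HomExtension.
Variables (R : realType) (H K : hilbert R) (A : set (bop H H)).
Variable p : bop H H -> bop K K.
Hypotheses (csA : cstar_algebra A) (bp : bounded_linear_on A p).
Hypothesis pc : forall a, A a -> rnm (p a) <= rnm a.
Hypothesis pm : forall a b, A a -> A b -> p (a ** b) = p a ** p b.
Hypothesis pd : closed_span [set p a v | a in A & v in setT] = setT.
Variable m : bop H H.
Hypothesis mm : multiplier A m.

Let I := ({a | A a} * K)%type.
Let s (q : I) := p (sval q.1) q.2.
Let g (q : I) := p (m ** sval q.1) q.2.

(** For [u] far along the approximate unit, [p (m u)] already sends [p a v] close to [p (m a) v].
    Its norm is at most [rnm m], which makes the assignment [p a v -> p (m a) v] well defined and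
    bounded. *)
Let near_comb (l : seq (R[i] * I)) (e : R) : 0 < e ->
  approx_unit A [set u | [/\ A u, rnm u <= 1 &
    rnm (comb g l - p (m ** u) (comb s l)) < e]].
Proof.
have [sA _ mA _] := csA; have pF := approx_unit_proper csA.
elim: l e => [|[k [[a Aa] v]] l IH] e e0.
  apply: (approx_unit_mono (approx_unit_near (sub0 sA) e0)) => u /= [Au u1 _ _].
  by split=> //; rewrite /comb !big_nil bop_r0 subrr rnm0.
have e2 : 0 < e / 2 by rewrite divr_gt0.
pose M := cab k * (rnm m * rnm v) + 1.
have M0 : 0 < M by rewrite ltr_wpDl// !mulr_ge0 ?cab_ge0 ?rnm_ge0.
have d0 : 0 < e / 2 / M by rewrite !divr_gt0.
have fF : Filter (approx_unit A) := @filter_filter _ _ pF.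
apply: (approx_unit_mono (@filterI _ _ fF _ _ (IH _ e2) (approx_unit_near Aa d0))).
move=> u [[Au u1 h] [_ _ h' _]]; split=> //.
have Amu : A (m ** u) by case: (mm Au).
rewrite /comb !big_cons -/(comb g l) -/(comb s l) /g /s/= bop_rD bop_rZ opprD addrACA.
rewrite -scalerBr -bcompE -pm// -bopB.
have -> : p (m ** a) - p (m ** u ** a) = p (m ** a - m ** u ** a).
  have := bp.1 (-1) (m ** u ** a) (m ** a); rewrite !scaleN1r addrC [RHS]addrC.
  move=> ->//.
    by rewrite -bcompA; case: (mm (mA _ _ Au Aa)).
  by case: (mm Aa).
rewrite (le_lt_trans (rnmD _ _))// [ltRHS](splitr e) ler_ltD// rnmZ.
have ma : m ** a - m ** u ** a = - (m ** (u ** a - a)).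
  by rewrite bcompBr bcompA opprB.
have h1 : rnm (p (m ** a - m ** u ** a) v) <= rnm m * rnm (u ** a - a) * rnm v.
  rewrite (le_trans (rnm_bop _ _))// ler_wpM2r ?rnm_ge0//.
  apply: (le_trans (pc _)); last by rewrite ma rnmN rnm_bcomp.
  by apply: subB => //; [case: (mm Aa)|rewrite -bcompA; case: (mm (mA _ _ Au Aa))].
apply: (@le_trans _ _ (M * rnm (u ** a - a))).
  rewrite mulrDl mul1r -[leLHS]addr0 lerD ?rnm_ge0//.
  by rewrite -mulrA ler_wpM2l ?cab_ge0// (le_trans h1)// mulrAC.
by rewrite mulrC -ler_pdivlMr// ltW.
Qed.

Let comb_bd l : rnm (comb g l) <= rnm m * rnm (comb s l).
Proof.
apply/ler_addgt0Pr => e e0; have pF := approx_unit_proper csA.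
have [u [Au u1 h]] := filter_ex (near_comb l e0).
have := rnm_tri (p (m ** u) (comb s l)) (comb g l) 0; rewrite !subr0.
have : rnm (p (m ** u) (comb s l)) <= rnm m * rnm (comb s l).
  rewrite (le_trans (rnm_bop _ _))// ler_wpM2r ?rnm_ge0//.
  have Amu : A (m ** u) by case: (mm Au).
  rewrite (le_trans (pc Amu))// (le_trans (rnm_bcomp _ _))//.
  by rewrite ler_piMr ?rnm_ge0.
by move: h; move: (rnm _) (rnm (comb g l)) (rnm (p _ _)) (rnm m * _) => *; lra.
Qed.

Lemma hom_extP a : A a -> hom_ext A p m ** p a = p (m ** a).
Proof.
have range_s : range s = [set p a v | a in A & v in setT].
  apply/seteqP; split=> X /=.
    by move=> [[[b Ab] v] _ <-]; exists b => //; exists v.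
  by move=> [b Ab [v _ <-]]; exists (exist _ b Ab, v).
have [E [El Eb Es]] := @comb_extension _ _ _ _ s g _ (@complete_rnm R K)
  (rnm_ge0 m) comb_bd.
rewrite range_s pd in El Eb.
have [|n nE] := @bopE_exists R K K E (rnm m) (fun k u v => El k u v Logic.I Logic.I).
  by move=> v; exact: Eb.
have h : exists n : bop K K, forall a, A a -> n ** p a = p (m ** a).
  exists n => b Ab; apply: bop_eq => v; rewrite bcompE nE.
  exact: (Es (exist _ b Ab, v)).
by move: a; exact: (getPex h).
Qed.

End HomExtension.

Lemma fun_mul_r (R : realType) (H : hilbert R) (A : set (bop H H))
    (w : bop H H -> R[i]) b :
  cstar_algebra A -> functional A w -> A b -> functional A (fun c => w (c ** b)).
Proof.
move=> csA fw Ab; have [_ _ mA _] := csA; have [M [M0 wM]] := fun_boundP fw.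
apply: (@functional_intro _ _ _ _ (M * rnm b)) => [k x y Ax Ay|x Ax].
  by rewrite bcompDl bcompZl (fun_lin fw)//; exact: mA.
rewrite (le_trans (wM _ (mA _ _ Ax Ab)))// -mulrA ler_wpM2l// mulrC.
exact: rnm_bcomp.
Qed.

Section AmplifiedExtension.
Variables (R : realType) (H K L H' L' : hilbert R).
Variables (t : htensor H K L) (t' : htensor H' K L').
Variables (A : set (bop H H)) (B : set (bop K K)) (p : bop H H -> bop H' H').
Hypotheses (csA : cstar_algebra A) (csB : cstar_algebra B) (hp : star_hom A p).
Hypothesis pd : closed_span [set p a v | a in A & v in setT] = setT.
Hypothesis ndB : Defs.nondegenerate B.
Let AB := min_tens t A B.
Let csAB : cstar_algebra AB. Proof. exact: min_tens_cstar. Qed.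
Let f := tens_map t A B (fun a b => op_tens t' (p a) b).

Let fP : bounded_linear_on AB f /\
  forall a b, A a -> B b -> f (op_tens t a b) = op_tens t' (p a) b.
Proof.
by have [E [bE _ Eab]] := amplify_hom t t' B csA hp; apply: tens_mapP; exists E.
Qed.

Let fbd : bounded_linear_on AB f. Proof. exact: fP.1. Qed.

Let fE a b : A a -> B b -> f (op_tens t a b) = op_tens t' (p a) b.
Proof. exact: fP.2. Qed.

Let fc X : AB X -> rnm (f X) <= rnm X.
Proof.
have [E [bE Ec Eab]] := amplify_hom t t' B csA hp => ABX.
by rewrite /f (tens_map_eq bE Eab ABX); exact: Ec.
Qed.

Let fm X Y : AB X -> AB Y -> f (X ** Y) = f X ** f Y.
Proof.
have [sAB _ mAB _] := csAB; have [_ _ mA _] := csA; have [_ _ mB _] := csB.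
have [M M0 fM] := bounded_on_real fbd.
have bl Z : AB Z -> bounded_linear_on AB (fun X => f (X ** Z)).
  move=> ABZ; apply: (@bounded_onP _ _ _ _ _ (M * rnm Z)) => [c u v ABu ABv|u ABu].
    by rewrite bcompDl bcompZl fbd.1//; exact: mAB.
  rewrite (le_trans (fM _ (mAB _ _ ABu ABZ)))// -mulrA ler_wpM2l// mulrC.
  exact: rnm_bcomp.
have br Z : AB Z -> bounded_linear_on AB (fun X => f (Z ** X)).
  move=> ABZ; apply: (@bounded_onP _ _ _ _ _ (M * rnm Z)) => [c u v ABu ABv|u ABu].
    by rewrite bcompDr bcompZr fbd.1//; exact: mAB.
  rewrite (le_trans (fM _ (mAB _ _ ABZ ABu)))// -mulrA ler_wpM2l//.
  exact: rnm_bcomp.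
have bl' Z : bounded_linear_on AB (fun X => f X ** f Z).
  apply: (@bounded_onP _ _ _ _ _ (M * rnm (f Z))) => [c u v ABu ABv|u ABu].
    by rewrite fbd.1// bcompDl bcompZl.
  rewrite (le_trans (rnm_bcomp _ _))// mulrAC ler_wpM2r ?rnm_ge0//.
  exact: fM.
have br' Z : bounded_linear_on AB (fun X => f Z ** f X).
  apply: (@bounded_onP _ _ _ _ _ (M * rnm (f Z))) => [c u v ABu ABv|u ABu].
    by rewrite fbd.1// bcompDr bcompZr.
  rewrite (le_trans (rnm_bcomp _ _))// mulrC mulrAC ler_wpM2r ?rnm_ge0//.
  exact: fM.
move=> ABX ABY; apply: (agree_span (bl Y ABY) (bl' Y)) ABX => _ [a Aa [b Bb <-]].
have ABab : AB (op_tens t a b) by exact: min_tens_mem.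
apply: (agree_span (br _ ABab) (br' _)) ABY => _ [a' Aa' [b' Bb' <-]].
have [_ pm _] := hp.
by rewrite op_tensM !fE// ?op_tensM ?pm//; [exact: mA|exact: mB].
Qed.

Let fd : closed_span [set f X v | X in AB & v in setT] = setT.
Proof.
set D := [set f X v | X in AB & v in setT].
have sD := closed_span_subspace D; have cD := @closed_span_closed _ _ D.
suff h x y : closed_span D (t' x y).
  apply/seteqP; split=> // z _.
  have : closed_span [set t' x y | x in setT & y in setT] z by rewrite htens_dense.
  by apply: closed_span_ind => // _ [x _ [y _ <-]]; exact: h.
have : closed_span [set p a v | a in A & v in setT] x by rewrite pd.
move: x; apply: (closed_span_ind (P := leg t' y @^-1` closed_span D)).
- exact: subspace_bop.
- exact: closed_bop.
move=> _ [a Aa [x _ <-]] /=.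
have : closed_span [set (a : bop K K) x | a in B & x in setT] y by rewrite ndB.
move: y; apply: (closed_span_ind (P := leg (htens_flip t') (p a x) @^-1` closed_span D)).
- exact: subspace_bop.
- exact: closed_bop.
move=> _ [b Bb [y _ <-]] /=; apply: closed_span_sub.
exists (op_tens t a b); first exact: min_tens_mem.
by exists (t' x y) => //; rewrite fE// op_tensE.
Qed.

(** Slicing the second leg commutes with [p] on the first: both sides are bounded in [X], and
    elementary tensors are immediate. *)
Let f_slr X x y : AB X -> slr t' x y (f X) = p (slr t x y X).
Proof.
have [M M0 fM] := bounded_on_real fbd; have [pl _ _] := hp.
move: X; apply: agree_span.
- apply: (@bounded_onP _ _ _ _ _ (M * rnm x * rnm y)) => [c u v ABu ABv|u ABu].
    by rewrite fbd.1// slr_lin.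
  rewrite (le_trans (rnm_slr _ _ _ _))//.
  have -> : M * rnm x * rnm y * rnm u = M * rnm u * rnm x * rnm y by ring.
  by rewrite !ler_wpM2r ?rnm_ge0// fM.
- apply: (@bounded_onP _ _ _ _ _ (rnm x * rnm y)) => [c u v ABu ABv|u ABu].
    have su := slab_min_tens csA ABu x y; have sv := slab_min_tens csA ABv x y.
    by rewrite slr_lin pl.
  have su := slab_min_tens csA ABu x y.
  rewrite (le_trans (star_hom_contr csA hp su))// (le_trans (rnm_slr _ _ _ _))//.
  by have -> : rnm x * rnm y * rnm u = rnm u * rnm x * rnm y by ring.
move=> _ [a Aa [b Bb <-]]; rewrite fE// !slr_op_tens.
by rewrite (star_homZ csA hp).
Qed.

Variable m : bop L L.
Hypotheses (mm : multiplier AB m) (sm : slab t A m).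
Let N := hom_ext AB f m.

Lemma amplified_ext_mul X : AB X -> N ** f X = f (m ** X).
Proof. exact: hom_extP. Qed.

(** Multiplying [m] by [b (x) c] brings it into the minimal tensor product, where [f_slr] applies.
    Then [b] is removed by nondegeneracy of [p], and [c] by that of [B]. *)
Lemma amplified_ext_slr x y : slr t' x y N = p (slr t x y m).
Proof.
have [sA cA mA aA] := csA; have [pl pm pa] := hp.
have key c z : B c -> slr t' (c z) y N = p (slr t (c z) y m).
  move=> Bc; apply: (bop_ext_span pd) => _ [b Ab [v _ <-]].
  rewrite -!bcompE; congr (bop_fun _ v).
  have ABbc : AB (op_tens t b c) by exact: min_tens_mem.
  rewrite -slr_mul_r -fE// amplified_ext_mul// f_slr; last by case: (mm ABbc).
  by rewrite slr_mul_r pm//; exact: sm.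
apply/eqP; rewrite -subr_eq0; apply/eqP.
pose P := [set x | slr t' x y N - p (slr t x y m) = 0].
have : closed_span [set (a : bop K K) x | a in B & x in setT] x by rewrite ndB.
have pz0 : p 0 = 0 by exact: (star_hom0 csA hp).
move: x; apply: (closed_span_ind (P := P)).
- split.
    rewrite /P/=; have h0 (H0 L0 : hilbert R) (t0 : htensor H0 K L0) X : slr t0 0 y X = 0.
      by have := slr_linl t0 (-1) 0 0 y X; rewrite !scaleN1r oppr0 addr0 addNr.
    by rewrite !h0 pz0 subrr.
  move=> c u v; rewrite /P/= !slr_linl pl//.
  move=> hu hv; rewrite opprD addrACA -scalerBr.
  by rewrite hu hv scaler0 addr0.
- apply: (@closed_lip _ _ _ [set 0] (fun x => slr t' x y N - p (slr t x y m))
    ((rnm N + rnm m) * rnm y)); first exact: closed0.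
  move=> u v.
  have lB (H0 L0 : hilbert R) (t0 : htensor H0 K L0) X :
      slr t0 u y X - slr t0 v y X = slr t0 (u - v) y X.
    by rewrite [u - v]addrC -(scaleN1r v) slr_linl scaleN1r addrC.
  have -> : slr t' u y N - p (slr t u y m) - (slr t' v y N - p (slr t v y m)) =
      slr t' (u - v) y N - p (slr t (u - v) y m).
    by rewrite -!lB (star_homB csA hp)// !opprD !opprK addrACA.
  rewrite (le_trans (rnmB _ _))// -mulrA mulrDl; apply: lerD.
    rewrite (le_trans (rnm_slr _ _ _ _))//.
    by have -> : rnm N * rnm (u - v) * rnm y = rnm N * (rnm y * rnm (u - v)) by ring.
  rewrite (le_trans (star_hom_contr csA hp (sm _ _)))//.
  rewrite (le_trans (rnm_slr _ _ _ _))//.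
  by have -> : rnm m * rnm (u - v) * rnm y = rnm m * (rnm y * rnm (u - v)) by ring.
- by move=> _ [c Bc [z _ <-]]; rewrite /P/= key// subrr.
Qed.

End AmplifiedExtension.
(** Allows [w] to be replaced by a functional [w (. b)], which absorbs a multiplier into the minimal
    tensor product. *)
Lemma fslice_diff (R : realType) (H K L : hilbert R) (t : htensor H K L)
    (A : set (bop H H)) (w : bop H H -> R[i]) b (e : R) X :
  cstar_algebra A -> functional A w -> A b -> 0 <= e ->
  (forall y, A y -> cab (w (y - y ** b)) <= e * rnm y) -> slab t A X ->
  rnm (fslice t w X - fslice t (fun c => w (c ** b)) X) <= e * rnm X.
Proof.
move=> csA fw Ab e0 wb AX; have fwb := fun_mul_r csA fw Ab; have [_ _ mA _] := csA.
apply: rnm_dotP => [|x y]; first by rewrite mulr_ge0 ?rnm_ge0.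
rewrite bopB dotBl (fsliceP csA _ _ fw AX) (fsliceP csA _ _ fwb AX).
rewrite -(funB csA fw); [|exact: AX|by apply: mA].
by rewrite (le_trans (wb _ (AX x y)))// -!mulrA ler_wpM2l// mulrA rnm_slr.
Qed.

Section AmplifiedRight.
Variables (R : realType) (H K L K' L' : hilbert R).
Variables (t : htensor H K L) (t' : htensor H K' L').
Variables (A : set (bop H H)) (B : set (bop K K)) (q : bop K K -> bop K' K').
Hypotheses (csA : cstar_algebra A) (csB : cstar_algebra B) (hq : star_hom B q).
Hypothesis qd : closed_span [set q b v | b in B & v in setT] = setT.
Hypothesis ndA : Defs.nondegenerate A.
Let AB := min_tens t A B.
Let f := tens_map t A B (fun a b => op_tens t' a (q b)).
(** The map [f] seen through the flip, as an amplification on the first leg. *)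
Let f' := tens_map (htens_flip t) B A (fun b a => op_tens (htens_flip t') (q b) a).

Let Eex : exists E, bounded_linear_on AB E /\
  forall a b, A a -> B b -> E (op_tens t a b) = op_tens t' a (q b).
Proof.
have [E [bE _ Eab]] := amplify_hom (htens_flip t) (htens_flip t') A csB hq.
rewrite min_tens_flip in bE.
exists E; split=> // a b Aa Bb; have := Eab b a Bb Aa.
by rewrite !op_tens_flip.
Qed.

Let fbd : bounded_linear_on AB f. Proof. by case: (tens_mapP Eex). Qed.

Let fE a b : A a -> B b -> f (op_tens t a b) = op_tens t' a (q b).
Proof. by case: (tens_mapP Eex) => _; exact. Qed.

Let ff' X : AB X -> f X = f' X.
Proof.
move=> ABX; have [E [bE _ Eab]] := amplify_hom (htens_flip t) (htens_flip t') A csB hq.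
have -> : f' X = E X by apply: (tens_map_eq bE Eab); rewrite min_tens_flip.
rewrite min_tens_flip in bE; apply: (tens_map_eq bE) => // a b Aa Bb.
by rewrite -(op_tens_flip t) Eab// op_tens_flip.
Qed.

Variable m : bop L L.
Hypotheses (mm : multiplier AB m) (sm : slab t A m).
Let N := hom_ext AB f m.

Let N_flip : N = hom_ext (min_tens (htens_flip t) B A) f' m.
Proof.
rewrite /N /hom_ext min_tens_flip; congr get; apply/seteqP; split=> n /= h X ABX.
  by rewrite -!ff' ?h//; case: (mm ABX).
by rewrite !ff' ?h//; case: (mm ABX).
Qed.

Let N_mul X : AB X -> N ** f X = f (m ** X).
Proof.
move=> ABX; rewrite N_flip ff'// ff'; last by case: (mm ABX).
apply: (amplified_ext_mul (htens_flip t') csB csA hq qd ndA).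
  by rewrite min_tens_flip.
by rewrite min_tens_flip.
Qed.

Let slab_f X : AB X -> slab t' A (f X).
Proof.
move: X; apply: bounded_on_closed fbd (slab_subspace t' csA) (slab_closed csA) _.
by move=> _ [a Aa [b Bb <-]]; rewrite fE//; exact: slab_op_tens.
Qed.

Let fslice_f w X : functional A w -> AB X -> fslice t' w (f X) = q (fslice t w X).
Proof.
move=> fw; have [M wM] := fun_boundP fw; have [F F0 fF] := bounded_on_real fbd.
have [sB cB _ _] := csB; have [ql _ _] := hq; have M0 := wM.1.
have Bf Z : AB Z -> B (fslice t w Z) by exact: fslice_min_tens.
move: X; apply: agree_span.
- apply: (@bounded_onP _ _ _ _ _ (M * F)) => [c u v ABu ABv|u ABu].
    by rewrite fbd.1// (fslice_lin csA c fw)//; exact: slab_f.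
  rewrite (le_trans (rnm_fslice csA fw wM (slab_f ABu)))// -mulrA ler_wpM2l//.
  exact: fF.
- apply: (@bounded_onP _ _ _ _ _ M) => [c u v ABu ABv|u ABu].
    have su := slab_min_tens csA ABu; have sv := slab_min_tens csA ABv.
    by rewrite (fslice_lin csA c fw su sv) ql//; exact: Bf.
  rewrite (le_trans (star_hom_contr csB hq (Bf _ ABu)))//.
  exact: (rnm_fslice csA fw wM (slab_min_tens csA ABu)).
move=> _ [a Aa [b Bb <-]]; rewrite fE//.
by rewrite (fslice_op_tens t csA b fw Aa) (fslice_op_tens t' csA (q b) fw Aa)
  (star_homZ csB hq).
Qed.

(** Slicing the first leg commutes with [q] on the second. This is clear on the minimal tensor
    product; [w (. b)] and multiplication by [1 (x) c] reduce [m] to it, and [fslice_diff] removes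
    [b]. *)
Lemma amplified_right_fslice w : functional A w -> slab t' A N ->
  (forall v, functional A v -> B (fslice t v m)) ->
  fslice t' w N = q (fslice t w m).
Proof.
move=> fw sN Bm; have [_ _ mA _] := csA; have [_ qm _] := hq.
have key b : A b -> fslice t' (fun c => w (c ** b)) N = q (fslice t (fun c => w (c ** b)) m).
  move=> Ab; have fwb := fun_mul_r csA fw Ab.
  apply: (bop_ext_span qd) => _ [c Bc [v _ <-]].
  rewrite -!bcompE; congr (bop_fun _ v).
  have ABbc : AB (op_tens t b c) by exact: min_tens_mem.
  rewrite -(fslice_mul_r csA (q c) fw sN Ab fwb) -fE// N_mul//.
  rewrite fslice_f//; last by case: (mm ABbc).
  by rewrite (fslice_mul_r csA c fw sm Ab fwb) qm//; exact: Bm.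
apply/eqP; rewrite -subr_eq0; apply/eqP/rnm_small => e e0.
have s0 : 0 < rnm N + rnm m + 1 by rewrite ltr_wpDl// addr_ge0 ?rnm_ge0.
have d0 : 0 < e / (rnm N + rnm m + 1) by rewrite divr_gt0.
have [b [Ab _ wb]] := fun_right_unit csA fw d0.
have fwb := fun_mul_r csA fw Ab.
apply: (le_trans (rnm_tri (fslice t' (fun c => w (c ** b)) N) _ _)).
rewrite {2}key// -(star_homB csB hq)//; [|exact: Bm|exact: Bm].
have h1 := fslice_diff csA fw Ab (ltW d0) wb sN.
have h2 := fslice_diff csA fw Ab (ltW d0) wb sm.
have [sB _ _ _] := csB.
have h3 := star_hom_contr csB hq (subB sB (Bm _ fwb) (Bm _ fw)).
rewrite rnmBC in h2; apply: (le_trans (lerD h1 (le_trans h3 h2))).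
rewrite -mulrDr mulrAC ler_pdivrMr// ler_pM2l// lerDl//.
Qed.

End AmplifiedRight.
(** * Convolution on a quantum group *)

Lemma slr_nondegenerate (R : realType) (H K L : hilbert R) (t : htensor H K L)
    (A : set (bop H H)) (D : set K) X y :
  cstar_algebra A -> closed_span D = setT ->
  (forall x, D x -> A (slr t x y X)) -> forall x, A (slr t x y X).
Proof.
move=> csA Dd AX x; have [sA cA _ _] := csA.
have : closed_span D x by rewrite Dd.
move: x; apply: (closed_span_ind (P := fun x => A (slr t x y X))); last first.
- by move=> x Dx; exact: AX.
- apply: (@closed_lip _ _ _ A (fun x => slr t x y X) (rnm X * rnm y)) => // u v.
  rewrite -(scaleN1r (slr t v y X)) addrC -slr_linl scaleN1r addrC.
  by rewrite (le_trans (rnm_slr _ _ _ _))// mulrAC.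
split; last by move=> c u v Au Av /=; rewrite slr_linl; case: sA => _; apply.
rewrite /=; have := slr_linl t (-1) 0 0 y X; rewrite !scaleN1r oppr0 addr0 addNr => ->.
exact: sub0.
Qed.

Section QuantumGroup.
Variables (R : realType) (G : lcqg R).
Local Notation A := (C0 G).
Local Notation t := (qg_t G).
Local Notation tl := (qg_tl G).
Local Notation tr := (qg_tr G).
Local Notation D := (Delta G).

(** The map [conv_op w] read off from matrix coefficients; on [C0 G] the two agree by [conv_opE]. *)
Definition lconv (w : bop (qg_H G) (qg_H G) -> R[i]) a := fslice t w (D a).

Lemma Delta_hom : star_hom A D.
Proof. by case: (lcqg_comultiplication G). Qed.

Lemma Delta_multiplier a : A a -> multiplier (@C0C0 R G) (D a).
Proof. by case: (lcqg_comultiplication G) => _ h _ _; exact: h. Qed.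

Lemma Delta_bid_tens a b : A a -> A b -> @C0C0 R G (D a ** op_tens t (bid _) b).
Proof.
have [_ <-] := lcqg_cancellation G => Aa Ab; apply: closed_span_sub.
by exists a => //; exists b.
Qed.

Lemma Delta_tens_bid a b : A a -> A b -> @C0C0 R G (D a ** op_tens t b (bid _)).
Proof.
have [<- _] := lcqg_cancellation G => Aa Ab; apply: closed_span_sub.
by exists a => //; exists b.
Qed.

(** By cancellation [Delta a (1 (x) b)] is in the minimal tensor product, so slices at the vectors
    [b z] lie in [A]; these vectors span a dense subspace. *)
Lemma slab_Delta a : A a -> slab t A (D a).
Proof.
move=> Aa x y; move: x.
apply: (slr_nondegenerate (C0_cstar G) (C0_nondegenerate G)) => _ [b Ab [z _ <-]].
rewrite -[slr _ _ _ _]bcomp1r -slr_mul_r.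
exact: (slab_min_tens (C0_cstar G) (Delta_bid_tens Aa Ab)).
Qed.

(** The other cancellation law: slicing by [w (. b)] amounts to slicing [Delta a (b (x) 1)] by [w],
    and [w] is approximated by such functionals. *)
Lemma lconv_mem w a : functional A w -> A a -> A (lconv w a).
Proof.
move=> fw Aa; have csA := C0_cstar G; have [sA cA _ _] := csA.
apply: (proj1 (closed_rnm A) cA) => e e0.
have n0 : 0 < rnm (D a) + 1 by rewrite ltr_wpDl ?rnm_ge0.
have d0 : 0 < e / (rnm (D a) + 1) by rewrite divr_gt0.
have [b [Ab _ wb]] := fun_right_unit csA fw d0.
have fwb := fun_mul_r csA fw Ab; have sD := slab_Delta Aa.
exists (fslice t (fun c => w (c ** b)) (D a)).
  rewrite -[fslice _ _ _]bcomp1r -(fslice_mul_r csA _ fw sD Ab fwb).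
  exact: (fslice_min_tens csA fw sA cA (Delta_tens_bid Aa Ab)).
apply: (le_lt_trans (fslice_diff csA fw Ab (ltW d0) wb sD)).
by rewrite mulrAC ltr_pdivrMr// ltr_pM2l// ltrDl.
Qed.

Lemma Delta_nondegenerate : closed_span [set D a v | a in A & v in setT] = setT.
Proof.
set S := [set D a v | a in A & v in setT].
have sS := closed_span_subspace S; have cS := @closed_span_closed _ _ S.
apply/seteqP; split=> // z _.
have : closed_span [set (X : bop (qg_H2 G) (qg_H2 G)) v | X in @C0C0 R G & v in setT] z.
  rewrite (min_tens_nondegenerate t (C0_nondegenerate G) (C0_nondegenerate G)).
  by [].
apply: closed_span_ind => // _ [X CX [v _ <-]].
have [_ _ Cd _] := lcqg_comultiplication G; move: CX; rewrite -Cd.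
move: X; apply: (closed_span_ind (P := fun X : bop (qg_H2 G) (qg_H2 G) => closed_span S (X v))).
- split; first by rewrite bop0; exact: sub0.
  by move=> c X Y SX SY; rewrite bopD bopZ; case: sS => _; apply.
- apply: (@closed_lip _ _ _ _ (fun X : bop _ _ => X v) (rnm v)) => // X Y.
  by rewrite -bopB mulrC rnm_bop.
move=> _ [a Aa [Y CY <-]]; rewrite bcompE; apply: closed_span_sub.
by exists a => //; exists (Y v).
Qed.

Lemma conv_opE w a : functional A w -> A a -> conv_op w a = lconv w a.
Proof.
move=> fw Aa; have csA := C0_cstar G.
apply: (strict_ext_slice csA csA fw (Delta_multiplier Aa) (slab_Delta Aa)).
exact: C0_nondegenerate.
Qed.

Lemma convolutionE w v a : functional A w -> functional A v -> A a ->
  convolution w v a = v (lconv w a).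
Proof.
move=> fw fv Aa; have csA := C0_cstar G.
apply: (functional_ext_slice csA csA fw (Delta_multiplier Aa) (slab_Delta Aa) fv).
exact: lconv_mem.
Qed.

(** Slicing two legs at once in one bracketing of the cube is slicing them one after the other in
    the other bracketing. *)
Lemma slr_cube X x y z z' : slr tr (t x z) (t y z') X = slr t x y (slr tl z z' X).
Proof.
by apply: bop_dot_ext => u v; rewrite !slr_dot !qg_tA.
Qed.

Lemma slr_Delta_id a z z' : A a ->
  slr tl z z' (Delta_id (D a)) = D (slr t z z' (D a)).
Proof.
move=> Aa; have csA := C0_cstar G.
exact: (amplified_ext_slr tl csA csA Delta_hom Delta_nondegenerate (C0_nondegenerate G)
  (Delta_multiplier Aa) (slab_Delta Aa)).
Qed.

Lemma slab_Delta_id a : A a -> slab tr A (Delta_id (D a)).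
Proof.
move=> Aa; have csA := C0_cstar G.
have [_ _ _ aA] := csA; set N := Delta_id _.
move=> x y; move: x; apply: (slr_nondegenerate csA (htens_dense t)) => _ [x _ [z _ <-]].
(* [slr_nondegenerate] varies only the vector to which the operator is applied; an adjoint moves [y]
   there. *)
rewrite -[slr _ _ _ _]adjK slr_adj; apply: (aA); move: y.
apply: (slr_nondegenerate csA (htens_dense t)) => _ [y _ [z' _ <-]].
rewrite -slr_adj; apply: (aA).
by rewrite slr_cube slr_Delta_id//; apply/slab_Delta/slab_Delta.
Qed.

(** Coassociativity replaces [Delta (x) id] by [id (x) Delta], through which the slice of the first
    leg passes. *)
Lemma fslice_Delta_id w a : functional A w -> A a ->
  fslice tr w (Delta_id (D a)) = D (lconv w a).
Proof.
move=> fw Aa; have csA := C0_cstar G; have sN := slab_Delta_id Aa.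
have [_ _ _ coass] := lcqg_comultiplication G.
rewrite coass// in sN *.
apply: (amplified_right_fslice csA csA Delta_hom Delta_nondegenerate
  (C0_nondegenerate G) (Delta_multiplier Aa) (slab_Delta Aa) fw sN).
by move=> v fv; exact: lconv_mem.
Qed.

(** By the two orders of slicing the cube, the slice of [Delta (L a)] at [z, z'] is [L] of the slice
    of [Delta a]; then [w L = w]. *)
Lemma lconv_idem w a : functional A w -> (forall b, A b -> w (lconv w b) = w b) ->
  A a -> lconv w (lconv w a) = lconv w a.
Proof.
move=> fw wL Aa; have csA := C0_cstar G; apply: bop_dot_ext => z z'.
have sN := slab_Delta_id Aa; have sD := slab_Delta Aa.
rewrite (fsliceP csA _ _ fw (slab_Delta (lconv_mem fw Aa))) (fsliceP csA _ _ fw sD).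
rewrite -(wL (slr t z z' (D a)))//; congr (w _).
rewrite -fslice_Delta_id//; apply: bop_dot_ext => u v.
rewrite slr_dot (fsliceP csA _ _ fw sN) slr_cube slr_Delta_id//.
by rewrite (fsliceP csA _ _ fw (slab_Delta (sD z z'))).
Qed.

End QuantumGroup.
(** * Norm-attaining functionals and their absolute values *)

Lemma le0_small (R : realType) (x M : R) : (forall e, 0 < e -> x <= e * M) -> x <= 0.
Proof.
move=> h; rewrite leNgt; apply/negP => x0.
have M1 : 0 < 2 * (`|M| + 1) by rewrite mulr_gt0// ltr_wpDl.
have := h (x / (2 * (`|M| + 1))) (divr_gt0 x0 M1).
rewrite mulrAC ler_pdivlMr// => h1.
have h2 : x * M <= x * `|M| by rewrite ler_pM2l// ler_norm.
by have := mulr_ge0 (ltW x0) (normr_ge0 M); lra.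
Qed.

Section Norming.
Variables (R : realType) (H : hilbert R) (A : set (bop H H)).
Hypothesis csA : cstar_algebra A.

(** Same perturbation as in [norming_unit], around the midpoint of [c] and [c']: the row of their
    half sum and half difference is a contraction by the parallelogram law. *)
Lemma norming_cauchy w (e : R) c c' b : functional A w -> fun_bound A w 1 -> 0 < e ->
  A c -> A c' -> rnm c <= 1 -> rnm c' <= 1 ->
  1 - e ^+ 2 <= complex.Re (w c) -> 1 - e ^+ 2 <= complex.Re (w c') -> A b ->
  cab (w (c ** b) - w (c' ** b)) <= 3 * e * rnm b.
Proof.
have [sA cA mA aA] := csA.
move=> fw w1 e0 Ac Ac' c1 c1' wc wc' Ab; apply: cab_perturb => // [|k]; first exact: rnm_ge0.
pose y := 2^-1%:C *: (c + c') ** bid H + 2^-1%:C *: (c - c') ** ((2%:C * k) *: b).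
have yE : y = 2^-1%:C *: (c + c') + k *: ((c - c') ** b).
  rewrite /y bcomp1r bcompZl bcompZr scalerA mulrA -rCM mulVf ?pnatr_eq0// rC1 mul1r.
  by [].
have Ay : A y by rewrite yE; apply: subD => //;
  apply: subZ => //; [exact: subD|apply: mA => //; exact: subB].
have ny : rnm y <= (1 + 4 * (cab k * rnm b) ^+ 2 + 1) / 2.
  apply: rnm_rowcol => // [|v|u]; first by have := sqr_ge0 (cab k * rnm b); lra.
    rewrite bidE bopZ rnmZ cabM cab_real ger0_norm// [(1 + _) * _]mulrDl mul1r lerD2l.
    rewrite !exprMn; have -> : 4 * (cab k ^+ 2 * rnm b ^+ 2) * rnm v ^+ 2 =
      2 ^+ 2 * cab k ^+ 2 * (rnm b * rnm v) ^+ 2 by ring.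
    apply: ler_wpM2l; first by rewrite mulr_ge0 ?sqr_ge0.
    rewrite ler_pXn2r ?nnegrE ?mulr_ge0 ?rnm_ge0//.
    exact: rnm_bop.
  rewrite !adjZ adjD adjB !bopZ bopD bopB !rnmZ cab_conj cab_real.
  rewrite ger0_norm ?invr_ge0// !exprMn -mulrDr parallelogram.
  have h (d : bop H H) : rnm d <= 1 -> rnm (adj d u) ^+ 2 <= rnm u ^+ 2.
    move=> d1; rewrite ler_pXn2r ?nnegrE ?rnm_ge0// (le_trans (rnm_bop _ _))//.
    by rewrite rnm_adj ler_piMl ?rnm_ge0.
  have := h _ c1; have := h _ c1'.
  by move: (rnm _ ^+ 2) (rnm _ ^+ 2) (rnm _ ^+ 2) => p q r; lra.
have := le_trans (Re_le _) (w1.2 y Ay); rewrite mul1r => /le_trans/(_ ny).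
rewrite {1}yE (funD fw) ?(funZ csA fw) ?bcompBl ?(funB csA fw) ?(funD fw)//;
  do ?[exact: mA | exact: subD | apply: subZ => // | apply: subB => //].
rewrite ReD Re_scale ReD; move: (complex.Re (k * _)) => z.
move: wc wc'; move: (e ^+ 2) ((cab k * rnm b) ^+ 2).
by move: (complex.Re (w c)) (complex.Re (w c')) => *; lra.
Qed.

(** By [norming_cauchy], [w (c b)] converges as [w c] tends to 1. A defect [e^2] in [w c] costs [e]
    in the functional, hence the squares. *)
Lemma norming_limit w : functional A w -> fun_bound A w 1 ->
  (forall e : R, 0 < e -> exists c, [/\ A c, rnm c <= 1 & 1 - e <= complex.Re (w c)]) ->
  exists2 psi, functional A psi & forall e c, 0 < e -> A c -> rnm c <= 1 ->
    1 - e ^+ 2 <= complex.Re (w c) -> forall b, A b ->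
    cab (w (c ** b) - psi b) <= 3 * e * rnm b.
Proof.
have [sA cA mA aA] := csA; move=> fw w1 wn.
have n0 (n : nat) : 0 < n.+1%:R^-1 :> R by rewrite invr_gt0.
have /choice[c cP] := fun n : nat => wn _ (exprn_gt0 2 (n0 n)).
have {}cP (n N : nat) : (N <= n)%N -> [/\ A (c n), rnm (c n) <= 1 &
    1 - N.+1%:R^-1 ^+ 2 <= complex.Re (w (c n))].
  move=> Nn; have [Ac c1 wc] := cP n; split=> //; apply: le_trans wc.
  rewrite lerD2l lerN2 ler_pXn2r ?nnegrE ?invr_ge0//.
  by rewrite lef_pV2 ?posrE ?ltr0n// ler_nat.
have /choice[psi psiP] : forall b, exists l, A b -> forall e c, 0 < e -> A c -> rnm c <= 1 ->
    1 - e ^+ 2 <= complex.Re (w c) -> cab (w (c ** b) - l) <= 3 * e * rnm b.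
  move=> b; have [Ab|nAb] := pselect (A b); last by exists 0.
  have [|l lP] := @complex_complete _ (fun n => w (c n ** b)).
    move=> e e0; have d0 : 0 < e / (3 * rnm b + 1).
      by rewrite divr_gt0// ltr_wpDl// mulr_ge0// rnm_ge0.
    have [N _ hN] := near_infty_natSinv_lt (PosNum d0).
    exists N => m n Nm Nn; have [? ? ?] := cP _ _ Nm; have [? ? ?] := cP _ _ Nn.
    apply: (@le_lt_trans _ _ (3 * N.+1%:R^-1 * rnm b)); first exact: norming_cauchy.
    have := hN N (leqnn N); rewrite /= ltr_pdivlMr; last by rewrite ltr_wpDl// mulr_ge0// rnm_ge0.
    apply: le_lt_trans.
    by rewrite mulrDr mulr1 (mulrC 3) -mulrA lerDl ltW.
  exists l => _ e c' e0 Ac' c1' wc'; apply/ler_addgt0Pr => d d0.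
  have [N1 h1] := lP d d0; have [N2 _ h2] := near_infty_natSinv_lt (PosNum e0).
  pose n := maxn N1 N2; have [Ac c1 wc] := cP n n (leqnn n).
  have wce : 1 - e ^+ 2 <= complex.Re (w (c n)).
    apply: le_trans wc; rewrite lerD2l lerN2 ler_pXn2r ?nnegrE ?ltW//.
    exact: (h2 n (leq_maxr _ _)).
  apply: (le_trans (cab_tri (w (c n ** b)) _ _)); apply: lerD.
    exact: norming_cauchy.
  exact/ltW/h1/leq_maxl.
exists psi => [|e c' e0 Ac' c1' wc' b Ab]; last exact: psiP.
have wn2 (e : R) : 0 < e -> exists c, [/\ A c, rnm c <= 1 & 1 - e ^+ 2 <= complex.Re (w c)].
  by move=> e0; apply: wn; exact: exprn_gt0.
(* A crude bound: the error 3 at [e = 1] plus the norm of [w]. The sharp bound 1 is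
   [polar_bound]. *)
apply: (@functional_intro _ _ _ _ 4) => [k a b Aa Ab|a Aa].
  have Aab : A (k *: a + b) by case: sA => _; apply.
  apply/eqP; rewrite -subr_eq0; apply/eqP/cab_eq0/le_anti; rewrite cab_ge0 andbT.
  apply: (@le0_small _ _ (3 * rnm (k *: a + b) + cab k * (3 * rnm a) + 3 * rnm b)) => e e0.
  have [d [Ad d1 wd]] := wn2 e e0.
  have h1 := psiP _ Aab _ _ e0 Ad d1 wd; have h2 := psiP _ Aa _ _ e0 Ad d1 wd.
  have h3 := psiP _ Ab _ _ e0 Ad d1 wd.
  have -> : psi (k *: a + b) - (k * psi a + psi b) =
      - (w (d ** (k *: a + b)) - psi (k *: a + b)) + k * (w (d ** a) - psi a) +
      (w (d ** b) - psi b).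
    by rewrite bcompDr bcompZr (fun_lin fw) //; [ring|exact: mA|exact: mA].
  apply: (le_trans (cabD _ _)); apply: (le_trans (lerD (cabD _ _) (lexx _))).
  rewrite cabN cabM; have h4 := ler_wpM2l (cab_ge0 k) h2.
  apply: (le_trans (lerD (lerD h1 h4) h3)).
  by rewrite le_eqVlt; apply/orP; left; apply/eqP; ring.
have [d [Ad d1 wd]] := wn2 1 ltr01; have := psiP _ Aa _ _ ltr01 Ad d1 wd.
have := w1.2 _ (mA _ _ Ad Aa); rewrite mul1r mulr1.
have := cab_tri (w (d ** a)) (psi a) 0; rewrite !subr0 (cabBC (psi a)).
have : rnm (d ** a) <= rnm a.
  by rewrite (le_trans (rnm_bcomp _ _))// ler_piMl ?rnm_ge0.
by move: (cab _) (cab _) (cab _) (rnm _) (rnm _) => *; lra.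
Qed.

Lemma Re_fadj (w : bop H H -> R[i]) c : complex.Re (fadj w (adj c)) = complex.Re (w c).
Proof. by rewrite /fadj adjK Re_cj. Qed.

(** An approximate polar decomposition: [c] plays the adjoint of the partial isometry, with
    [psi = w (c .)], [om = w (. c)] and, back again, [w = psi (c' .) = om (. c')]. Positivity of
    [psi] and [om] is a consequence. *)
Definition polar w psi om :=
  [/\ functional A w, fun_bound A w 1, functional A psi, functional A om &
   forall e : R, 0 < e -> exists c, [/\ A c, rnm c <= 1, 1 - e <= complex.Re (w c) &
    forall b, A b -> [/\ cab (w (c ** b) - psi b) <= e * rnm b,
      cab (w (b ** c) - om b) <= e * rnm b,
      cab (psi (adj c ** b) - w b) <= e * rnm b &
      cab (om (b ** adj c) - w b) <= e * rnm b]]].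

Lemma polar_exists w : functional A w -> fun_bound A w 1 ->
  (forall e : R, 0 < e -> exists c, [/\ A c, rnm c <= 1 & 1 - e <= complex.Re (w c)]) ->
  exists psi om, polar w psi om.
Proof.
have [sA cA mA aA] := csA; move=> fw w1 wn.
have [psi fpsi psiP] := norming_limit fw w1 wn.
have fw' := fadj_functional csA fw; have w1' := fadj_bound csA w1.
have [|om fom omP] := norming_limit fw' w1'.
  move=> e /wn[c [Ac c1 wc]]; exists (adj c).
  by rewrite rnm_adj Re_fadj; split=> //; exact: aA.
exists psi, (fadj om); split=> //; first exact: fadj_functional.
(* Two errors [3 d] add up in the last two estimates, and [d <= 1] gives [d^2 <= e]. *)
move=> e e0; pose d := Num.min 1 (e / 6).
have d0 : 0 < d by rewrite lt_min ltr01 divr_gt0.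
have de : d <= e / 6 by rewrite ge_min lexx orbT.
have d3 : 3 * d <= e by lra.
have d6 : 6 * d = 3 * d + 3 * d by ring.
have d1 : d <= 1 by rewrite ge_min lexx.
have dd : d ^+ 2 <= d by rewrite expr2 (ler_piMl (ltW d0)).
have [c [Ac c1 wc]] := wn _ (exprn_gt0 2 d0).
have Ac' := aA _ Ac; have c1' : rnm (adj c) <= 1 by rewrite rnm_adj.
have wc' : 1 - d ^+ 2 <= complex.Re (fadj w (adj c)) by rewrite Re_fadj.
exists c; split=> // [|b Ab]; first by apply: le_trans wc; lra.
have Ab' := aA _ Ab.
have h1 := psiP _ _ d0 Ac c1 wc _ Ab; have h2 := omP _ _ d0 Ac' c1' wc' _ Ab'.
have h3 := psiP _ _ d0 Ac c1 wc _ (mA _ _ Ac' Ab).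
have h4 := omP _ _ d0 Ac' c1' wc' _ (mA _ _ Ac Ab').
have h5 := norming_unit csA fw w1 d0 Ac c1 wc Ab.
have h6 := norming_unit csA fw' w1' d0 Ac' c1' wc' Ab'.
have n3 : 3 * d * rnm b <= e * rnm b by rewrite ler_wpM2r ?rnm_ge0.
have n6 : 3 * d * rnm b + 3 * d * rnm b <= e * rnm b.
  by rewrite -mulrDl -d6 ler_wpM2r ?rnm_ge0// -ler_pdivlMl// mulrC.
have nb (x : bop H H) : rnm x <= 1 -> 3 * d * rnm (x ** b) <= 3 * d * rnm b.
  move=> x1; rewrite ler_wpM2l ?(mulr_ge0 _ (ltW d0))//.
  by rewrite (le_trans (rnm_bcomp _ _))// ler_piMl ?rnm_ge0.
have nb' : 3 * d * rnm (c ** adj b) <= 3 * d * rnm b.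
  rewrite ler_wpM2l ?(mulr_ge0 _ (ltW d0))//.
  by rewrite (le_trans (rnm_bcomp _ _))// rnm_adj ler_piMl ?rnm_ge0.
split.
- exact: le_trans n3.
- apply: le_trans n3; rewrite -cab_conj rmorphB/= /fadj conjCK.
  by move: h2; rewrite /fadj adjM !adjK rnm_adj.
- apply: le_trans n6; apply: (le_trans (cab_tri (w (c ** (adj c ** b))) _ _)).
  apply: lerD; last by rewrite bcompA.
  by rewrite cabBC; exact: le_trans h3 (nb _ c1').
- apply: le_trans n6; rewrite -cab_conj rmorphB/= /fadj conjCK adjM adjK.
  have -> : cj (w b) = fadj w (adj b) by rewrite /fadj adjK.
  apply: (le_trans (cab_tri (fadj w (adj c ** (c ** adj b))) _ _)).
  apply: lerD; first by rewrite cabBC; exact: le_trans h4 nb'.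
  by move: h6; rewrite adjK rnm_adj bcompA.
Qed.

Lemma polar_adj w psi om : polar w psi om -> polar (fadj w) (fadj om) (fadj psi).
Proof.
have [sA cA mA aA] := csA; move=> [fw w1 fpsi fom wn].
split; [exact: fadj_functional|exact: fadj_bound|exact: fadj_functional| |].
  exact: fadj_functional.
move=> e /wn[c [Ac c1 wc h]]; exists (adj c); rewrite rnm_adj; split=> //.
- exact: aA.
- by rewrite Re_fadj.
move=> b Ab; have [h1 h2 h3 h4] := h _ (aA _ Ab); rewrite rnm_adj in h1 h2 h3 h4.
by rewrite /fadj !adjM !adjK -!rmorphB/= !cab_conj; split.
Qed.

End Norming.

(** * The first order inequality for absolute values *)

Lemma rnm_row_contraction (R : realType) (H K : hilbert R) (V : bop K H) (t : R) u :
  rnm ((bid H - (t ^+ 2 / 2)%:C *: (V ** adj V)) u) ^+ 2 + rnm ((t%:C *: adj V) u) ^+ 2 <=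
  (1 + t ^+ 4 / 4 * rnm V ^+ 4) * rnm u ^+ 2.
Proof.
rewrite bopB bidE !bopZ rnm_sqB !rnmZ !cab_real !exprMn dotZr.
have -> : cj (t ^+ 2 / 2)%:C = (t ^+ 2 / 2)%:C :> R[i] by exact: conjc_real.
rewrite Re_scale bcompE adjP' dotxx/= !real_normK ?num_real//.
have : rnm (V (adj V u)) ^+ 2 <= (rnm V ^+ 2 * rnm u) ^+ 2.
  rewrite ler_pXn2r ?nnegrE ?mulr_ge0 ?sqr_ge0 ?rnm_ge0//.
  rewrite (le_trans (rnm_bop _ _))// expr2 -mulrA ler_wpM2l ?rnm_ge0//.
  by rewrite -(rnm_adj V) rnm_bop.
move=> h; have {h} := ler_wpM2l (sqr_ge0 (t ^+ 2 / 2)) h.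
move: (rnm (V _)) (rnm (adj V u)) (rnm V) (rnm u) => x y v z.
have -> : (t ^+ 2 / 2) ^+ 2 * (v ^+ 2 * z) ^+ 2 = t ^+ 4 / 4 * v ^+ 4 * z ^+ 2 by field.
by lra.
Qed.

(** The final bookkeeping of [polar_le], with [s] for [t ^+ 2] and [q] for [t ^+ 4]. *)
Lemma polar_arith (R : realType) (s q e k c x y z4 z a p V T na np : R) :
  1 - e <= c ->
  c - s / 2 * (k * c + x) - s / 2 * y + q * (2^-1 / 2) * z4 + s * z <=
    (1 + q / 4 * T ^+ 4 + (1 + q / 4 * V ^+ 4)) / 2 ->
  s * (k * c) <= s * k -> s * x <= s * (a + e * na) -> s * y <= s * (p + e * np) ->
  q * 2^-1 ^+ 2 * - (V ^+ 2 * T ^+ 2) <= q * 2^-1 ^+ 2 * z4 ->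
  s * (2 * z - k - a - p) <= 2 * e + s * e * (na + np) +
    q * ((V ^+ 4 + T ^+ 4) / 4 + V ^+ 2 * T ^+ 2 / 2).
Proof. by move=> *; lra. Qed.

Section Polar.
Variables (R : realType) (H : hilbert R) (A : set (bop H H)).
Hypothesis csA : cstar_algebra A.
Variables w psi om : bop H H -> R[i].
Hypothesis pw : polar A w psi om.

Lemma polar_le (K : hilbert R) (V : bop K H) (T : bop H K) (k : R) a :
  0 <= k -> A a -> V ** adj V = k%:C *: bid H + a -> A (adj T ** T) -> A (V ** T) ->
  2 * complex.Re (w (V ** T)) <= k + complex.Re (om a) + complex.Re (psi (adj T ** T)).
Proof.
have [sA cA mA aA] := csA; have [fw w1 fpsi fom wn] := pw.
move=> k0 Aa VE AT AVT; set p := adj T ** T in AT *.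
set Z := complex.Re (w (V ** T)).
pose C := (rnm V ^+ 4 + rnm T ^+ 4) / 4 + rnm V ^+ 2 * rnm T ^+ 2 / 2.
have key (t e : R) : 0 < e -> t ^+ 2 * (2 * Z - k - complex.Re (om a) - complex.Re (psi p)) <=
    2 * e + t ^+ 2 * e * (rnm a + rnm p) + t ^+ 4 * C.
  move=> e0; have [c [Ac c1 wc h]] := wn e e0.
  have [_ h2 _ _] := h a Aa; have [h1 _ _ _] := h p AT.
  set r := (t ^+ 2 / 2)%:C : R[i].
  set X := bid H - r *: (V ** adj V); set Y := bid H - r *: p.
  (* The row [(X c, t V)] times the column [(Y, t T)]. Since [(1 - r P)^2 + 2 r P = 1 + r^2 P^2],
     both have squared norm [1 + O(t^4)]. *)
  pose y := (X ** c) ** Y + (t%:C *: V) ** (t%:C *: T).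
  have AVc : A (V ** adj V ** c).
    by rewrite VE bcompDl bcompZl bcomp1l; apply: (subD sA); [exact: subZ|exact: mA].
  have Acp := mA _ _ Ac AT; have AVcp := mA _ _ AVc AT.
  have yE : y = c - r *: (V ** adj V ** c) - r *: (c ** p) +
      (r * r) *: (V ** adj V ** c ** p) + (t ^+ 2)%:C *: (V ** T).
    rewrite /y /X /Y bcompZl bcompZr scalerA -rCM -expr2.
    rewrite !(bcompBl, bcompBr, bcomp1l, bcomp1r, bcompZl, bcompZr).
    by rewrite scalerA opprD opprK !addrA.
  have Ar1 := subZ sA r AVc; have Ar2 := subZ sA r Acp; have Ar3 := subZ sA (r * r) AVcp.
  have Ar4 := subZ sA (t ^+ 2)%:C AVT; have As1 := subB sA Ac Ar1; have As2 := subB sA As1 Ar2.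
  have As3 := subD sA As2 Ar3.
  have Ay : A y by rewrite yE; exact: (subD sA As3 Ar4).
  have ny : rnm y <= (1 + t ^+ 4 / 4 * rnm T ^+ 4 + (1 + t ^+ 4 / 4 * rnm V ^+ 4)) / 2.
    have pos (v : R) : 0 <= 1 + t ^+ 4 / 4 * v ^+ 4.
      by rewrite addr_ge0// mulr_ge0 ?divr_ge0// exprn_even_ge0.
    apply: rnm_rowcol => [||v|u]; [exact: pos|exact: pos| |].
      by have := rnm_row_contraction (adj T) t v; rewrite !adjK rnm_adj.
    apply: le_trans (rnm_row_contraction V t u); rewrite adjZ adjM.
    have -> : cj t%:C = t%:C :> R[i] by exact: conjc_real.
    have rr : cj r = r by exact: conjc_real.
    have -> : adj X = X by rewrite /X adjB adjZ adj1 adjM adjK rr.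
    rewrite lerD2r ler_pXn2r ?nnegrE ?rnm_ge0// bcompE (le_trans (rnm_bop _ _))//.
    by rewrite rnm_adj ler_piMl ?rnm_ge0.
  have wy := le_trans (le_trans (Re_le _) (w1.2 y Ay)) _; rewrite mul1r in wy.
  have {wy} := wy _ ny; rewrite yE.
  rewrite (funD fw)// (funD fw)// !(funB csA fw)// !(funZ csA fw)//.
  rewrite -rCM !ReD !ReN !Re_scale -/Z.
  have -> : w (V ** adj V ** c) = k%:C * w c + w (a ** c).
    by rewrite VE bcompDl bcompZl bcomp1l (fun_lin fw)//; exact: mA.
  have w4 : - (rnm V ^+ 2 * rnm T ^+ 2) <= complex.Re (w (V ** adj V ** c ** p)).
    have := norm_Re_le (w (V ** adj V ** c ** p)); have := w1.2 _ AVcp.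
    have : rnm (V ** adj V ** c ** p) <= rnm V ^+ 2 * rnm T ^+ 2.
      rewrite (le_trans (rnm_bcomp _ _))// -rnm_cstar' -rnm_cstar ler_wpM2r ?rnm_ge0//.
      by rewrite (le_trans (rnm_bcomp _ _))// ler_piMr ?rnm_ge0.
    rewrite mul1r ler_norml => g1 g2 /andP[g3 _].
    by apply: le_trans g3; rewrite lerN2; exact: le_trans g2 g1.
  rewrite ReD Re_scale; have := Re_le (w c); have := w1.2 c Ac; rewrite mul1r.
  have := Re_le (w (a ** c) - om a); have := Re_le (w (c ** p) - psi p).
  rewrite !ReB /C.
  move: (complex.Re (w _)) w4 wc h1 h2.
  move=> z4 w4 wc h1 h2 g1 g2 g3 g4 g5.
  (* The scalar part of [V V'] contributes through [w c <= 1], in place of a value of [om] at the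
     unit. *)
  have kw : k * complex.Re (w c) <= k by rewrite ler_piMr// (le_trans g4)// (le_trans g3).
  have g6 : complex.Re (w (a ** c)) <= complex.Re (om a) + e * rnm a.
    by rewrite -lerBlDl; exact: le_trans g2 h2.
  have g7 : complex.Re (w (c ** p)) <= complex.Re (psi p) + e * rnm p.
    by rewrite -lerBlDl; exact: le_trans g1 h1.
  have t2 : 0 <= t ^+ 2 by exact: sqr_ge0.
  have f1 := ler_wpM2l t2 kw; have f2 := ler_wpM2l t2 g6; have f3 := ler_wpM2l t2 g7.
  have f4 := ler_wpM2l (sqr_ge0 (t ^+ 2 / 2)) w4.
  have t4 : (t ^+ 2) ^+ 2 = t ^+ 4 by ring.
  move: g5 f1 f2 f3 f4; rewrite -/p exprMn t4 mulrACA -expr2 t4.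
  exact: (polar_arith wc).
set D := 2 * Z - _ - _ - _ in key; suff : D <= 0.
  by rewrite /D; move: (complex.Re (om a)) (complex.Re (psi p)) => *; lra.
(* At fixed [s = t^2] the error [e] tends to 0; then, after division by [s], so does [s]. *)
apply: (@le0_small _ _ C) => s s0; set t := Num.sqrt s.
have t2 : t ^+ 2 = s by rewrite sqr_sqrtr// ltW.
have t4 : t ^+ 4 = s * s by rewrite -t2; ring.
rewrite -subr_le0 -(ler_pM2l s0) mulr0.
apply: (@le0_small _ _ (2 + s * (rnm a + rnm p))) => e e0.
have := key t e e0; rewrite t2 t4; move: (rnm a + rnm p) => *; lra.
Qed.

Lemma polar_cstar_ge0 T : A T -> 0 <= complex.Re (psi (adj T ** T)).
Proof.
have [sA cA mA aA] := csA; have [fw w1 fpsi fom wn] := pw; move=> AT.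
have e0 : (0 : bop H H) ** adj 0 = 0%:C *: bid H + 0.
  by rewrite bcomp0l addr0; exact/esym/scale0r.
have := @polar_le H 0 T 0 0 (lexx 0) (sub0 sA) e0.
rewrite bcomp0l => /(_ (mA _ _ (aA _ AT) AT) (sub0 sA)).
by rewrite (fun0 csA fw) (fun0 csA fom) mulr0 !add0r.
Qed.

Lemma polar_bound : fun_bound A psi 1.
Proof.
have [sA cA mA aA] := csA; have [fw w1 fpsi fom wn] := pw; split=> // b Ab.
rewrite mul1r -subr_le0; apply: (@le0_small _ _ (rnm b)) => e /wn[c [Ac c1 _ h]].
have [h1 _ _ _] := h b Ab; have := cab_tri (w (c ** b)) (psi b) 0; rewrite !subr0 (cabBC (psi b)).
have := w1.2 _ (mA _ _ Ac Ab); rewrite mul1r.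
have : rnm (c ** b) <= rnm b by rewrite (le_trans (rnm_bcomp _ _))// ler_piMl ?rnm_ge0.
by move: h1; move: (cab _) (cab (w _)) (rnm (c ** b)) (cab (psi b)) => *; lra.
Qed.

(** For self-adjoint [h], [1 + i t h] has squared norm at most [1 + t^2 |h|^2], so
    [w (c (1 + i t h))] cannot exceed 1 to first order in [t]. *)
Lemma polar_self_adjoint h : A h -> adj h = h -> complex.Im (psi h) = 0.
Proof.
have [sA cA mA aA] := csA; have [fw w1 fpsi fom wn] := pw; move=> Ah hh.
have key (t : R) : - t * complex.Im (psi h) <= t ^+ 2 * rnm h ^+ 2 / 2.
  rewrite -subr_le0; apply: (@le0_small _ _ (1 + `|t| * rnm h)) => e /wn[c [Ac c1 wc wh]].
  have [h1 _ _ _] := wh h Ah; set k : R[i] := 0 +i* t.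
  (* The zero entries only bring the product into the form of [rnm_rowcol]. *)
  pose y := c ** (bid H + k *: h) + (0 : bop H H) ** (0 : bop H H).
  have Ach := mA _ _ Ac Ah.
  have yE : y = c + k *: (c ** h).
    by rewrite /y bcomp0l addr0 bcompDr bcomp1r bcompZr.
  have Ay : A y by rewrite yE; apply: (subD sA) => //; exact: subZ.
  have ny : rnm y <= (1 + t ^+ 2 * rnm h ^+ 2 + 1) / 2.
    apply: rnm_rowcol => // [|v|u].
    - by rewrite addr_ge0// mulr_ge0 ?sqr_ge0.
    - rewrite bop0 rnm0 expr0n addr0 bopD bidE bopZ rnm_sqD rnmZ dotZr.
      have hr : complex.Im (hdot H v (h v)) = 0.
        have : hdot H v (h v) = cj (hdot H v (h v)) by rewrite -dotC adjP hh.
        by case: (hdot H v (h v)) => x z [/eqP]; rewrite -addr_eq0 -mulr2n mulrn_eq0/= => /eqP.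
      have -> : complex.Re (cj k * hdot H v (h v)) = 0.
        by case: (hdot H v (h v)) hr => x z /= ->; rewrite mul0r mulr0 subr0.
      have -> : cab k = `|t| by rewrite /cab normc_def/= expr0n add0r sqrtr_sqr.
      rewrite mulr0 addr0 mulrDl mul1r lerD2l exprMn real_normK ?num_real// -mulrA.
      rewrite ler_wpM2l ?sqr_ge0// -exprMn ler_pXn2r ?nnegrE ?mulr_ge0 ?rnm_ge0//.
      exact: rnm_bop.
    - rewrite adj0 bop0 rnm0 expr0n addr0 mul1r ler_pXn2r ?nnegrE ?rnm_ge0//.
      by rewrite (le_trans (rnm_bop _ _))// rnm_adj ler_piMl ?rnm_ge0.
  have := le_trans (le_trans (Re_le _) (w1.2 y Ay)); rewrite mul1r => /(_ _ ny).
  rewrite yE (funD fw)//; last exact: subZ.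
  rewrite (funZ csA fw)// ReD.
  have -> : complex.Re (k * w (c ** h)) = - t * complex.Im (w (c ** h)).
    by case: (w _) => x z /=; rewrite mul0r add0r mulNr.
  have := norm_Im_le (w (c ** h) - psi h) => h2; have {h1 h2} h3 := le_trans h2 h1.
  have := ler_norm (- t * complex.Im (psi h - w (c ** h))).
  rewrite normrM normrN => h4.
  have {h3 h4} h5 : - t * complex.Im (psi h - w (c ** h)) <= `|t| * (e * rnm h).
    rewrite (le_trans h4)// ler_wpM2l//; apply: le_trans h3.
    by rewrite -opprB raddfN normrN.
  move: h5 wc; rewrite raddfB/=.
  move: (complex.Im (psi h)) (complex.Im (w _)) (complex.Re (w _)) (rnm h) `|t| => p q r n T.
  by lra.
set z := complex.Im (psi h) in key *.
have z0 : `|z| <= 0.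
  apply: (@le0_small _ _ (rnm h ^+ 2 / 2)) => e e0.
  rewrite -(ler_pM2l e0) mulrA -expr2 mulrA.
  have h1 := key e; have := key (- e); rewrite sqrrN opprK => h2.
  by rewrite -[X in X * `|z|]gtr0_norm// -normrM ler_norml; move: h1 h2; lra.
by apply/eqP; rewrite -normr_eq0 eq_le z0 normr_ge0.
Qed.

Lemma polar_hermitian b : A b -> fadj psi b = psi b.
Proof.
have [sA cA mA aA] := csA; have [fw w1 fpsi fom wn] := pw; move=> Ab.
have Ab' := aA _ Ab.
have h1 : complex.Im (psi (b + adj b)) = 0.
  by apply: polar_self_adjoint; [exact: (subD sA)|rewrite adjD adjK addrC].
have h2 : complex.Im (psi ('i%C *: (b - adj b))) = 0.
  apply: polar_self_adjoint; first by apply: (subZ sA); exact: subB.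
  rewrite adjZ adjB adjK (_ : cj 'i%C = - 'i%C) ?scaleNr -?scalerN ?opprB//.
  by apply/eqP; rewrite eq_complex/= oppr0 !eqxx.
move: h1 h2; rewrite (funD fpsi)// (funZ csA fpsi) ?(funB csA fpsi)//; last exact: subB.
rewrite /fadj; case: (psi b) (psi (adj b)) => [x y] [x' y'] /= h1 h2.
by apply/eqP; rewrite eq_complex/=; apply/andP; split; apply/eqP; move: h1 h2; lra.
Qed.

Lemma polar_positive : positive_functional A psi.
Proof.
have [sA cA mA aA] := csA; have [_ _ fpsi _ _] := pw; split=> // _ [T AT <-].
rewrite lecE/= polar_cstar_ge0// andbT; apply/eqP/polar_self_adjoint.
  by apply: mA => //; exact: aA.
by rewrite adjM adjK.
Qed.

End Polar.

(** Both absolute values being hermitian, passing to the adjoint of [w] interchanges them; each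
    one-sided result then yields its mirror image. *)
Lemma polar_flip (R : realType) (H : hilbert R) (A : set (bop H H)) w psi om :
  cstar_algebra A -> polar A w psi om -> polar A (fadj w) om psi.
Proof.
move=> csA pw; have [sA cA mA aA] := csA.
have pw' := polar_adj csA pw; have [fw' w1' _ _ wn] := pw'.
have hp := polar_hermitian csA pw.
have ho b : A b -> fadj om b = om b by move/(polar_hermitian csA pw'); rewrite fadjK.
have [_ _ fpsi fom _] := pw; split=> // e /wn[c [Ac c1 wc h]]; exists c; split=> // b Ab.
by have := h b Ab; rewrite !ho ?hp//; apply: mA => //; exact: aA.
Qed.
(** * The conditional expectation *)

Section WeightDensity.
Variables (R : realType) (H : hilbert R) (A : set (bop H H)) (phi : bop H H -> \bar R).
Hypotheses (csA : cstar_algebra A) (wphi : proper_weight A phi).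

Lemma weight_mono a b : positive A a -> A b -> qpos (b - a) ->
  (phi a <= phi b)%E /\ phi b = (phi a + phi (b - a)%R)%E.
Proof.
have [sA cA mA aA] := csA; have [[w0 wD wZ] _ _ _] := wphi.
move=> pa Ab q; have Aa : A a by case: pa => c Ac <-; apply: mA => //; exact: aA.
have pb : positive A (b - a) by apply: qpos_sqrt => //; exact: subB.
have -> : phi b = (phi a + phi (b - a)%R)%E by rewrite -wD// addrC subrK.
by split=> //; rewrite leeDl// w0.
Qed.

Lemma weight_scale_fin (r : R) a : 0 <= r -> positive A a -> (phi a < +oo)%E ->
  (phi (r%:C *: a)%R < +oo)%E.
Proof.
have [[w0 wD wZ] _ _ _] := wphi; move=> r0 pa fa; rewrite wZ//.
by have := w0 _ pa; case: (phi a) fa => // x _ _; rewrite -EFinM ltry.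
Qed.

(** From [(a p)' (a p) <= |a|^2 p^2] and [p^2 <= (|p| + 1) p]; the summand 1 covers [p = 0]. *)
Lemma qpos_cut (a p : bop H H) : qpos p ->
  qpos ((rnm a ^+ 2 * (rnm p + 1))%:C *: p - adj (a ** p) ** (a ** p)).
Proof.
move=> pp; have [ps p0] := pp; split.
  set r := (rnm a ^+ 2 * _)%:C; have rr : cj r = r by exact: conjc_real.
  by rewrite adjB adjZ rr !adjM !adjK ps.
move=> v; rewrite bopB dotBl ReB bopZ dotZl Re_scale adj_comp_dot bcompE/=.
have n0 : 0 < rnm p + 1 by rewrite ltr_wpDl ?rnm_ge0.
have h1 : rnm (p v) ^+ 2 <= (rnm p + 1) * complex.Re (hdot H (p v) v).
  set r := (rnm p + 1)^-1; have r0 : 0 < r by rewrite invr_gt0.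
  have := @qpos_sq_le _ _ (r%:C *: p) v (qposZ (ltW r0) pp).
  rewrite rnmZ cab_real gtr0_norm// mulrC ler_pdivrMr// mul1r lerDl ler01 => /(_ isT).
  rewrite bopZ rnmZ cab_real gtr0_norm// dotZl Re_scale exprMn expr2 -mulrA ler_pM2l//.
  by rewrite /r ler_pdivrMl.
have h2 : rnm (a (p v)) ^+ 2 <= rnm a ^+ 2 * rnm (p v) ^+ 2.
  by rewrite -exprMn ler_pXn2r ?nnegrE ?mulr_ge0 ?rnm_ge0// rnm_bop.
rewrite subr_ge0 (le_trans h2)// -mulrA ler_wpM2l ?sqr_ge0//.
Qed.

(** Approximate [a] by [a u^2] with [u] from an approximate unit, then [u^2] by a positive [p] of
    finite weight; [qpos_cut] bounds the weight of [(a p)' (a p)]. *)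
Lemma weight_dense a (e : R) : A a -> 0 < e ->
  exists b, [/\ A b, (phi (adj b ** b) < +oo)%E & rnm (a - b) < e].
Proof.
have [sA cA mA aA] := csA; have [[w0 wD wZ] _ wd _] := wphi; move=> Aa e0.
have e3 : 0 < e / 3 by rewrite divr_gt0.
have [u [Au u1 uu us]] := @approx_unit_exists _ _ _ csA [:: a] (e / 3)
  (fun b bs => eq_ind_r A Aa (eqP (etrans (esym (mem_seq1 b a)) bs))) e3.
have [_ au] := us a (mem_head _ _).
have n0 : 0 < rnm a + 1 by rewrite ltr_wpDl ?rnm_ge0.
have d0 : 0 < e / 3 / (rnm a + 1) by rewrite divr_gt0.
have [|p [pp fp] up] := proj1 (closure_rnm _ _) (wd (adj u ** u) _) _ d0.
  by exists u.
have Ap : A p by case: pp => c Ac <-; apply: mA => //; exact: aA.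
exists (a ** p); split; first exact: mA.
  apply: le_lt_trans (weight_scale_fin (r := rnm a ^+ 2 * (rnm p + 1)) _ pp fp).
    apply: (proj1 (weight_mono _ _ _)).
    - by exists (a ** p) => //; exact: mA.
    - exact: subZ.
    - exact: qpos_cut (positive_qpos pp).
  by rewrite mulr_ge0 ?sqr_ge0// ltW// ltr_wpDl ?rnm_ge0.
have -> : a - a ** p = - (a ** u - a) - (a ** u - a) ** u + a ** (adj u ** u - p).
  by rewrite uu; bop_ring.
have h1 : rnm ((a ** u - a) ** u) < e / 3.
  by apply: le_lt_trans au; rewrite (le_trans (rnm_bcomp _ _))// ler_piMr ?rnm_ge0.
have h2 : rnm (a ** (adj u ** u - p)) <= e / 3.
  rewrite (le_trans (rnm_bcomp _ _))// (@le_trans _ _ ((rnm a + 1) * rnm (adj u ** u - p)))//.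
    by rewrite ler_wpM2r ?rnm_ge0// lerDl.
  by move: up; rewrite ltr_pdivlMr// mulrC => /ltW.
apply: (le_lt_trans (rnmD _ _)); apply: (le_lt_trans (lerD (rnmB _ _) (lexx _))).
rewrite rnmN; move: au h1 h2; move: (rnm _) (rnm _) (rnm _) => *; lra.
Qed.

End WeightDensity.

(** * Left convolution and the Haar weight *)

Section LeftConvolution.
Variables (R : realType) (G : lcqg R).
Local Notation A := (C0 G).
Local Notation t := (qg_t G).
Local Notation D := (Delta G).
Let csA := C0_cstar G.
Implicit Type w : bop (qg_H G) (qg_H G) -> R[i].

Lemma lconvP w a x y : functional A w -> A a ->
  hdot _ (lconv w a x) y = w (slr t x y (D a)).
Proof. by move=> fw Aa; rewrite (fsliceP csA _ _ fw)//; exact: slab_Delta. Qed.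

Lemma lconv_lin w c a b : functional A w -> A a -> A b ->
  lconv w (c *: a + b) = c *: lconv w a + lconv w b.
Proof.
move=> fw Aa Ab; have [Dl _ _] := Delta_hom G.
by rewrite /lconv Dl// (fslice_lin csA c fw)//; exact: slab_Delta.
Qed.

Lemma rnm_lconv w M a : functional A w -> fun_bound A w M -> A a ->
  rnm (lconv w a) <= M * rnm a.
Proof.
move=> fw wM Aa; have M0 := wM.1.
apply: (le_trans (rnm_fslice csA fw wM (slab_Delta Aa))).
by rewrite ler_wpM2l// (star_hom_contr csA (Delta_hom G)).
Qed.

Lemma lconvB w a b : functional A w -> A a -> A b ->
  lconv w (a - b) = lconv w a - lconv w b.
Proof. by move=> fw Aa Ab; rewrite addrC -scaleN1r lconv_lin// scaleN1r addrC. Qed.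

Lemma lconv_adj w a : functional A w -> A a -> lconv (fadj w) (adj a) = adj (lconv w a).
Proof.
move=> fw Aa; have [_ _ Da] := Delta_hom G.
by rewrite /lconv Da// (fslice_adj csA fw)//; exact: slab_Delta.
Qed.

Lemma lconv_eq w v a : functional A w -> functional A v ->
  (forall b, A b -> w b = v b) -> A a -> lconv w a = lconv v a.
Proof.
move=> fw fv wv Aa; apply: bop_dot_ext => x y; rewrite !lconvP// wv//.
exact: slab_Delta.
Qed.

Lemma slr_cstar (X : bop (qg_H2 G) (qg_H2 G)) (x : qg_H G) :
  adj (X ** leg t x) ** (X ** leg t x) = slr t x x (adj X ** X).
Proof. by rewrite /slr adjM !bcompA. Qed.

Lemma slr_ADelta a x y : A a -> A (slr t x y (D a)).
Proof. by move=> /slab_Delta; exact. Qed.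

End LeftConvolution.
Section PolarConvolution.
Variables (R : realType) (G : lcqg R).
Local Notation A := (C0 G).
Local Notation t := (qg_t G).
Local Notation D := (Delta G).
Let csA := C0_cstar G.
Variables w psi om : bop (qg_H G) (qg_H G) -> R[i].
Hypothesis pw : polar A w psi om.

(** In [polar_le] take [T = Delta a (1 (x) x)] and [V = (1 (x) y)'] with [y = L a x]. Then [V V'] is
    the scalar [|y|^2], [w (V T)] is [<L a x, y> = |y|^2] and [T' T] is a slice of
    [Delta (a' a)]. *)
Lemma lconv_square_le a : A a ->
  qpos (lconv psi (adj a ** a) - adj (lconv w a) ** lconv w a).
Proof.
have [sA cA mA aA] := csA; have [fw w1 fpsi fom wn] := pw; move=> Aa.
have [_ Dm Da] := Delta_hom G; have Aaa := mA _ _ (aA _ Aa) Aa.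
split.
  rewrite adjB !adjM adjK -lconv_adj// adjM adjK; congr (_ - _).
  apply: lconv_eq => //; first exact: fadj_functional.
  by move=> b; exact: (polar_hermitian csA pw).
move=> x; set y := lconv w a x.
have TT : adj (D a ** leg t x) ** (D a ** leg t x) = slr t x x (D (adj a ** a)).
  by rewrite slr_cstar Dm ?Da//; exact: aA.
have VV : adj (leg t y) ** adj (adj (leg t y)) = (rnm y ^+ 2)%:C *: bid (qg_H G) + 0.
  by rewrite adjK addr0 adj_leg_leg dotxx.
have := polar_le csA pw (sqr_ge0 (rnm y)) (sub0 sA) VV; rewrite -/A => /(_ (D a ** leg t x)).
rewrite TT bcompA -/(slr t x y (D a)) => /(_ (slr_ADelta _ _ Aaa) (slr_ADelta _ _ Aa)).
rewrite (fun0 csA fom) -lconvP// -/y dotxx -lconvP// bopB dotBl ReB adj_comp_dot -/y/=.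
by rewrite addr0; lra.
Qed.

(** For a fixed point of finite weight, [L_psi (x' x) - x' x] is positive of weight 0, hence 0. A
    general [x = L x] is a limit of [L a] with [a' a] of finite weight, and by [lconv_square_le]
    these have finite weight too. *)
Lemma lconv_haar x : A x -> lconv w x = x -> (forall a, A a -> lconv w (lconv w a) = lconv w a) ->
  lconv psi (adj x ** x) = adj x ** x.
Proof.
have [sA cA mA aA] := csA; have [fw w1 fpsi fom wn] := pw; move=> Ax xL LL.
have [phi [[wphi _] fphi lphi]] := lcqg_left_haar G.
have [[w0 wD wZ] _ _ _] := wphi.
have fin a : A a -> (phi (adj a ** a) < +oo)%E ->
    (phi (lconv psi (adj a ** a)) <= phi (adj a ** a))%E.
  move=> Aa fa; have pa : positive A (adj a ** a) by exists a.
  have Aaa := mA _ _ (aA _ Aa) Aa.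
  have := lphi _ _ (polar_positive csA pw) pa fa.
  rewrite -[slice_l _ _]/(conv_op psi (adj a ** a)) conv_opE// => ->.
  have := functional_unit_le csA fpsi (polar_bound csA pw).
  have := w0 _ pa; case: (phi _) fa => // r _; rewrite lee_fin => r0 u1.
  by rewrite -EFinM lee_fin ler_piMl.
have stable a : A a -> (phi (adj a ** a) < +oo)%E ->
    (phi (adj (lconv w a) ** lconv w a) < +oo)%E.
  move=> Aa fa; have Aaa := mA _ _ (aA _ Aa) Aa; have AL := lconv_mem fw Aa.
  apply: (le_lt_trans _ (le_lt_trans (fin _ Aa fa) fa)).
  apply: (proj1 (weight_mono csA wphi _ (lconv_mem fpsi Aaa) (lconv_square_le Aa))).
  by exists (lconv w a).
have fixed y : A y -> lconv w y = y -> (phi (adj y ** y) < +oo)%E ->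
    lconv psi (adj y ** y) = adj y ** y.
  move=> Ay yL fy; have Ayy := mA _ _ (aA _ Ay) Ay; have AL := lconv_mem fpsi Ayy.
  have := lconv_square_le Ay; rewrite yL => q.
  have py : positive A (adj y ** y) by exists y.
  have [_ h] := weight_mono csA wphi py AL q.
  have pd : positive A (lconv psi (adj y ** y) - adj y ** y).
    by apply: qpos_sqrt => //; exact: subB.
  apply/eqP; rewrite -subr_eq0; apply/eqP/fphi => //.
  have := fin _ Ay fy; rewrite h; have := w0 _ pd; have := w0 _ py.
  case: (phi (adj y ** y)) fy => // r _; case: (phi _) => // s.
  by rewrite -EFinD !lee_fin => r0 s0 rs; congr (_%:E); lra.
have M0 : 0 <= 2 * rnm x + 1 by rewrite addr_ge0// mulr_ge0 ?rnm_ge0.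
apply/eqP; rewrite -subr_eq0; apply/eqP/rnm_eq0/le_anti; rewrite rnm_ge0 andbT.
apply: (@le0_small _ _ (2 * (2 * rnm x + 1))) => e e0.
(* The bound 1 gives [rnm y <= rnm x + 1], so that [x' x - y' y] has norm at most
   [d (2 |x| + 1)]. *)
pose d := Num.min 1 e; have d0 : 0 < d by rewrite lt_min ltr01.
have d1 : d <= 1 by rewrite ge_min lexx.
have de : d <= e by rewrite ge_min lexx orbT.
have [a [Aa fa xa]] := weight_dense csA wphi Ax d0.
pose y := lconv w a; have Ay : A y by exact: lconv_mem.
have xy : rnm (x - y) < d.
  rewrite -xL /y -lconvB//; apply: le_lt_trans xa; rewrite -[leRHS]mul1r.
  by apply: rnm_lconv => //; exact: subB.
have yy := fixed y Ay (LL _ Aa) (stable _ Aa fa).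
have Axx := mA _ _ (aA _ Ax) Ax; have Ayy := mA _ _ (aA _ Ay) Ay.
have dxy : rnm (adj x ** x - adj y ** y) <= d * (2 * rnm x + 1).
  have -> : adj x ** x - adj y ** y = adj x ** (x - y) + adj (x - y) ** y.
    by rewrite adjB; bop_ring.
  have ny : rnm y <= rnm x + 1.
    have := rnm_tri x y 0; rewrite !subr0 rnmBC; move: xy d1.
    by move: (rnm _) (rnm y) (rnm x) => *; lra.
  rewrite (le_trans (rnmD _ _))// (le_trans (lerD (rnm_bcomp _ _) (rnm_bcomp _ _)))//.
  rewrite !rnm_adj; have := rnm_ge0 (x - y); have := rnm_ge0 x; have := rnm_ge0 y.
  by move: xy ny; move: (rnm _) (rnm x) (rnm y) => *; nra.
have -> : lconv psi (adj x ** x) - adj x ** x =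
    lconv psi (adj x ** x - adj y ** y) - (adj x ** x - adj y ** y).
  by rewrite lconvB// yy opprB addrA subrK.
rewrite (le_trans (rnmB _ _))//.
have := rnm_lconv fpsi (polar_bound csA pw) (subB sA Axx Ayy); rewrite mul1r.
have : d * (2 * rnm x + 1) <= e * (2 * rnm x + 1) by rewrite ler_wpM2r.
by move: dxy; move: (rnm _) (rnm (lconv _ _)) (d * _) => *; lra.
Qed.

Let om_adj b : A b -> om (adj b) = cj (om b).
Proof.
by move=> Ab; rewrite -(polar_hermitian csA (polar_flip csA pw) Ab) /fadj conjCK.
Qed.

Variable x : bop (qg_H G) (qg_H G).
Hypotheses (Ax : A x) (xL : lconv w x = x) (xx : lconv psi (adj x ** x) = adj x ** x).

(* The square inequality is an equality at [x], so the expansion of [polar_le] at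
   [V = adj (leg t (x z)) + s *: W] has vanishing linear term in [s]. *)
Lemma polar_transport z (W : bop (qg_H2 G) (qg_H G)) :
  A (W ** (D x ** leg t z)) -> A (W ** leg t (x z)) -> A (W ** adj W) ->
  w (W ** (D x ** leg t z)) = om (W ** leg t (x z)).
Proof.
have [sA cA mA aA] := csA; have [fw w1 fpsi fom wn] := pw; move=> A0 A1 AW.
have [_ Dm Da] := Delta_hom G; have Axx := mA _ _ (aA _ Ax) Ax.
set T := D x ** leg t z in A0 *; set B := W ** leg t (x z) in A1 *.
have TT : adj T ** T = slr t z z (D (adj x ** x)).
  by rewrite slr_cstar Dm ?Da//; exact: aA.
set C := complex.Re (om (W ** adj W)).
have key (s : R[i]) : 2 * complex.Re (s * (w (W ** T) - om B)) <= cab s ^+ 2 * C.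
  pose V := adj (leg t (x z)) + s *: W.
  (* What remains of [V V'] beyond the scalar. At a fixed point the terms of order zero in [s] are
     [2 |x z|^2] on both sides and cancel. *)
  pose a := s *: B + (cj s *: adj B + (cab s ^+ 2)%:C *: (W ** adj W)).
  have AB' := aA _ A1; have Aa : A a.
    by apply: (subD sA); [exact: subZ|apply: (subD sA); exact: subZ].
  have ss : s * cj s = (cab s ^+ 2)%:C by rewrite -normCK cabE -rmorphXn.
  have VV : V ** adj V = (rnm (x z) ^+ 2)%:C *: bid (qg_H G) + a.
    rewrite /V /a adjD adjK adjZ bcompDl !bcompDr !bcompZl !bcompZr scalerA ss.
    rewrite adj_leg_leg dotxx /B adjM -!addrA; congr (_ + _).
    by rewrite addrCA.
  have A2 : A (adj (leg t (x z)) ** T) by rewrite /T bcompA; exact: slr_ADelta.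
  have VT : V ** T = adj (leg t (x z)) ** T + s *: (W ** T).
    by rewrite /V bcompDl bcompZl.
  have AV : A (V ** T) by rewrite VT; apply: (subD sA) => //; exact: subZ.
  have AT : A (adj T ** T) by rewrite TT; exact: slr_ADelta.
  have := polar_le csA pw (sqr_ge0 (rnm (x z))) Aa VV AT AV.
  rewrite VT (funD fw)//; last exact: subZ.
  rewrite (funZ csA fw)// {1}/T bcompA -/(slr t z (x z) (D x)) -lconvP// xL dotxx.
  rewrite TT -lconvP// xx adj_comp_dot /a (fun_lin fom)//; last first.
    by apply: (subD sA); exact: subZ.
  rewrite (fun_lin fom)//; last exact: subZ.
  rewrite (funZ csA fom)// om_adj// mulrBr !ReD ReN Re_scale -rmorphM.
  have -> : complex.Re (cj (s * om B)) = complex.Re (s * om B) by rewrite Re_cj.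
  rewrite -/C/=; move: (complex.Re _) (complex.Re _) (rnm (x z) ^+ 2) (cab s ^+ 2 * C) => *; lra.
apply/eqP; rewrite -subr_eq0; apply/eqP/cab_eq0/le_anti; rewrite cab_ge0 andbT.
have [s s1 sz] := Re_phase (w (W ** T) - om B).
apply: (@le0_small _ _ (C / 2)) => e e0; have := key (e%:C * s).
rewrite -mulrA sz -rCM/= cabM s1 mulr1 cab_real gtr0_norm//.
by move=> h; rewrite -(ler_pM2l e0); move: h; move: (cab _) => *; lra.
Qed.

(** [polar_transport] at [W = (1 (x) y)' Delta a], read as an equality of matrix coefficients at
    [z, y]. *)
Lemma lconv_mul_right a : A a -> lconv w (a ** x) = lconv om a ** x.
Proof.
have [sA cA mA aA] := csA; have [fw w1 fpsi fom wn] := pw; move=> Aa.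
have Aa' := aA _ Aa; have [_ Dm Da] := Delta_hom G; apply: bop_dot_ext => z y.
rewrite bcompE !lconvP//; last exact: mA.
have h : adj (leg t y) ** D a ** (D x ** leg t z) = slr t z y (D (a ** x)).
  by rewrite Dm// /slr !bcompA.
rewrite -h polar_transport//.
- by rewrite h; apply/slr_ADelta/mA.
- exact: slr_ADelta.
- rewrite adjM adjK bcompA -(bcompA _ (D a)) -Da// -Dm//.
  exact/slr_ADelta/mA.
Qed.

(** Insert [c] into the previous choice of [W]: with [b] and [b'] the slices of [Delta (a x)] and
    [Delta a], [psi b] is close to [w (c b) = om (c b')], which is close to [fadj w b']. *)
Lemma lconv_mul_right_state a : A a -> lconv psi (a ** x) = lconv (fadj w) a ** x.
Proof.
have [sA cA mA aA] := csA; have [fw w1 fpsi fom wn] := pw; move=> Aa.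
have Aa' := aA _ Aa; have [_ Dm Da] := Delta_hom G; apply: bop_dot_ext => z y.
have fw' := fadj_functional csA fw.
rewrite bcompE !lconvP//; last exact: mA.
set b := slr t z y (D (a ** x)); set b' := slr t (x z) y (D a).
have Ab : A b by apply/slr_ADelta/mA.
have Ab' : A b' by exact: slr_ADelta.
apply/eqP; rewrite -subr_eq0; apply/eqP/cab_eq0/le_anti; rewrite cab_ge0 andbT.
apply: (@le0_small _ _ (rnm b + rnm b')) => e /wn[c [Ac c1 _ h]].
have [h1 _ _ _] := h b Ab; have [_ _ _ h4] := h (adj b') (aA _ Ab').
have tr : w (c ** b) = om (c ** b').
  have bE : c ** (adj (leg t y) ** D a) ** (D x ** leg t z) = c ** b.
    by rewrite /b Dm// /slr !bcompA.
  have b'E : c ** (adj (leg t y) ** D a) ** leg t (x z) = c ** b'.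
    by rewrite -bcompA.
  rewrite -bE polar_transport ?bE ?b'E//; [exact: mA|exact: mA|].
  have -> : c ** (adj (leg t y) ** D a) ** adj (c ** (adj (leg t y) ** D a)) =
      c ** slr t y y (D (a ** adj a)) ** adj c.
    by rewrite Dm// Da// /slr !adjM !adjK !bcompA.
  apply: (mA); last exact: aA.
  by apply: (mA) => //; exact/slr_ADelta/mA.
have h4' : cab (om (c ** b') - fadj w b') <= e * rnm b'.
  rewrite -cab_conj rmorphB/= -om_adj; last exact: mA.
  by rewrite adjM /fadj conjCK -(rnm_adj b').
apply: (le_trans (cab_tri (w (c ** b)) _ _)).
by rewrite cabBC {2}tr mulrDr lerD.
Qed.

End PolarConvolution.

(** * Ternary identities for a contractive idempotent *)

Section ContractiveIdempotent.
Variables (R : realType) (G : lcqg R).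
Local Notation A := (C0 G).
Let csA := C0_cstar G.
Implicit Type w : bop (qg_H G) (qg_H G) -> R[i].

(** Otherwise [w] is bounded by some [q < 1]. As [w = w L] and [L] is bounded by [q] as well, [w] is
    bounded by every [q ^ n] and vanishes. *)
Lemma idempotent_norming w : functional A w -> fun_bound A w 1 ->
  (exists2 a, A a & w a != 0) -> (forall a, A a -> w (lconv w a) = w a) ->
  forall e : R, 0 < e -> exists c, [/\ A c, rnm c <= 1 & 1 - e <= complex.Re (w c)].
Proof.
have [sA cA mA aA] := csA; move=> fw w1 [a Aa wa] wL e e0; apply: contrapT => h.
have {}h c : A c -> rnm c <= 1 -> complex.Re (w c) < 1 - e.
  by move=> Ac c1; rewrite ltNge; apply/negP => wc; apply: h; exists c.
set q := 1 - e in h.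
have q0 : 0 < q by have := h 0 (sub0 sA); rewrite rnm0 (fun0 csA fw); exact.
have wq : fun_bound A w q.
  split; first exact: ltW.
  move=> b Ab; have [b0|b0] := eqVneq (rnm b) 0.
    by rewrite (rnm_eq0 b0) (fun0 csA fw) cab0 rnm0 mulr0.
  have bp : 0 < rnm b by rewrite lt_neqAle eq_sym b0 rnm_ge0.
  have [s s1 sb] := Re_phase (w b); pose k := (rnm b)^-1%:C * s.
  have := h (k *: b) (subZ sA k Ab).
  rewrite rnmZ cabM s1 mulr1 cab_real ger0_norm ?invr_ge0 ?rnm_ge0// mulVf// lexx => /(_ isT).
  rewrite (funZ csA fw)// -mulrA sb -rCM/= mulrC ltr_pdivrMr//.
  exact: ltW.
have wqn n : fun_bound A w (q ^+ n).
  elim: n => [|n [_ IH]]; first by rewrite expr0.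
  split=> [|b Ab]; first by rewrite exprn_ge0// ltW.
  rewrite -wL// (le_trans (IH _ (lconv_mem fw Ab)))// exprSr -mulrA.
  by apply: ler_wpM2l; [exact/exprn_ge0/ltW|exact: rnm_lconv].
have q1 : `|q| < 1 by rewrite gtr0_norm// /q; lra.
case/negP: wa; apply/eqP/cab_small => d d0.
have n0 : 0 < rnm a + 1 by rewrite ltr_wpDl ?rnm_ge0.
have /cvgrPdist_lt/(_ _ (divr_gt0 d0 n0))[N _ /(_ N (leqnn N))] := cvg_expr q1.
rewrite /= sub0r normrN ger0_norm; last exact/exprn_ge0/ltW.
rewrite ltr_pdivlMr// => qN.
apply: (le_trans ((wqn N).2 a Aa)); apply: le_trans (ltW qN).
by apply: ler_wpM2l; [exact/exprn_ge0/ltW|rewrite lerDl].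
Qed.

Lemma fadj_fadj w : fadj (fadj w) = w.
Proof. by apply/funext => a; rewrite fadjK. Qed.

Lemma lconv_fadj_idem w : functional A w ->
  (forall a, A a -> lconv w (lconv w a) = lconv w a) ->
  forall a, A a -> lconv (fadj w) (lconv (fadj w) a) = lconv (fadj w) a.
Proof.
have [sA cA mA aA] := csA; move=> fw LL a Aa; have Aa' := aA _ Aa.
by rewrite -(adjK a) !lconv_adj ?LL//; exact: lconv_mem.
Qed.

Section Expectation.
Variables w psi om : bop (qg_H G) (qg_H G) -> R[i].
Hypothesis pw : polar A w psi om.
Hypothesis LL : forall a, A a -> lconv w (lconv w a) = lconv w a.

Let LL' := lconv_fadj_idem (let: And5 fw _ _ _ _ := pw in fw) LL.

(** [lconv_mul_right_state] for the adjoint functional, whose right absolute value is [om] and which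
    fixes [adj x]. *)
Lemma lconv_mul_adj_right a x : A a -> A x -> lconv w x = x ->
  lconv om (a ** adj x) = lconv w a ** adj x.
Proof.
have [sA cA mA aA] := csA; have [fw _ _ _ _] := pw; move=> Aa Ax xL.
have Ax' := aA _ Ax; have xL' : lconv (fadj w) (adj x) = adj x by rewrite lconv_adj// xL.
have pf := polar_flip csA pw.
rewrite (lconv_mul_right_state pf Ax' xL' (lconv_haar pf Ax' xL' LL'))//.
by rewrite fadj_fadj.
Qed.

Lemma lconv_ternary_right a x y : A a -> A x -> A y -> lconv w x = x -> lconv w y = y ->
  lconv w (a ** adj x ** y) = lconv w a ** adj x ** y.
Proof.
have [sA cA mA aA] := csA; move=> Aa Ax Ay xL yL.
rewrite (lconv_mul_right pw Ay yL (lconv_haar pw Ay yL LL)); last exact/mA/aA.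
by rewrite lconv_mul_adj_right.
Qed.

(** [L (x a' y) = L_om (x a') y], and since [om] is hermitian [L_om (x a')] is the adjoint of
    [L_om (a x') = L a x']. *)
Lemma lconv_ternary_middle a x y : A a -> A x -> A y -> lconv w x = x -> lconv w y = y ->
  lconv w (x ** adj a ** y) = x ** adj (lconv w a) ** y.
Proof.
have [sA cA mA aA] := csA; have [fw w1 fpsi fom wn] := pw; move=> Aa Ax Ay xL yL.
have Ax' := aA _ Ax; have Aa' := aA _ Aa.
rewrite (lconv_mul_right pw Ay yL (lconv_haar pw Ay yL LL)); last exact: mA.
have fom' := fadj_functional csA fom; have Aax := mA _ _ Aa Ax'.
have h b : A b -> om b = fadj om b.
  by move=> Ab; rewrite (polar_hermitian csA (polar_flip csA pw)).
have -> : x ** adj a = adj (a ** adj x) by rewrite adjM adjK.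
rewrite (lconv_eq fom fom' h) ?lconv_adj//; last exact: aA.
by rewrite lconv_mul_adj_right// adjM adjK.
Qed.

End Expectation.

(** The adjoint of [lconv_ternary_right] for [fadj w]. *)
Lemma lconv_ternary_left w psi om a x y : polar A w psi om ->
  (forall a, A a -> lconv w (lconv w a) = lconv w a) ->
  A a -> A x -> A y -> lconv w x = x -> lconv w y = y ->
  lconv w (x ** adj y ** a) = x ** adj y ** lconv w a.
Proof.
have [sA cA mA aA] := csA; move=> pw LL Aa Ax Ay xL yL; have [fw _ _ _ _] := pw.
have pf := polar_flip csA pw; have fw' := fadj_functional csA fw.
have Ax' := aA _ Ax; have Ay' := aA _ Ay; have Aa' := aA _ Aa.
have LL' := lconv_fadj_idem fw LL.
have := lconv_ternary_right pf LL' Aa' Ay' Ax'; rewrite !lconv_adj// xL yL => /(_ erefl erefl).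
have Aaxy := mA _ _ (mA _ _ Aa' Ay) Ax'.
rewrite adjK => /(congr1 (@adj _ _ _)); rewrite -lconv_adj//.
by rewrite fadj_fadj !adjM !adjK !bcompA.
Qed.

End ContractiveIdempotent.
Theorem theorem3p3 (R : realType) (G : lcqg R)
    (w : bop (qg_H G) (qg_H G) -> R[i]) :
  coamenable G -> idempotent_functional w -> contractive_functional w ->
  sub_tro (C0 G) (conv_op w @` C0 G) /\
  tro_conditional_expectation (C0 G) (conv_op w @` C0 G) (conv_op w).
Proof.
move=> _ [fw wn0 ww] cw; have csA := C0_cstar G; have [sA cA mA aA] := csA.
have w1 : fun_bound (C0 G) w 1.
  by split=> // a Aa; rewrite mul1r -lecC -rnmE -cabE cw.
have wL a : C0 G a -> w (lconv w a) = w a by move=> Aa; rewrite -convolutionE// ww.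
have LL a : C0 G a -> lconv w (lconv w a) = lconv w a by exact: lconv_idem.
have [psi [om pw]] := polar_exists csA fw w1 (idempotent_norming fw w1 wn0 wL).
have LA a : C0 G a -> C0 G (lconv w a) by exact: lconv_mem.
(* Idempotence turns the image into a set of fixed points, which is closed because [L] is a
   contraction. *)
have XE : conv_op w @` C0 G = [set x | C0 G x /\ lconv w x = x].
  apply/seteqP; split=> [_ [a Aa <-]|x [Ax xL]].
    by rewrite conv_opE//; split; [exact: LA|exact: LL].
  by exists x => //; rewrite conv_opE.
split.
  split=> [_ [a Aa <-]|]; first by rewrite conv_opE//; exact: LA.
  rewrite XE; split.
  - split.
      split; first exact: sub0.
      by rewrite -(subrr 0) lconvB ?subrr//; exact: sub0.
    move=> c u v [Au uL] [Av vL]; split; first by case: sA => _; apply.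
    by rewrite lconv_lin// uL vL.
  - apply/closed_rnm => x h; have Ax : C0 G x.
      by apply: (proj1 (closed_rnm _) cA) => e e0; have [y [Ay _] xy] := h e e0; exists y.
    split=> //; apply/eqP; rewrite -subr_eq0; apply/eqP/rnm_small => e e0.
    have [y [Ay yL] xy] := h (e / 2) (divr_gt0 e0 (ltr0Sn _ 1)).
    apply: (le_trans (rnm_tri y _ _)); rewrite (rnmBC y) -{1}yL -lconvB//.
    have := rnm_lconv fw w1 (subB sA Ax Ay); rewrite mul1r; move: xy.
    by move: (rnm _) (rnm (lconv _ _)) => *; lra.
  - move=> a b c [Aa aL] [Ab bL] [Ac cL]; split.
      by apply: (mA) => //; apply: (mA) => //; exact: aA.
    by rewrite (lconv_ternary_right pw LL)// aL.
split=> //.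
- move=> c u v Au Av; rewrite !conv_opE ?lconv_lin//.
  by case: sA => _; apply.
- move=> a Aa; rewrite conv_opE// !rnmE lecC -[leRHS]mul1r.
  exact: rnm_lconv.
move=> a x y Aa; rewrite XE => -[Ax xL] [Ay yL].
have Axy : C0 G (x ** adj a ** y) by do !apply: (mA) => //; exact: aA.
have Aaxy : C0 G (a ** adj x ** y) by do !apply: (mA) => //; exact: aA.
have Axya : C0 G (x ** adj y ** a) by do !apply: (mA) => //; exact: aA.
rewrite !conv_opE//; split.
- exact: (lconv_ternary_right pw LL).
- exact: (lconv_ternary_middle pw LL).
- exact: (lconv_ternary_left pw LL).
Qed.
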